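(* Let $A$ be a unital C*-algebra, let $G$ be a discrete group acting on $A$ by *-automorphisms, and let $\tau \in T_G(A)$. Let $\pi : A \to B(H_\tau)$ be the GNS representation of $(A,\tau)$, let $M = \pi(A)''$, and let $\tau_M$ denote the corresponding faithful normal trace on $M$. Then the following sets are in natural bijection with each other: (1) The set of all weak expectations $F : A \rtimes_u G \to M$ for $(A,\tau,G)$. (2) The set of all families $\{x_t\}_{t \in G} \subseteq M$ satisfying: (a) $x_e = 1$; (b) $x_t y = (t \cdot y) x_t$ for all $y \in M$ and $t \in G$; (c) $s \cdot x_t = x_{sts^{-1}}$ for all $s,t \in G$; (d) the matrix $[x_{st^{-1}}]_{s,t \in \mathcal{F}}$ is positive for all finite $\mathcal{F} \subseteq G$. (3) $\{\sigma \in T(A \rtimes_u G) : \sigma|_A = \tau\}$. The natural map (bijection) from (1) to (2) is given by letting $x_t = F(t)$, and the natural map (bijection) from (2) to (3) is given by defining a trace $\sigma \in T(A \rtimes_u G)$ by $\sigma(at) = \tau_M(\pi(a)x_t)$ for $a \in A$, $t \in G$.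
   Context: ''Trace'' means tracial state. $T(B)$ is the set of tracial states on a unital C*-algebra $B$, and $T_G(A)$ is the set of tracial states on $A$ invariant under the action of $G$. $A \rtimes_u G$ is the universal (full) crossed product; the unitary in it corresponding to $t \in G$ is denoted by $t$. $e$ is the identity of $G$. For $\tau \in T_G(A)$ with GNS representation $\pi : A \to B(H_\tau)$ and $M = \pi(A)''$: there is a unique (automatically faithful) normal trace $\tau_M$ on $M$ with $\tau_M \circ \pi = \tau$, and the action of $G$ on $A$ induces a unique action of $G$ on $M$ by *-automorphisms with $s \cdot \pi(a) = \pi(s \cdot a)$; $M$ always carries this action. $G$ acts on $A \rtimes_u G$ by $s \cdot (at) = (s \cdot a)(sts^{-1})$ for $a \in A$, $s,t \in G$. A map $F : A \rtimes_u G \to M$ is a weak expectation for $(A,\tau,G)$ if it is unital, completely positive, $G$-equivariant, and satisfies $F|_A = \pi$. *)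

(* Defs.v *)
From HB Require Import structures.
From mathcomp Require Import all_boot all_order all_algebra.
From mathcomp Require Import complex.
From mathcomp Require Import all_classical all_reals all_analysis.
Set Implicit Arguments.
Unset Strict Implicit.
Unset Printing Implicit Defensive.
Import Order.TTheory GRing.Theory Num.Theory.
Import numFieldNormedType.Exports.
Local Open Scope classical_set_scope.
Local Open Scope ring_scope.

(** Norms take values in [R[i]] (as for any [normedModType R[i]]), and [0 <= z]
    in [R[i]] means that [z] is real and nonnegative. *)

(* The norm of a C*-algebra is a field [cnorm] because the library has no common
   substructure of [algType] and [normedModType], so that no structure can join
   them. *)
HB.mixin Record isCStarAlgebra (R : realType) A & GRing.Algebra R[i] A := {
  star : A -> A;
  starD : forall x y : A, star (x + y) = star x + star y;
  starZ : forall (k : R[i]) (x : A), star (k *: x) = k^* *: star x;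
  starM : forall x y : A, star (x * y) = star y * star x;
  starK : forall x : A, star (star x) = x;
  cnorm : A -> R[i];
  cnormD : forall x y : A, cnorm (x + y) <= cnorm x + cnorm y;
  cnormZ : forall (k : R[i]) (x : A), cnorm (k *: x) = `|k| * cnorm x;
  cnorm0_eq0 : forall x : A, cnorm x = 0 -> x = 0;
  cnormM : forall x y : A, cnorm (x * y) <= cnorm x * cnorm y;
  cstar_identity : forall x : A, cnorm (star x * x) = cnorm x ^+ 2;
  cnorm_complete : forall a : nat -> A,
    (forall e : R[i], 0 < e -> exists N : nat, forall m n : nat,
       (N <= m)%N -> (N <= n)%N -> cnorm (a m - a n) < e) ->
    exists l : A, forall e : R[i], 0 < e -> exists N : nat, forall n : nat,
       (N <= n)%N -> cnorm (a n - l) < e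
}.

#[short(type="cstarAlgType")]
HB.structure Definition CStarAlgebra (R : realType) :=
  {A of isCStarAlgebra R A & GRing.Algebra R[i] A}.

(* The inner product is linear in the first variable. *)
HB.mixin Record isHilbert (R : realType) H & CompleteNormedModule R[i] H := {
  ip : H -> H -> R[i];
  ip_linearl : forall (k : R[i]) (u v w : H),
    ip (k *: u + v) w = k * ip u w + ip v w;
  ip_conj : forall u v : H, ip v u = (ip u v)^*;
  ip_norm : forall u : H, ip u u = `|u| ^+ 2
}.

#[short(type="hilbertType")]
HB.structure Definition Hilbert (R : realType) :=
  {H of isHilbert R H & CompleteNormedModule R[i] H}.

Section CStar.
Context {R : realType}.

Definition star_hom (A B : cstarAlgType R) (f : A -> B) : Prop :=
  [/\ linear f, f 1 = 1, {morph f : x y / x * y} & {morph f : x / star x}].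

(* Each [alpha s] is invertible, with inverse [alpha s^-1]. *)
Definition cstar_action (G : groupType) (A : cstarAlgType R)
    (alpha : G -> A -> A) : Prop :=
  [/\ forall s, star_hom (alpha s),
      forall a, alpha 1%g a = a &
      forall s t a, alpha (s * t)%g a = alpha s (alpha t a)].

Definition tracial_state (A : cstarAlgType R) (tau : A -> R[i]) : Prop :=
  [/\ scalar tau, tau 1 = 1,
      forall a, 0 <= tau (star a * a) &
      forall a b, tau (a * b) = tau (b * a)].

Definition invariant_state (G : groupType) (A : cstarAlgType R)
    (alpha : G -> A -> A) (tau : A -> R[i]) : Prop :=
  forall s a, tau (alpha s a) = tau a.

Definition mxstar (A : cstarAlgType R) n (c : 'M[A]_n) : 'M[A]_n :=
  map_mx star c^T.

Definition mxpositive (A : cstarAlgType R) n (b : 'M[A]_n) : Prop :=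
  exists c : 'M[A]_n, b = mxstar c *m c.

End CStar.

(** B(H) is handled as a subset of the function space [H -> H]; its vector space
    operations are the pointwise ones, its product is [\o] and its unit is
    [idfun]. *)

Section Operators.
Context {R : realType} {H : hilbertType R}.
Implicit Types (x y T S : H -> H) (M : set (H -> H)).

Definition bounded_op T : Prop := linear T /\ continuous T.

Definition adjoint T S : Prop := forall u v, ip (T u) v = ip u (S v).

Definition positive_op T : Prop := forall v, 0 <= ip (T v) v.

Definition op_le T S : Prop := forall v, ip (T v) v <= ip (S v) v.

(* positivity of the operator on H^n with matrix [X] *)
Definition op_mx_positive n (X : 'I_n -> 'I_n -> H -> H) : Prop :=
  forall v : 'I_n -> H, 0 <= \sum_i \sum_j ip (X i j (v j)) (v i).

Definition commutant (D : set (H -> H)) : set (H -> H) :=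
  [set T | bounded_op T /\ forall S, D S -> T \o S = S \o T].

Definition selfadjoint_part M : set (H -> H) := [set x | M x /\ adjoint x x].

Definition directed_family (D : set (H -> H)) : Prop :=
  D !=set0 /\
  forall x y, D x -> D y -> exists z, [/\ D z, op_le x z & op_le y z].

Definition sa_lub M (D : set (H -> H)) x : Prop :=
  [/\ selfadjoint_part M x,
      forall y, D y -> op_le y x &
      forall z, selfadjoint_part M z -> (forall y, D y -> op_le y z) ->
        op_le x z].

(* preservation of suprema of bounded increasing nets of self-adjoint elements;
   an increasing net is given by its range, a directed subset *)
Definition normal_functional M (phi : (H -> H) -> R[i]) : Prop :=
  forall (D : set (H -> H)) x,
    D `<=` selfadjoint_part M -> directed_family D -> sa_lub M D x ->
    forall c, (forall y, D y -> phi y <= c) -> phi x <= c.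

(* Only the values of [phi] on [M] matter. *)
Record faithful_normal_trace M (phi : (H -> H) -> R[i]) : Prop := {
  fnt_linear : forall k x y, M x -> M y -> phi (k *: x + y) = k * phi x + phi y;
  fnt_unit : phi idfun = 1;
  fnt_positive : forall x, M x -> positive_op x -> 0 <= phi x;
  fnt_trace : forall x y, M x -> M y -> phi (x \o y) = phi (y \o x);
  fnt_faithful : forall x, M x -> positive_op x -> phi x = 0 -> x = 0;
  fnt_normal : normal_functional M phi
}.

Record vN_automorphism M (theta : (H -> H) -> (H -> H)) : Prop := {
  vna_bij : set_bij M M theta;
  vna_linear : forall k x y, M x -> M y ->
    theta (k *: x + y) = k *: theta x + theta y;
  vna_mul : forall x y, M x -> M y -> theta (x \o y) = theta x \o theta y;
  vna_star : forall x y, M x -> M y -> adjoint x y -> adjoint (theta x) (theta y)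
}.

Definition vN_action (G : groupType) M (beta : G -> (H -> H) -> (H -> H)) : Prop :=
  [/\ forall s, vN_automorphism M (beta s),
      forall x, M x -> beta 1%g x = x &
      forall s t x, M x -> beta (s * t)%g x = beta s (beta t x)].

Definition star_rep (A : cstarAlgType R) (pi : A -> H -> H) : Prop :=
  [/\ forall a, bounded_op (pi a),
      forall k a b, pi (k *: a + b) = k *: pi a + pi b,
      pi 1 = idfun,
      forall a b, pi (a * b) = pi a \o pi b &
      forall a, adjoint (pi a) (pi (star a))].

Definition unitary_rep (G : groupType) (U : G -> H -> H) : Prop :=
  [/\ forall t, bounded_op (U t),
      U 1%g = idfun,
      forall s t, U (s * t)%g = U s \o U t &
      forall t, adjoint (U t) (U t^-1%g)].

Definition covariant_rep (G : groupType) (A : cstarAlgType R)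
    (alpha : G -> A -> A) (rho : A -> H -> H) (U : G -> H -> H) : Prop :=
  [/\ star_rep rho, unitary_rep U &
      forall t a, U t \o rho a \o U t^-1%g = rho (alpha t a)].

(* the GNS triple, characterized up to unitary equivalence *)
Definition GNS (A : cstarAlgType R) (tau : A -> R[i])
    (pi : A -> H -> H) (xi : H) : Prop :=
  [/\ star_rep pi,
      forall a, ip (pi a xi) xi = tau a &
      closure (range (fun a => pi a xi)) = setT].

Definition vN_gen (A : cstarAlgType R) (pi : A -> H -> H) : set (H -> H) :=
  commutant (commutant (range pi)).

End Operators.

(** The algebra [B], with the canonical maps [iota] of A and [u] of G, is
    determined up to isomorphism by covariance, by density of the span of the
    elements [iota a * u t], and by the extension of every covariant
    representation of (A, G) to a representation of [B]. *)

Record universal_crossed_product (R : realType) (G : groupType)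
    (A : cstarAlgType R) (alpha : G -> A -> A)
    (B : cstarAlgType R) (iota : A -> B) (u : G -> B) : Prop := {
  ucp_hom : star_hom iota;
  ucp_u1 : u 1%g = 1;
  ucp_uM : forall s t, u (s * t)%g = u s * u t;
  ucp_uV : forall t, u t^-1%g = star (u t);
  ucp_cov : forall t a, u t * iota a * star (u t) = iota (alpha t a);
  ucp_dense : forall (b : B) (e : R[i]), 0 < e ->
    exists n (a : 'I_n -> A) (t : 'I_n -> G),
      cnorm (b - \sum_i iota (a i) * u (t i)) < e;
  ucp_universal : forall (K : hilbertType R) (rho : A -> K -> K) (U : G -> K -> K),
    covariant_rep alpha rho U ->
    exists Theta : B -> K -> K,
      [/\ star_rep Theta, forall a, Theta (iota a) = rho a &
          forall t, Theta (u t) = U t]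
}.

Section Sets.
Context {R : realType} {G : groupType} {A B : cstarAlgType R} {H : hilbertType R}.

Definition completely_positive (F : B -> H -> H) : Prop :=
  (forall k b c, F (k *: b + c) = k *: F b + F c) /\
  forall n (b : 'M[B]_n), mxpositive b -> op_mx_positive (fun i j => F (b i j)).

(* [gamma] is the action of G on [B], [beta] the action of G on [M]. *)
Definition weak_expectations (iota : A -> B) (gamma : G -> B -> B)
    (pi : A -> H -> H) (M : set (H -> H)) (beta : G -> (H -> H) -> (H -> H)) :
    set (B -> H -> H) :=
  [set F | [/\ forall b, M (F b), F 1 = idfun, completely_positive F,
               forall s b, F (gamma s b) = beta s (F b) &
               forall a, F (iota a) = pi a]].

(* A finite subset of G is enumerated by a duplicate-free tuple. *)
Definition positive_families (M : set (H -> H))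
    (beta : G -> (H -> H) -> (H -> H)) : set (G -> H -> H) :=
  [set x | (forall t, M (x t)) /\
           [/\ x 1%g = idfun,
               forall t y, M y -> x t \o y = beta t y \o x t,
               forall s t, beta s (x t) = x (s * t * s^-1)%g &
               forall n (f : n.-tuple G), uniq f ->
                 op_mx_positive (fun i j => x (tnth f i * (tnth f j)^-1)%g)]].

Definition trace_extensions (iota : A -> B) (tau : A -> R[i]) :
    set (B -> R[i]) :=
  [set sigma | tracial_state sigma /\ forall a, sigma (iota a) = tau a].

End Sets.

(* Main.v *)
Require Import Defs.
From HB Require Import structures.
From mathcomp Require Import all_boot all_order all_algebra.
From mathcomp Require Import complex.
From mathcomp Require Import all_classical all_reals all_analysis.
From mathcomp Require Import ring lra.
From mathcomp Require Import freeg.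
Set Implicit Arguments.
Unset Strict Implicit.
Unset Printing Implicit Defensive.
Import Order.TTheory GRing.Theory Num.Theory.
Import numFieldNormedType.Exports.
Local Open Scope classical_set_scope.
Local Open Scope ring_scope.

(** Write [w] for the vector state [y |-> <y xi, xi>], [rho d] for the right
    multiplication [pi a xi |-> pi (a * d) xi] (bounded, because [tau] is a trace)
    and [J] for the modular conjugation [pi a xi |-> pi (star a) xi].

    The algebra [M] is the commutant of the operators [rho d] ([vN_genE]); so [xi]
    is separating for [M], [J y xi = y^* xi] for [y] in [M], and [w] is a trace on
    [M].  The given trace [tauM] is [w] ([snt_vector], [tauM_vector]).  The reason is
    a non-commutative Egorov argument: if [pi (a k)] approximates [y] fast in the
    norm of [xi], the resolvents of weighted sums of the squared errors form cut-offs
    that make the error small in operator norm, and normality lets the cut-offs tend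
    to the identity; the trace property moves the cut-offs out of the way, and
    [tauM (y^* y) <= |y xi|^2] results ([snt_sq_le]).  The same argument applies to
    [tauM \o beta s], since automorphisms of [M] preserve order ([aut_psd]); hence
    [beta s] preserves [w] and is continuous in the norm of [xi].

    From expectations to families: [iota a] lies in the multiplicative domain of [F]
    ([cp_mul_right]), so [F (u t)] is covariant with respect to [pi(A)], hence with
    respect to [M] by continuity ([covariance_extends]); positivity is that of the
    Gram matrix of the unitaries.  [F] is recovered from its values on the generators
    because unital completely positive maps are contractive ([cp_norm]), which rests
    on square roots of [r^2 - b^* b] ([cstar_gap]).

    From families to expectations: the kernel
    [((t, v), (s, w)) |-> <x (s^-1 t) v, w>] is positive definite, its Hilbert space
    ([kolmogorov]) carries a covariant representation, and the universal property
    yields a representation of the crossed product whose compression to the copy of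
    [H] at the identity of [G] is [F] ([family_dilation]).

    From families to traces: [sigma = tauM \o F].  The trace identity is checked on
    generators with the covariance of [x], its equivariance and the invariance of
    [w] ([we_trace]).  Conversely a trace [sigma] extending [tau] defines a bounded
    form [(a, c) |-> sigma (c^* b a)] on [pi(A) xi]; its operator [F b] commutes with
    every [rho d], so it lies in [M], and [F] is a weak expectation
    ([trace_operator_we]). *)

(** * Real-valued inner product and norm *)

Notation "r *r v" := ((real_complex _ r) *: v) (at level 40).

Section RealInner.
Context {R : realType} {H : hilbertType R}.
Implicit Types (u v w : H) (r : R).

Definition rip u v : R := complex.Re (ip u v).
Definition nrm u : R := complex.Re `|u|.

Lemma ReD (x y : R[i]) : complex.Re (x + y) = complex.Re x + complex.Re y.
Proof. by case: x; case: y. Qed.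
Lemma ReN (x : R[i]) : complex.Re (- x) = - complex.Re x.
Proof. by case: x. Qed.
Lemma ReM_real r (x : R[i]) : complex.Re (r%:C%C * x) = r * complex.Re x.
Proof. by case: x => a b /=; rewrite mul0r subr0. Qed.
Lemma Re_conj (x : R[i]) : complex.Re (x^*) = complex.Re x.
Proof. by case: x. Qed.
Lemma Re_sum I (s : seq I) (P : pred I) (f : I -> R[i]) :
  complex.Re (\sum_(i <- s | P i) f i) = \sum_(i <- s | P i) complex.Re (f i).
Proof. by apply: (big_morph (@complex.Re R)) => // x y; rewrite ReD. Qed.

Lemma ge0_complexP (x : R[i]) : (0 <= x) = (complex.Im x == 0) && (0 <= complex.Re x).
Proof. by rewrite lecE /=. Qed.

Lemma ge0_Re (x : R[i]) : 0 <= x -> 0 <= complex.Re x.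
Proof. by rewrite ge0_complexP => /andP[]. Qed.

Lemma ge0_ReK (x : R[i]) : 0 <= x -> x = (complex.Re x)%:C%C.
Proof. by rewrite ge0_complexP; case: x => a b /= /andP[/eqP -> _]. Qed.

Lemma ip0l w : ip (0 : H) w = 0.
Proof.
have := ip_linearl 1 0 0 w; rewrite scale1r addr0 mul1r => h.
by apply: (addrI (ip (0 : H) w)); rewrite addr0 -{1}h.
Qed.
Lemma ipDl u v w : ip (u + v) w = ip u w + ip v w.
Proof. by have := ip_linearl 1 u v w; rewrite scale1r mul1r. Qed.
Lemma ipZl k u w : ip (k *: u) w = k * ip u w.
Proof. by have := ip_linearl k u 0 w; rewrite addr0 ip0l addr0. Qed.
Lemma ipDr u v w : ip w (u + v) = ip w u + ip w v.
Proof. by rewrite ip_conj ipDl rmorphD /= -!ip_conj. Qed.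
Lemma ipZr k u w : ip w (k *: u) = k^* * ip w u.
Proof. by rewrite ip_conj ipZl rmorphM /= -!ip_conj. Qed.
Lemma ipNl u w : ip (- u) w = - ip u w.
Proof. by rewrite -scaleN1r ipZl mulN1r. Qed.
Lemma ipNr u w : ip w (- u) = - ip w u.
Proof. by rewrite -scaleN1r ipZr rmorphN1 mulN1r. Qed.
Lemma ip_suml I (s : seq I) (P : pred I) (f : I -> H) w :
  ip (\sum_(i <- s | P i) f i) w = \sum_(i <- s | P i) ip (f i) w.
Proof. by apply: (big_morph (fun u => ip u w)) => [x y|]; rewrite ?ipDl ?ip0l. Qed.
Lemma ip0r w : ip w (0 : H) = 0.
Proof. by rewrite ip_conj ip0l rmorph0. Qed.
Lemma ip_sumr I (s : seq I) (P : pred I) (f : I -> H) w :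
  ip w (\sum_(i <- s | P i) f i) = \sum_(i <- s | P i) ip w (f i).
Proof. by apply: (big_morph (fun u => ip w u)) => [x y|]; rewrite ?ipDr ?ip0r. Qed.

Lemma ripC u v : rip u v = rip v u.
Proof. by rewrite /rip ip_conj Re_conj. Qed.
Lemma ripDl u v w : rip (u + v) w = rip u w + rip v w.
Proof. by rewrite /rip ipDl ReD. Qed.
Lemma ripDr u v w : rip w (u + v) = rip w u + rip w v.
Proof. by rewrite ripC ripDl !(ripC w). Qed.
Lemma ripNl u w : rip (- u) w = - rip u w.
Proof. by rewrite /rip ipNl ReN. Qed.
Lemma ripNr u w : rip w (- u) = - rip w u.
Proof. by rewrite ripC ripNl ripC. Qed.
Lemma ripZl r u w : rip (r *r u) w = r * rip u w.
Proof. by rewrite /rip ipZl ReM_real. Qed.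
Lemma ripZr r u w : rip w (r *r u) = r * rip w u.
Proof. by rewrite ripC ripZl ripC. Qed.
Lemma rip0l w : rip 0 w = 0. Proof. by rewrite /rip ip0l. Qed.
Lemma rip0r w : rip w 0 = 0. Proof. by rewrite /rip ip0r. Qed.
Definition ripE := (ripDl, ripDr, ripNl, ripNr, ripZl, ripZr, rip0l, rip0r).

(** The real part determines the whole inner product, so identities between
    inner products only need to be checked for [rip]. *)
Lemma ip_rip u v : ip u v = Complex (rip u v) (rip u ('i%C *: v)).
Proof.
rewrite /rip ipZr; case: (ip u v) => a b /=.
by rewrite mul0r mulN1r opprK add0r.
Qed.

Lemma rip_ii u v : rip ('i%C *: u) ('i%C *: v) = rip u v.
Proof.
rewrite /rip ipZl ipZr mulrA; have -> : 'i%C * ('i%C : R[i])^* = 1.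
  by apply/eqP; rewrite eq_complex /= !(mul0r, mulr0, mul1r, addr0, sub0r, opprK) !eqxx.
by rewrite mul1r.
Qed.

Lemma nrmC u : `|u| = ((nrm u)%:C)%C.
Proof. by rewrite /nrm; apply: ge0_ReK. Qed.

Lemma nrm_ge0 u : 0 <= nrm u.
Proof. exact/ge0_Re. Qed.

Lemma ipuu u : ip u u = ((nrm u ^+ 2)%:C)%C.
Proof. by rewrite ip_norm nrmC -rmorphXn. Qed.

Lemma ripuu u : rip u u = nrm u ^+ 2.
Proof. by rewrite /rip ipuu. Qed.

Lemma rip_ge0 u : 0 <= rip u u.
Proof. by rewrite ripuu sqr_ge0. Qed.

Lemma nrm0P u : nrm u = 0 -> u = 0.
Proof. by move=> h; apply/normr0_eq0; rewrite nrmC h. Qed.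

Lemma nrm0 : nrm 0 = 0 :> R.
Proof. by rewrite /nrm normr0. Qed.

Lemma rip0P u : rip u u = 0 -> u = 0.
Proof. by rewrite ripuu => /eqP; rewrite sqrf_eq0 => /eqP /nrm0P. Qed.

Lemma nrmD u v : nrm (u + v) <= nrm u + nrm v.
Proof.
have := ler_normD u v.
by rewrite !nrmC -(rmorphD (real_complex R)) lecR.
Qed.

Lemma nrmN u : nrm (- u) = nrm u.
Proof. by rewrite /nrm normrN. Qed.

Lemma nrmB u v : nrm (u - v) = nrm (v - u).
Proof. by rewrite -nrmN opprB. Qed.

Lemma nrmZ (k : R[i]) u : nrm (k *: u) = complex.Re `|k| * nrm u.
Proof.
rewrite /nrm normrZ {1}(ge0_ReK (normr_ge0 k)) ReM_real //.
Qed.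

Lemma nrm_le_dist u v : nrm u <= nrm v + nrm (u - v).
Proof. by have := nrmD v (u - v); rewrite addrC subrK. Qed.

End RealInner.

(** Cauchy--Schwarz as a discriminant bound: [a + 2 t b + t^2 c] is the square
    length of [u + t v] when [a], [b], [c] are the values of a form at [(u, u)],
    [(u, v)], [(v, v)].  The scalar form serves inner products, positive operators,
    positive functionals and traces alike. *)
Lemma form_cauchy_schwarz (R : realType) (a b c : R) :
  (forall t : R, 0 <= a + 2 * t * b + t ^+ 2 * c) -> b ^+ 2 <= a * c.
Proof.
move=> h.
have [c0|c0] := ltP 0 c.
  have := h (- b / c); rewrite -(pmulr_lge0 _ c0).
  have -> : (a + 2 * (- b / c) * b + (- b / c) ^+ 2 * c) * c = a * c - b ^+ 2.
    by field; rewrite gt_eqF.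
  by rewrite subr_ge0.
have b0 : b = 0.
  apply/eqP; apply: contraT => bn0.
  have := h (- (a + 1) / (2 * b)).
  have -> : 2 * (- (a + 1) / (2 * b)) * b = - (a + 1) by field.
  have := sqr_ge0 (- (a + 1) / (2 * b)); nra.
rewrite b0 expr0n /=.
have a0 : 0 <= a by have := h 0; rewrite expr0n /= mulr0 !mul0r !addr0.
have [->|an0] := eqVneq a 0; first by rewrite mul0r.
have ap : 0 < a by rewrite lt_neqAle eq_sym an0.
have c1 : 0 <= c; last by apply: mulr_ge0.
rewrite leNgt; apply/negP => cn.
have := h (Num.sqrt (2 * a / - c)).
rewrite sqr_sqrtr; last by rewrite divr_ge0 //; lra.
have -> : 2 * a / - c * c = - 2 * a by field; rewrite lt_eqF.
rewrite b0; lra.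
Qed.

Section RealInner2.
Context {R : realType} {H : hilbertType R}.
Implicit Types (u v w : H) (r : R).

Lemma rip_CS2 u v : rip u v ^+ 2 <= rip u u * rip v v.
Proof.
apply: form_cauchy_schwarz => t.
have := rip_ge0 (u + t *r v); rewrite !ripE (ripC v u).
by congr (0 <= _); ring.
Qed.

Lemma rip_CS u v : `|rip u v| <= nrm u * nrm v.
Proof.
rewrite -ler_sqr ?nnegrE ?mulr_ge0 ?nrm_ge0 // real_normK ?num_real //.
by rewrite exprMn -!ripuu rip_CS2.
Qed.

Lemma rip_le u v : rip u v <= nrm u * nrm v.
Proof. exact: le_trans (ler_norm _) (rip_CS u v). Qed.

Lemma nrm_le_rip w C : 0 <= C -> (forall u, rip w u <= C * nrm u) -> nrm w <= C.
Proof.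
move=> C0 h; have [w0|w0] := eqVneq (nrm w) 0; first by rewrite w0.
have wp : 0 < nrm w by rewrite lt_neqAle eq_sym w0 nrm_ge0.
by rewrite -(ler_pM2r wp) -expr2 -ripuu.
Qed.

Lemma parallelogram u v :
  rip (u - v) (u - v) = 2 * rip u u + 2 * rip v v - rip (u + v) (u + v).
Proof. by rewrite !ripE (ripC v u); ring. Qed.

Lemma rip_inj u v : (forall w, rip u w = rip v w) -> u = v.
Proof.
move=> h; apply/eqP; rewrite -subr_eq0; apply/eqP/rip0P.
by rewrite ripDl ripNl h subrr.
Qed.

End RealInner2.

(** * Limits of sequences *)

Section ScalarLimits.
Context {R : realType}.
Implicit Types (f g : nat -> R) (l m : R).

Lemma cvg_epsP f l :
  (f @ \oo --> l) <->
  (forall e, 0 < e -> exists N, forall n, (N <= n)%N -> `|f n - l| < e).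
Proof.
split=> [/cvgrPdist_lt h e e0|h].
  have [N _ hN] := h e e0; exists N => n Nn.
  by rewrite distrC; apply: hN.
apply/cvgrPdist_lt => e e0; have [N hN] := h e e0.
by exists N => // n Nn; rewrite distrC; apply: hN.
Qed.

Lemma rcvg_le f g l m :
  f @ \oo --> l -> g @ \oo --> m -> (forall n, f n <= g n) -> l <= m.
Proof. by move=> hf hg h; apply: (ler_cvg_to hf hg); exists 0%N => // n _ /=. Qed.

Lemma rcvg_eq f g l m :
  f @ \oo --> l -> g @ \oo --> m -> f =1 g -> l = m.
Proof.
move=> hf hg h; apply: le_anti.
by rewrite (rcvg_le hf hg) ?(rcvg_le hg hf) // => n; rewrite h.
Qed.

Lemma cvg0_squeeze f g :
  (forall n, 0 <= f n <= g n) -> g @ \oo --> (0 : R) -> f @ \oo --> (0 : R).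
Proof.
move=> h hg; apply: (@squeeze_cvgr _ _ _ _ (fun=> 0) g); last exact: hg.
  by exists 0%N => // n _; exact: h.
exact: cvg_cst.
Qed.

Lemma cvg_half : (fun n : nat => (2^-1 : R) ^+ n) @ \oo --> (0 : R).
Proof. by apply: cvg_expr; rewrite ger0_norm ?invr_ge0 // invf_lt1 ?ltr1n. Qed.

Lemma cvgM0 (c : R) f : f @ \oo --> (0 : R) -> (fun n => c * f n) @ \oo --> (0 : R).
Proof. by move=> hf; rewrite -[X in _ --> X](mulr0 c); apply: cvgM => //; exact: cvg_cst. Qed.

Lemma le_epsP (x y : R) : (forall e, 0 < e -> x <= y + e) -> x <= y.
Proof. by move=> h; apply/ler_addgt0Pr. Qed.

(** Norm bounds in a C*-algebra are first obtained for radii strictly above the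
    norm; this passes to the norm itself. *)
Lemma le_sqr_above (x a k : R) :
  (forall r, a < r -> x <= r ^+ 2 * k) -> x <= a ^+ 2 * k.
Proof.
move=> h.
have hl : (fun n : nat => (a + 2^-1 ^+ n) ^+ 2 * k) @ \oo --> a ^+ 2 * k.
  have h1 : (fun n : nat => a + 2^-1 ^+ n) @ \oo --> a.
    by rewrite -[X in _ --> X]addr0; apply: cvgD; [exact: cvg_cst | exact: cvg_half].
  by apply: cvgM; [rewrite expr2; apply: cvgM | exact: cvg_cst].
apply: (rcvg_le (cvg_cst _) hl) => n; apply: h.
by rewrite ltrDl exprn_gt0 // invr_gt0.
Qed.

End ScalarLimits.

Section VectorLimits.
Context {R : realType}.

(** Norm convergence, expressed through the real-valued norm so that all scalar
    limits live in [R]. *)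
Definition tends {H : hilbertType R} (a : nat -> H) (l : H) : Prop :=
  (fun n => nrm (a n - l)) @ \oo --> (0 : R).

Context {H : hilbertType R}.
Implicit Types (a b : nat -> H) (l m u v : H).

Lemma tends_cst l : tends (fun=> l) l.
Proof. by rewrite /tends subrr nrm0; exact: cvg_cst. Qed.

Lemma tends_le a l (f : nat -> R) :
  (forall n, nrm (a n - l) <= f n) -> f @ \oo --> (0 : R) -> tends a l.
Proof. by move=> h; apply: cvg0_squeeze => n; rewrite nrm_ge0 h. Qed.

Lemma tendsD a b l m : tends a l -> tends b m -> tends (fun n => a n + b n) (l + m).
Proof.
move=> ha hb; apply: (tends_le (f := fun n => nrm (a n - l) + nrm (b n - m))).
  by move=> n; rewrite opprD addrACA nrmD.
by rewrite -[X in _ --> X](addr0 0); apply: cvgD.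
Qed.

Lemma tendsZ (k : R[i]) a l : tends a l -> tends (fun n => k *: a n) (k *: l).
Proof.
move=> ha; apply: (tends_le (f := fun n => complex.Re `|k| * nrm (a n - l))).
  by move=> n; rewrite -scalerBr nrmZ.
exact: cvgM0.
Qed.

Lemma tends_nrm a l : tends a l -> (fun n => nrm (a n)) @ \oo --> nrm l.
Proof.
move=> /cvg_epsP h; apply/cvg_epsP => e e0; have [N hN] := h e e0.
exists N => n Nn; apply: le_lt_trans (hN n Nn); rewrite subr0 (ger0_norm (nrm_ge0 _)).
have := nrm_le_dist (a n) l; have := nrm_le_dist l (a n).
rewrite (nrmB l) ler_norml; lra.
Qed.

Lemma tends_rip a b l m :
  tends a l -> tends b m -> (fun n => rip (a n) (b n)) @ \oo --> rip l m.
Proof.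
move=> ha hb; apply/subr_cvg0.
have hf : (fun n => nrm (a n - l) * nrm (b n) + nrm l * nrm (b n - m)) @ \oo --> (0 : R).
  rewrite -[X in _ --> X](addr0 0); apply: cvgD; last exact: cvgM0.
  by rewrite -[X in _ --> X](mul0r (nrm m)); apply: cvgM => //; exact: tends_nrm.
apply/cvg_epsP => e e0; have [N hN] := (cvg_epsP _ _).1 hf e e0.
exists N => n Nn; apply: le_lt_trans (hN n Nn); rewrite !subr0.
have -> : rip (a n) (b n) - rip l m = rip (a n - l) (b n) + rip l (b n - m).
  by rewrite !ripE; ring.
apply: le_trans (ler_normD _ _) _.
rewrite [X in _ <= X]ger0_norm; last by rewrite addr_ge0 ?mulr_ge0 ?nrm_ge0.
by apply: lerD; exact: rip_CS.
Qed.

Lemma tends_uniq a l m : tends a l -> tends a m -> l = m.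
Proof.
move=> hl hm; apply: rip_inj => w.
exact: (rcvg_eq (tends_rip hl (tends_cst w)) (tends_rip hm (tends_cst w))).
Qed.

Lemma tends_complete a :
  (forall e, 0 < e -> exists N, forall i j, (N <= i)%N -> (N <= j)%N ->
     nrm (a i - a j) < e) ->
  exists l, tends a l.
Proof.
move=> h.
have cau : cauchy (a @ \oo).
  apply/cauchy_ballP => e e0.
  have er : e = ((complex.Re e)%:C)%C by apply: ge0_ReK; exact: ltW.
  have [N hN] : exists N, forall i j, (N <= i)%N -> (N <= j)%N -> nrm (a i - a j) < complex.Re e.
    by apply: h; rewrite -ltcR -er.
  exists (a @` [set n | (N <= n)%N], a @` [set n | (N <= n)%N]) => /=.
    by split; exists N => // n /= Nn; exists n.
  move=> [x y] [/= [i Ni <-] [n Nn <-]].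
  by rewrite -ball_normE /= nrmC er ltcR; apply: hN.
have /cvg_ex[l hl] : cvg (a @ \oo) by apply: cauchy_cvg.
exists l; apply/cvg_epsP => e e0.
move/cvgrPdist_lt : hl => /(_ (e%:C)%C); rewrite ltcR => /(_ e0) [N _ hN].
exists N => n Nn; have := hN n Nn; rewrite /= nrmC ltcR nrmB subr0.
by rewrite ger0_norm ?nrm_ge0.
Qed.

(** The form of completeness for minimising and monotone sequences, where squared
    distances are bounded by energy gaps. *)
Lemma tends_complete_null a (f : nat -> R) :
  f @ \oo --> (0 : R) -> (forall i j, nrm (a i - a j) ^+ 2 <= f i + f j) ->
  exists l, tends a l.
Proof.
move=> hf h; apply: tends_complete => e e0.
have [|N hN] := (cvg_epsP _ _).1 hf (e ^+ 2 / 2); first by rewrite divr_gt0 ?exprn_gt0.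
exists N => i n Nm Nn; rewrite -ltr_sqr ?nnegrE ?nrm_ge0 ?ltW//.
apply: le_lt_trans (h i n) _.
have := hN i Nm; have := hN n Nn; rewrite !subr0.
have := ler_norm (f i); have := ler_norm (f n); lra.
Qed.

End VectorLimits.

(** * Bounded operators *)

Section BoundedOps.
Context {R : realType}.

Section Linear.
Context {U V : lmodType R[i]} (T : U -> V) (hT : linear T).
Lemma lin0 : T 0 = 0.
Proof.
have := hT 1 0 0; rewrite !scale1r addr0 => h.
by apply: (addrI (T 0)); rewrite addr0 -h.
Qed.
Lemma linD u v : T (u + v) = T u + T v.
Proof. by rewrite -{1}[u]scale1r hT scale1r. Qed.
Lemma linZ k u : T (k *: u) = k *: T u.
Proof. by rewrite -[k *: u]addr0 hT lin0 addr0. Qed.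
Lemma linN u : T (- u) = - T u.
Proof. by rewrite -scaleN1r linZ scaleN1r. Qed.
Lemma linB u v : T (u - v) = T u - T v.
Proof. by rewrite linD linN. Qed.
Lemma lin_sum I (s : seq I) (P : pred I) (f : I -> U) :
  T (\sum_(i <- s | P i) f i) = \sum_(i <- s | P i) T (f i).
Proof. by apply: (big_morph T linD lin0). Qed.
End Linear.

Definition bounded_by {H K : hilbertType R} (T : H -> K) (C : R) : Prop :=
  forall v, nrm (T v) <= C * nrm v.

Context {H K : hilbertType R}.
Implicit Types (T S : H -> K).

Lemma bounded_byW T C : bounded_by T C -> exists2 C', 0 < C' & bounded_by T C'.
Proof.
move=> h; exists (`|C| + 1); first by rewrite ltr_wpDl.
move=> v; apply: le_trans (h v) _; apply: ler_wpM2r; first exact: nrm_ge0.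
by apply: le_trans (ler_norm C) _; rewrite lerDl.
Qed.

Lemma tends_op T C a l : linear T -> bounded_by T C -> tends a l ->
  tends (fun n => T (a n)) (T l).
Proof.
move=> lT bT h; apply: (tends_le (f := fun n => C * nrm (a n - l))); last exact: cvgM0.
by move=> n; rewrite -(linB lT) bT.
Qed.

Lemma bounded_by_continuous T C : linear T -> bounded_by T C -> continuous T.
Proof.
move=> lT bT; pose lTm := GRing.isLinear.Build _ _ _ _ T lT.
pose TL : {linear H -> K} := HB.pack T lTm.
apply: (@bounded_linear_continuous R[i] H K TL).
apply/linear_boundedP; exists (`|C|%:C)%C; split; first by rewrite complex_real.
move=> r hr x; rewrite /= !nrmC.
apply: le_trans (_ : ((`|C|)%:C * (nrm x)%:C)%C <= _); last first.
  by apply: ler_wpM2r; [rewrite lecR nrm_ge0 | exact: ltW].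
rewrite -rmorphM /= lecR; apply: le_trans (bT x) _.
by apply: ler_wpM2r; [exact: nrm_ge0 | exact: ler_norm].
Qed.

Lemma continuous_bounded_by T : linear T -> continuous T -> exists C, bounded_by T C.
Proof.
move=> lT cT; pose lTm := GRing.isLinear.Build _ _ _ _ T lT.
pose TL : {linear H -> K} := HB.pack T lTm.
have /linear_boundedP[y [yr h]] : bounded_near TL (nbhs (0 : H)).
  by apply/linear_bounded_continuous.
have [c yc] := complex_realP _ yr.
exists (c + 1) => v; have := h ((c + 1)%:C)%C _ v.
rewrite yc ltcR ltrDl ltr01 => /(_ isT).
by rewrite !nrmC -rmorphM lecR.
Qed.

End BoundedOps.

(** * Lax--Milgram, Riesz and adjoints *)

Section LaxMilgram.
Context {R : realType} {H : hilbertType R}.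

Definition symm (T : H -> H) : Prop := forall u v, rip (T u) v = rip u (T v).

Definition psd (T : H -> H) : Prop := forall v, 0 <= rip (T v) v.

Lemma lin_real {U V : lmodType R[i]} (T : U -> V) (hT : linear T) (r : R) u :
  T (r *r u) = r *r T u.
Proof. exact: linZ. Qed.

(** The energy [q (e x) - 2 l x] is bounded below by coercivity, and the
    parallelogram identity makes every minimising sequence Cauchy; its limit
    represents [l]. The functional lives on an arbitrary module [E] mapped to [H]
    so that functionals known only on a dense subspace are covered. *)
Lemma lax_milgram (E : lmodType R[i]) (e : E -> H) (T : H -> H) (C c K : R)
    (l : E -> R) :
  linear e -> linear T -> bounded_by T C -> symm T -> 0 < c ->
  (forall v, c * rip v v <= rip (T v) v) ->
  (forall x y, l (x + y) = l x + l y) -> (forall r x, l (r *r x) = r * l x) ->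
  (forall x, `|l x| <= K * nrm (e x)) ->
  exists v, forall y, rip (T v) (e y) = l y.
Proof.
move=> le lT bT sT c0 coer lD lZ bl.
pose J x := rip (T (e x)) (e x) - 2 * l x.
have Jlow x : - (K ^+ 2 / c) <= J x.
  have h1 := coer (e x); have h2 := le_trans (ler_norm _) (bl x).
  have h3 : 0 <= (c * nrm (e x) - K) ^+ 2 / c by rewrite divr_ge0 ?sqr_ge0 ?ltW.
  have h4 : (c * nrm (e x) - K) ^+ 2 / c = c * rip (e x) (e x) - 2 * (K * nrm (e x)) + K ^+ 2 / c.
    by rewrite ripuu; field; rewrite gt_eqF.
  rewrite /J; lra.
pose S := [set J x | x in setT].
have hS : has_inf S.
  split; first by exists (J 0); exists 0.
  by exists (- (K ^+ 2 / c)) => _ [x _ <-].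
pose m := inf S.
have mJ x : m <= J x by apply: ge_inf; [case: hS | exists x].
have /choice[x hx] : forall n : nat, exists x, J x < m + 2^-1 ^+ n.
  move=> n; have h2 : 0 < (2^-1 : R) ^+ n by rewrite exprn_gt0 // invr_gt0.
  by have [_ [x _ <-] h] := inf_adherent h2 hS; exists x.
have par a b : rip (T (e a - e b)) (e a - e b) = 2 * J a + 2 * J b - 4 * J ((2^-1 : R) *r (a + b)).
  rewrite /J lZ lD (lin_real le) (linD le) (lin_real lT) (linB lT) (linD lT) !ripE.
  by rewrite (sT (e a) (e b)) (ripC (e a)); field.
have [v hv] : exists v, tends (fun n => e (x n)) v.
  apply: (tends_complete_null (f := fun n => 2 / c * 2^-1 ^+ n)); first exact/cvgM0/cvg_half.
  move=> i j; rewrite -ripuu -mulrDr mulrAC ler_pdivlMr // mulrC.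
  apply: le_trans (coer _) _; rewrite par.
  have := mJ ((2^-1 : R) *r (x i + x j)); have := hx i; have := hx j; lra.
exists v => y.
suff h t : 0 <= 0 + 2 * t * (rip (T v) (e y) - l y) + t ^+ 2 * rip (T (e y)) (e y).
  have := form_cauchy_schwarz h; rewrite mul0r => h2.
  have /eqP : (rip (T v) (e y) - l y) ^+ 2 = 0 by apply: le_anti; rewrite h2 sqr_ge0.
  by rewrite sqrf_eq0 subr_eq0 => /eqP.
rewrite add0r.
have eqJ n : J (x n + t *r y) = J (x n) + (2 * t * (rip (T (e (x n))) (e y) - l y) +
    t ^+ 2 * rip (T (e y)) (e y)).
  rewrite /J lD lZ (linD le) (lin_real le) (linD lT) (lin_real lT) !ripE.
  by rewrite (sT (e y)) (ripC (e y)); ring.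
have lim1 : (fun n => rip (T (e (x n))) (e y)) @ \oo --> rip (T v) (e y).
  by apply: tends_rip (tends_cst _); apply: tends_op hv.
have lim2 : (fun n => 2 * t * (rip (T (e (x n))) (e y) - l y) +
    t ^+ 2 * rip (T (e y)) (e y)) @ \oo --> 2 * t * (rip (T v) (e y) - l y) +
    t ^+ 2 * rip (T (e y)) (e y).
  apply: cvgD; last exact: cvg_cst.
  apply: cvgM; first exact: cvg_cst.
  by apply: cvgB => //; exact: cvg_cst.
apply: (rcvg_le (f := fun n => - 2^-1 ^+ n) _ lim2).
  by rewrite -[X in _ --> X]oppr0; apply: cvgN; exact: cvg_half.
move=> n; have := mJ (x n + t *r y); rewrite eqJ; have := hx n; lra.
Qed.

End LaxMilgram.

Section Riesz.
Context {R : realType}.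

Definition dense_map {S : Type} {H : hilbertType R} (e : S -> H) : Prop :=
  forall v, exists a : nat -> S, tends (fun n => e (a n)) v.

Lemma dense_map_id (H : hilbertType R) : dense_map (@idfun H).
Proof. by move=> v; exists (fun=> v); exact: tends_cst. Qed.

Lemma dense_rip_inj S (H : hilbertType R) (e : S -> H) u v : dense_map e ->
  (forall x, rip u (e x) = rip v (e x)) -> u = v.
Proof.
move=> de h; apply: rip_inj => w; have [a ha] := de w.
have h1 := tends_rip (tends_cst u) ha; have h2 := tends_rip (tends_cst v) ha.
by apply: rcvg_eq h1 h2 _ => n; exact: h.
Qed.

Lemma dense_ip_inj S (H : hilbertType R) (e : S -> H) u v : dense_map e ->
  (forall x, ip u (e x) = ip v (e x)) -> u = v.
Proof. by move=> de h; apply: (dense_rip_inj de) => x; rewrite /rip h. Qed.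

Lemma dense_nrm_le S (H : hilbertType R) (e : S -> H) w C : dense_map e -> 0 <= C ->
  (forall x, rip w (e x) <= C * nrm (e x)) -> nrm w <= C.
Proof.
move=> de C0 h; apply: nrm_le_rip => // u; have [a ha] := de u.
apply: (rcvg_le (tends_rip (tends_cst w) ha) (cvgM (cvg_cst C) (tends_nrm ha))).
by move=> n; exact: h.
Qed.

(** [lax_milgram] for the identity operator represents the real part of [f]; complex
    linearity then fixes the imaginary part. *)
Lemma riesz_dense (E : lmodType R[i]) (H : hilbertType R) (e : E -> H)
    (f : E -> R[i]) K : linear e -> dense_map e -> 0 <= K -> scalar f ->
  (forall x, complex.Re `|f x| <= K * nrm (e x)) ->
  exists v, nrm v <= K /\ forall x, f x = ip (e x) v.
Proof.
move=> le de K0 sf bf.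
have f0 : f 0 = 0 by apply: (addrI (f 0)); rewrite -{1}[f 0]mul1r -sf scale1r addr0 addr0.
have fZ k x : f (k *: x) = k * f x by rewrite -[k *: x]addr0 sf f0 addr0.
have bRe x : `|complex.Re (f x)| <= complex.Re `|f x|.
  by rewrite -lecR -(ge0_ReK (normr_ge0 _)); exact: normc_ge_Re.
have [v hv] : exists v, forall y, rip v (e y) = complex.Re (f y).
  apply: (@lax_milgram _ H E e idfun 1 1 K) => //.
  - by move=> v; rewrite mul1r.
  - by move=> v; rewrite mul1r.
  - by move=> x y; rewrite -{1}[x]scale1r sf mul1r ReD.
  - by move=> r x; rewrite fZ ReM_real.
  - by move=> x; apply: le_trans (bRe x) (bf x).
exists v; split.
  apply: (dense_nrm_le de) => // x; rewrite hv.
  exact: le_trans (ler_norm _) (le_trans (bRe x) (bf x)).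
move=> x; rewrite ip_rip !(ripC (e x)) hv.
have -> : rip ('i%C *: v) (e x) = complex.Im (f x).
  have := rip_ii v ('i%C *: e x); rewrite scalerA -expr2 sqr_i scaleN1r ripNr => h1.
  have := hv ('i%C *: x); rewrite (linZ le) fZ => h2.
  have -> : rip ('i%C *: v) (e x) = - rip v ('i%C *: e x) by rewrite -h1 opprK.
  by rewrite h2; case: (f x) => a b /=; rewrite mul0r mul1r sub0r opprK.
by case: (f x).
Qed.

Lemma ip_CS (H : hilbertType R) (u v : H) : complex.Re `|ip u v| <= nrm u * nrm v.
Proof.
have [->|z0] := eqVneq (ip u v) 0; first by rewrite normr0 mulr_ge0 ?nrm_ge0.
set z := ip u v in z0 *.
(* rotating [u] makes the inner product real, equal to its own modulus *)
have -> : complex.Re `|z| = rip ((z^* / `|z|) *: u) v.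
  rewrite /rip ipZl -/z mulrAC (mulrC _ z) -normCK expr2 mulfK //.
  by rewrite normr_eq0.
apply: le_trans (rip_le _ _) _; rewrite nrmZ normrM normfV normr_id norm_conjC.
by rewrite mulfV ?normr_eq0 //= mul1r.
Qed.

Lemma adjoint_exists (H K : hilbertType R) (T : H -> K) C : 0 <= C ->
  linear T -> bounded_by T C ->
  exists S : K -> H, [/\ linear S, bounded_by S C & forall u v, ip (T u) v = ip u (S v)].
Proof.
move=> C0 lT bT.
have /choice[S hS] : forall w : K, exists v : H, nrm v <= C * nrm w /\
    forall x, ip (T x) w = ip x v.
  move=> w; apply: (@riesz_dense H H idfun (fun x => ip (T x) w)).
  - by [].
  - exact: dense_map_id.
  - by rewrite mulr_ge0 ?nrm_ge0.
  - by move=> k x y; rewrite lT ipDl ipZl.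
  - move=> x; apply: le_trans (_ : nrm (T x) * nrm w <= _); last first.
      by rewrite mulrAC; apply: ler_wpM2r; [exact: nrm_ge0 | exact: bT].
    exact: ip_CS.
exists S; split; last by move=> u v; have [_] := hS v.
- move=> k u v; apply: (@dense_ip_inj _ _ idfun _ _ (@dense_map_id H)) => x.
  rewrite ip_conj [RHS]ip_conj; congr (_^*).
  have [_ h1] := hS (k *: u + v); have [_ h2] := hS u; have [_ h3] := hS v.
  by rewrite -h1 !ipDr !ipZr -h2 -h3.
- by move=> v; have [] := hS v.
Qed.

(** The Riesz adjoint of [g] is defined on all of [K], so the extension of [g] along
    [e] is obtained as the adjoint of that operator. *)
Lemma extend_dense (E : lmodType R[i]) (H K : hilbertType R) (e : E -> H)
    (g : E -> K) C : 0 <= C -> linear e -> dense_map e -> linear g ->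
  (forall x, nrm (g x) <= C * nrm (e x)) ->
  exists T : H -> K, [/\ linear T, bounded_by T C & forall x, T (e x) = g x].
Proof.
move=> C0 le de lg bg.
have /choice[S hS] : forall w : K, exists v : H, nrm v <= C * nrm w /\
    forall x, ip (g x) w = ip (e x) v.
  move=> w; apply: riesz_dense => //.
  - by rewrite mulr_ge0 ?nrm_ge0.
  - by move=> k x y; rewrite lg ipDl ipZl.
  - move=> x; apply: le_trans (_ : nrm (g x) * nrm w <= _); last first.
      by rewrite mulrAC; apply: ler_wpM2r; [exact: nrm_ge0 | exact: bg].
    exact: ip_CS.
have lS : linear S.
  move=> k u v; apply: (dense_ip_inj de) => x.
  rewrite ip_conj [RHS]ip_conj; congr (_^*).
  have [_ h1] := hS (k *: u + v); have [_ h2] := hS u; have [_ h3] := hS v.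
  by rewrite -h1 !ipDr !ipZr -h2 -h3.
have bS : bounded_by S C by move=> v; have [] := hS v.
have [T [lT bT hT]] := adjoint_exists C0 lS bS.
exists T; split=> // x; apply: (@dense_ip_inj _ _ idfun _ _ (@dense_map_id K)) => w /=.
by rewrite ip_conj -hT -ip_conj; have [_ ->] := hS w.
Qed.

End Riesz.

(** * Positive operators: resolvents and monotone limits *)

Section Positive.
Context {R : realType} {H : hilbertType R}.
Implicit Types (T S P : H -> H).

Lemma symm_adjoint T : linear T -> symm T -> adjoint T T.
Proof.
move=> lT sT u v; rewrite !ip_rip; congr Complex; first exact: sT.
by rewrite sT (linZ lT).
Qed.

Lemma adjoint_symm T : adjoint T T -> symm T.
Proof. by move=> aT u v; rewrite /rip aT. Qed.

Lemma adjoint_rip T S : adjoint T S -> forall u v, rip (T u) v = rip u (S v).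
Proof. by move=> aT u v; rewrite /rip aT. Qed.

Lemma adjoint_sym T S : adjoint T S -> adjoint S T.
Proof. by move=> h u v; rewrite ip_conj -h -ip_conj. Qed.

Lemma adjoint_uniq T S S' : adjoint T S -> adjoint T S' -> S = S'.
Proof.
move=> h h'; apply/funext => v; apply: rip_inj => w.
by rewrite ripC (ripC _ w) -(adjoint_rip h) -(adjoint_rip h').
Qed.

Lemma symm_positive_op T : linear T -> symm T -> psd T -> positive_op T.
Proof.
move=> lT sT pT v; rewrite ge0_complexP; have := pT v; rewrite /rip => -> /=.
rewrite andbT; have := ip_conj (T v) v; rewrite -(symm_adjoint lT sT).
by case: (ip (T v) v) => a b [] /eqP; rewrite -addr_eq0 -mulr2n mulrn_eq0.
Qed.

Lemma positive_op_psd T : positive_op T -> psd T.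
Proof. by move=> h v; apply: ge0_Re. Qed.

(** Polarisation along [u + v] and [i u + v], where [<T v, v>] is real. *)
Lemma positive_op_symm T : linear T -> positive_op T -> symm T.
Proof.
move=> lT pT; have im0 v : rip (T v) ('i%C *: v) = 0.
  have := pT v; rewrite ge0_complexP => /andP[/eqP]; rewrite ip_rip /=.
  by [].
have skew u v : rip (T u) ('i%C *: v) = - rip (T v) ('i%C *: u).
  have := im0 (u + v); rewrite (linD lT) scalerDr !ripE !im0 add0r addr0 => /eqP.
  by rewrite addr_eq0 => /eqP.
move=> u v; have := skew ('i%C *: u) v; rewrite (linZ lT) rip_ii.
by rewrite scalerA -expr2 sqr_i scaleN1r ripNr opprK (ripC u).
Qed.

Lemma psd_CS T : linear T -> symm T -> psd T ->
  forall u v, rip (T u) v ^+ 2 <= rip (T u) u * rip (T v) v.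
Proof.
move=> lT sT pT u v; apply: form_cauchy_schwarz => t.
have := pT (u + t *r v); rewrite (linD lT) (lin_real lT) !ripE.
rewrite (sT v) (ripC v (T u)).
by congr (0 <= _); ring.
Qed.

(** Cauchy--Schwarz for the form of [T], applied to [v] and [T v]. *)
Lemma psd_nrm T C : linear T -> symm T -> psd T -> bounded_by T C ->
  forall v, nrm (T v) ^+ 2 <= C * rip (T v) v.
Proof.
move=> lT sT pT bT v; rewrite -ripuu.
have [->|n0] := eqVneq (T v) 0.
  by rewrite !rip0l mulr0.
have rp : 0 < rip (T v) (T v).
  by rewrite lt_neqAle rip_ge0 andbT eq_sym; apply: contraNneq n0 => /rip0P ->.
have h := psd_CS lT sT pT v (T v).
have h2 : rip (T (T v)) (T v) <= C * rip (T v) (T v).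
  apply: le_trans (rip_le _ _) _; rewrite ripuu expr2 mulrA.
  by apply: ler_wpM2r; [exact: nrm_ge0 | exact: bT].
have h3 := pT v; rewrite -(ler_pM2r rp) -expr2; apply: le_trans h _.
by rewrite mulrAC mulrC; apply: ler_wpM2r.
Qed.

Lemma psd_bounded T C : linear T -> symm T -> psd T -> 0 <= C ->
  (forall v, rip (T v) v <= C * rip v v) -> bounded_by T C.
Proof.
move=> lT sT pT C0 hC v; rewrite -ler_sqr ?nnegrE ?mulr_ge0 ?nrm_ge0 //.
rewrite exprMn -!ripuu.
have [->|n0] := eqVneq (T v) 0.
  by rewrite rip0l mulr_ge0 ?sqr_ge0 ?rip_ge0.
have rp : 0 < rip (T v) (T v).
  by rewrite lt_neqAle rip_ge0 andbT eq_sym; apply: contraNneq n0 => /rip0P ->.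
rewrite -(ler_pM2r rp) -expr2; apply: le_trans (psd_CS lT sT pT v (T v)) _.
apply: le_trans (ler_pM (pT v) (pT (T v)) (hC v) (hC (T v))) _.
by rewrite le_eqVlt; apply/orP; left; apply/eqP; ring.
Qed.

(** The form of [T] is coercive, so [lax_milgram] solves [T v = w] for every [w]. *)
Lemma inverse_exists T C c : linear T -> bounded_by T C -> symm T -> 0 < c ->
  (forall v, c * rip v v <= rip (T v) v) ->
  exists P, [/\ linear P, bounded_by P c^-1, symm P /\ psd P,
    forall v, T (P v) = v & forall v, P (T v) = v].
Proof.
move=> lT bT sT c0 coer.
have coern v : c * nrm v <= nrm (T v).
  have [->|n0] := eqVneq (nrm v) 0; first by rewrite mulr0 nrm_ge0.
  have np : 0 < nrm v by rewrite lt_neqAle eq_sym n0 nrm_ge0.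
  rewrite -(ler_pM2r np) -mulrA -expr2 -ripuu.
  exact: le_trans (coer v) (rip_le _ _).
have injT u v : T u = T v -> u = v.
  move=> h; apply/eqP; rewrite -subr_eq0; apply/eqP/nrm0P/le_anti.
  rewrite nrm_ge0 andbT -(pmulr_rle0 _ c0).
  by apply: le_trans (coern _) _; rewrite (linB lT) h subrr nrm0.
have /choice[P hP] : forall w, exists v, T v = w.
  move=> w; have [||||v hv] := @lax_milgram _ H H idfun T C c (nrm w) (fun u => rip w u) _ lT bT sT c0 coer.
  - by [].
  - by move=> x y; rewrite ripDr.
  - by move=> r x; rewrite ripZr.
  - exact: rip_CS.
  by exists v; apply: rip_inj.
exists P; split=> //.
- by move=> k u v; apply: injT; rewrite lT !hP.
- move=> v; rewrite -(ler_pM2l c0) mulrA mulfV ?gt_eqF // mul1r.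
  by rewrite -{2}(hP v).
- split=> [u v|v]; first by rewrite -{1}(hP v) -sT hP.
  by rewrite -{2}(hP v) ripC; apply: le_trans (coer _); rewrite mulr_ge0 ?rip_ge0 ?ltW.
- by move=> v; apply: injT; rewrite hP.
Qed.

(** Inversion reverses the order: [<P w, w>] is the maximum over [v] of
    [2 <w, v> - <T v, v>], which decreases when [T] grows. *)
Lemma inverse_antitone T T' P P' : linear T -> symm T -> psd T ->
  (forall v, T (P v) = v) -> (forall v, T' (P' v) = v) ->
  (forall v, rip (T v) v <= rip (T' v) v) ->
  forall w, rip (P' w) w <= rip (P w) w.
Proof.
move=> lT sT pT hP hP' le w.
have := pT (P' w - P w); rewrite (linB lT) hP !ripE.
rewrite (sT (P' w) (P w)) hP.
have := le (P' w); rewrite hP' (ripC w (P w)) (ripC w (P' w)); lra.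
Qed.

(** The increments of [z] are positive contractions, so [psd_nrm] bounds
    [|(z n - z m) v|^2] by the increment of the convergent sequence [<z n v, v>]. *)
Lemma monotone_limit (z : nat -> H -> H) :
  (forall n, linear (z n)) -> (forall n, symm (z n)) -> (forall n, psd (z n)) ->
  (forall n v, rip (z n v) v <= rip v v) ->
  (forall m n v, (m <= n)%N -> rip (z m v) v <= rip (z n v) v) ->
  exists Z, [/\ linear Z, symm Z, forall v, tends (fun n => z n v) (Z v) &
     forall n v, rip (z n v) v <= rip (Z v) v].
Proof.
move=> lz sz pz z1 zm.
have qcvg v : exists q : R, (fun n => rip (z n v) v) @ \oo --> q /\ forall n, rip (z n v) v <= q.
  have nd : nondecreasing_seq (fun n => rip (z n v) v) by move=> m n mn; apply: zm.
  have cv : cvgn (fun n => rip (z n v) v).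
    apply: nondecreasing_is_cvgn => //; exists (rip v v) => _ [n _ <-]; exact: z1.
  exists (limn (fun n => rip (z n v) v)); split=> // n.
  exact: nondecreasing_cvgn_le.
have diff m n v : (m <= n)%N -> nrm (z n v - z m v) ^+ 2 <= rip (z n v) v - rip (z m v) v.
  move=> mn; have := @psd_nrm (fun v => z n v - z m v) 1.
  have ld : linear (fun v => z n v - z m v).
    by move=> k x y; rewrite (lz n) (lz m) scalerBr opprD addrACA.
  have sd : symm (fun v => z n v - z m v) by move=> x y; rewrite ripDl ripDr ripNl ripNr sz (sz m).
  have pd : psd (fun v => z n v - z m v) by move=> x; rewrite ripDl ripNl subr_ge0 zm.
  have bd : bounded_by (fun v => z n v - z m v) 1.
    apply: psd_bounded => // x; rewrite ripDl ripNl mul1r.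
    by have := z1 n x; have := pz m x; lra.
  by move=> /(_ ld sd pd bd v); rewrite mul1r ripDl ripNl.
have /choice[Z hZ] : forall v, exists l, tends (fun n => z n v) l.
  move=> v; have [q [hq qle]] := qcvg v.
  apply: (tends_complete_null (f := fun n => q - rip (z n v) v)).
    by rewrite -[X in _ --> X](subrr q); apply: cvgB => //; exact: cvg_cst.
  move=> i j; have := qle i; have := qle j.
  have [ij|/ltnW ij] := leqP i j; have := diff _ _ v ij; rewrite 1?nrmB; lra.
exists Z; split=> //.
- move=> k u v; apply: tends_uniq (hZ _) _.
  by under eq_fun do rewrite lz; apply: tendsD => //; apply: tendsZ.
- move=> u v; have h1 := tends_rip (hZ u) (tends_cst v).
  have h2 := tends_rip (tends_cst u) (hZ v).
  by apply: (rcvg_eq h1 h2) => n; exact: sz.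
- move=> n v; have [q [hq qle]] := qcvg v.
  have h2 := tends_rip (hZ v) (tends_cst v).
  by rewrite -(rcvg_eq hq h2 (fun=> erefl)).
Qed.

End Positive.

(** * Square roots and positive functionals on C*-algebras *)

Section CStarAlg.
Context {R : realType} {B : cstarAlgType R}.
Implicit Types (x y z b c h : B) (r : R).

Definition cn x : R := complex.Re (cnorm x).

Lemma cnorm0 : cnorm (0 : B) = 0.
Proof. by rewrite -(scale0r (0 : B)) cnormZ normr0 mul0r. Qed.

Lemma cnorm_ge0 x : 0 <= cnorm x.
Proof.
have := cnormD x (- x); rewrite subrr cnorm0 -scaleN1r cnormZ normrN normr1 mul1r.
by rewrite -mulr2n pmulrn_lge0.
Qed.

Lemma cnC x : cnorm x = ((cn x)%:C)%C.
Proof. by apply: ge0_ReK; exact: cnorm_ge0. Qed.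

Lemma cn_ge0 x : 0 <= cn x.
Proof. by apply: ge0_Re; exact: cnorm_ge0. Qed.

Lemma cnD x y : cn (x + y) <= cn x + cn y.
Proof. by have := cnormD x y; rewrite !cnC -(rmorphD (real_complex R)) lecR. Qed.

Lemma cnM x y : cn (x * y) <= cn x * cn y.
Proof. by have := cnormM x y; rewrite !cnC -(rmorphM (real_complex R)) lecR. Qed.

Lemma cnZ (k : R[i]) x : cn (k *: x) = complex.Re `|k| * cn x.
Proof. by rewrite /cn cnormZ {1}(ge0_ReK (normr_ge0 k)) ReM_real. Qed.

Lemma cnZr r x : cn (r *r x) = `|r| * cn x.
Proof. by rewrite cnZ normc_def /= expr0n /= addr0 sqrtr_sqr. Qed.

Lemma cn0 : cn 0 = 0. Proof. by rewrite /cn cnorm0. Qed.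

Lemma cnN x : cn (- x) = cn x.
Proof. by rewrite -scaleN1r cnZ normrN normr1 mul1r. Qed.

Lemma cnB x y : cn (x - y) = cn (y - x).
Proof. by rewrite -cnN opprB. Qed.

Lemma cn_dist x y z : cn (x - z) <= cn (x - y) + cn (y - z).
Proof. by rewrite -[x - z](subrKA y) cnD. Qed.

Lemma cn0P x : cn x = 0 -> x = 0.
Proof. by move=> h; apply: cnorm0_eq0; rewrite cnC h. Qed.

Lemma cn_starM x : cn (star x * x) = cn x ^+ 2.
Proof. by apply: complexI; rewrite -cnC cstar_identity cnC rmorphXn. Qed.

Lemma cn_star x : cn (star x) = cn x.
Proof.
have le z : cn z <= cn (star z).
  have [->|n0] := eqVneq (cn z) 0; first exact: cn_ge0.
  have np : 0 < cn z by rewrite lt_neqAle eq_sym n0 cn_ge0.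
  by rewrite -(ler_pM2r np) -expr2 -cn_starM cnM.
by apply: le_anti; rewrite le -{2}(starK x) le.
Qed.

Lemma star0 : star (0 : B) = 0.
Proof. by apply: (addrI (star 0)); rewrite -starD !addr0. Qed.

Lemma starN x : star (- x) = - star x.
Proof. by apply/eqP; rewrite -addr_eq0 -starD addNr star0. Qed.

Lemma star1 : star (1 : B) = 1.
Proof. by rewrite -[LHS]mulr1 -{2}(starK 1) -starM mulr1 starK. Qed.

Lemma starZr r x : star (r *r x) = r *r star x.
Proof. by rewrite starZ; congr (_ *: _); exact: conjc_real. Qed.

Lemma star_sum I (s : seq I) (P : pred I) (f : I -> B) :
  star (\sum_(i <- s | P i) f i) = \sum_(i <- s | P i) star (f i).
Proof. by apply: (big_morph star starD star0). Qed.

(** [1 - l] is a square root of [1 - h] exactly when [l] is a fixed point of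
    [y |-> (h + y^2) / 2], which is a contraction on a ball of radius below one. *)
Lemma cstar_sqrt h : star h = h -> cn h < 1 -> exists c, star c = c /\ c * c = 1 - h.
Proof.
move=> sh h1; pose r := cn h; have r0 : 0 <= r := cn_ge0 h.
pose f y := (2^-1 : R) *r (h + y * y).
have nf (x y : B) : cn x <= r -> cn y <= r -> cn (f x - f y) <= r * cn (x - y).
  move=> hx hy; rewrite /f -scalerBr cnZr ger0_norm ?invr_ge0 // opprD addrACA subrr add0r.
  have -> : x * x - y * y = x * (x - y) + (x - y) * y.
    by rewrite mulrBr mulrBl addrA subrK.
  have := cnD (x * (x - y)) ((x - y) * y).
  have := cnM x (x - y); have := cnM (x - y) y.
  have := ler_wpM2r (cn_ge0 (x - y)) hx; have := ler_wpM2l (cn_ge0 (x - y)) hy.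
  rewrite (mulrC _ r); lra.
have bf y : cn y <= r -> cn (f y) <= r.
  move=> hy; rewrite /f cnZr ger0_norm ?invr_ge0 //.
  have := cnD h (y * y); have := cnM y y; rewrite -/r.
  have := ler_pM (cn_ge0 y) (cn_ge0 y) hy hy.
  have : r * r <= r by rewrite -[leRHS]mulr1 ler_wpM2l // ltW.
  lra.
pose y n := iter n f 0.
have by_ n : cn (y n) <= r by elim: n => [|n ih]; [rewrite /y /= cn0 | exact: bf].
have sy n : star (y n) = y n.
  by elim: n => [|n ih]; rewrite /y /= ?star0 // /f starZr starD sh starM -/(y n) ih.
have cy n k : cn (y (n + k)%N - y n) <= r ^+ n.
  elim: n => [|n ih]; first by rewrite expr0 subr0 (le_trans (by_ _)) // ltW.
  rewrite addSn [y _.+1]/(f (y (n + k)%N)) [y _.+1]/(f (y n)) exprS.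
  by apply: le_trans (nf _ _ (by_ _) (by_ _)) _; apply: ler_wpM2l.
have cr : (fun n => r ^+ n) @ \oo --> (0 : R) by apply: cvg_expr; rewrite ger0_norm.
have [l hl] : exists l, forall e : R, 0 < e -> exists N, forall n, (N <= n)%N -> cn (y n - l) < e.
  have [|l hl] := @cnorm_complete _ _ y.
    move=> e e0; have er := ge0_ReK (ltW e0).
    move: e0; rewrite er ltcR => e0.
    have [|N hN] := (cvg_epsP _ _).1 cr (complex.Re e / 2); first by rewrite divr_gt0.
    exists N => i j Ni Nj; rewrite cnC ltcR.
    have := cn_dist (y i) (y N) (y j).
    have := cy N (i - N)%N; have := cy N (j - N)%N; rewrite !subnKC // => h3 h4.
    have := hN N (leqnn N); rewrite subr0 (cnB (y N) (y j)) ger0_norm ?exprn_ge0 //; lra.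
  exists l => e e0; have [|N hN] := hl ((e%:C)%C); first by rewrite ltcR.
  by exists N => n Nn; have := hN n Nn; rewrite cnC ltcR.
have lr : cn l <= r.
  apply: le_epsP => e e0; have [N hN] := hl e e0.
  have := cnD (y N) (- (y N - l)); rewrite opprB addrC subrK cnB.
  have := hN N (leqnn _); have := by_ N; lra.
have lf : f l = l.
  apply/eqP; rewrite -subr_eq0; apply/eqP/cn0P/le_anti; rewrite cn_ge0 andbT.
  apply: le_epsP => e e0; rewrite add0r; have [|N hN] := hl (e / 2); first by rewrite divr_gt0.
  have := cn_dist (f l) (y N.+1) l; have := hN N.+1 (leqnSn _).
  have := nf l (y N) lr (by_ N); rewrite -[f (y N)]/(y N.+1) (cnB l).
  have := hN N (leqnn _).
  have := ler_wpM2r (cn_ge0 (y N - l)) (ltW h1 : r <= 1); rewrite mul1r; lra.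
have sl : star l = l.
  apply/eqP; rewrite -subr_eq0; apply/eqP/cn0P/le_anti; rewrite cn_ge0 andbT.
  apply: le_epsP => e e0; rewrite add0r; have [|N hN] := hl (e / 2); first by rewrite divr_gt0.
  have := cn_dist (star l) (y N) l; have := hN N (leqnn _).
  have -> : cn (star l - y N) = cn (y N - l).
    by rewrite -{1}(sy N) -starN -starD cn_star cnB.
  lra.
exists (1 - l); rewrite starD starN star1 sl; split=> //.
rewrite mulrBl mul1r mulrBr mulr1.
have e2 : l + l = h + l * l.
  rewrite -{1 2}lf /f -scalerDl -(rmorphD (real_complex R)).
  by rewrite (_ : 2^-1 + 2^-1 = 1 :> R) ?scale1r //; field.
have -> : h = l + l - l * l by rewrite e2 addrK.
by rewrite !opprD !opprK !addrA.
Qed.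

(** Scaling brings [b^* b] below norm one, where [cstar_sqrt] applies.  This is how
    positivity on squares turns into norm bounds. *)
Lemma cstar_gap b r : cn b < r ->
  exists c, star c * c = ((r ^+ 2)%:C)%C *: 1 - star b * b.
Proof.
move=> br; have r0 : 0 < r := le_lt_trans (cn_ge0 b) br.
pose h := (r ^- 2) *r (star b * b).
have [||c [sc hc]] := @cstar_sqrt h.
- by rewrite /h starZr starM starK.
- rewrite /h cnZr ger0_norm ?invr_ge0 ?exprn_ge0 1?ltW // cn_starM.
  by rewrite mulrC ltr_pdivrMr ?exprn_gt0 // mul1r ltr_sqr ?nnegrE ?cn_ge0 ?ltW.
exists (r *r c); rewrite starZr -scalerAl -scalerAr scalerA -rmorphM -expr2 sc hc.
rewrite /h scalerBr scalerA -rmorphM mulfV ?scale1r //.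
by rewrite expf_neq0 // gt_eqF.
Qed.

Definition pos_functional (f : B -> R[i]) : Prop :=
  scalar f /\ forall x, 0 <= f (star x * x).

Section PosFunctional.
Context (f : B -> R[i]) (pf : pos_functional f).

Lemma pfD x y : f (x + y) = f x + f y.
Proof. by rewrite -{1}[x]scale1r pf.1 mul1r. Qed.
Lemma pf0 : f 0 = 0.
Proof. by apply: (addrI (f 0)); rewrite -pfD !addr0. Qed.
Lemma pfZ k x : f (k *: x) = k * f x.
Proof. by rewrite -[k *: x]addr0 pf.1 pf0 addr0. Qed.
Lemma pfN x : f (- x) = - f x.
Proof. by rewrite -scaleN1r pfZ mulN1r. Qed.
Lemma pf_sum I (s : seq I) (P : pred I) (g : I -> B) :
  f (\sum_(i <- s | P i) g i) = \sum_(i <- s | P i) f (g i).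
Proof. by apply: (big_morph f pfD pf0). Qed.

Lemma pf_im x : complex.Im (f (star x * x)) = 0.
Proof. by have := pf.2 x; rewrite ge0_complexP => /andP[/eqP]. Qed.

Lemma pf_re x : 0 <= complex.Re (f (star x * x)).
Proof. by apply: ge0_Re; exact: pf.2. Qed.

(** Polarisation: positivity at [1 + x] and [1 + i x] gives the two real
    components. *)
Lemma pf_star x : f (star x) = (f x)^*.
Proof.
have imD (a b : R[i]) : complex.Im (a + b) = complex.Im a + complex.Im b by case: a; case: b.
have h1 := pf_im (1 + x); have h2 := pf_im (1 + 'i%C *: x).
have h0 := pf_im 1; have hx := pf_im x; have hix := pf_im ('i%C *: x).
move: h1 h2 h0 hx hix.
rewrite !starD !star1 !(mulrDl, mulrDr, mul1r, mulr1) !pfD starZ !imD !pfZ.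
case: (f (star x)) => a b; case: (f x) => c d /=; rewrite !(mul0r, mul1r, mulr0, mulr1, add0r, addr0, sub0r).
move=> h1 h2 h3 h4 h5.
have -> : a = c by lra.
by have -> : b = - d by lra.
Qed.

Lemma pf_CS x y : complex.Re (f (star y * x)) ^+ 2 <=
  complex.Re (f (star x * x)) * complex.Re (f (star y * y)).
Proof.
apply: form_cauchy_schwarz => t; have h := pf_re (x + t *r y).
rewrite starD starZr !(mulrDl, mulrDr) -!scalerAl -!scalerAr scalerA in h.
rewrite -rmorphM !pfD !pfZ !ReD !ReM_real in h.
have e : complex.Re (f (star x * y)) = complex.Re (f (star y * x)).
  by rewrite -(starK (star x * y)) starM starK pf_star Re_conj.
by move: h; rewrite e; congr (0 <= _); ring.
Qed.

(** [f] is nonnegative at [(c a)^* (c a)] where [c^* c = r^2 - b^* b]. *)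
Lemma pf_mul_bound a b :
  complex.Re (f (star (b * a) * (b * a))) <= cn b ^+ 2 * complex.Re (f (star a * a)).
Proof.
apply: le_sqr_above => r br; have [c hc] := cstar_gap br.
have := pf_re (c * a); rewrite !starM -!mulrA (mulrA (star c)) hc mulrBl mulrBr.
by rewrite -scalerAl mul1r -scalerAr pfD pfN pfZ ReD ReN ReM_real !mulrA; lra.
Qed.

Lemma pf_bound b : complex.Re (f (star b * b)) <= cn b ^+ 2 * complex.Re (f 1).
Proof. by have := pf_mul_bound 1 b; rewrite star1 !mulr1. Qed.

Lemma pf_norm b : complex.Re `|f b| <= cn b * complex.Re (f 1).
Proof.
have p1 : 0 <= complex.Re (f 1) by have := pf_re 1; rewrite star1 mulr1.
have key x : complex.Re (f x) <= cn x * complex.Re (f 1).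
  apply: le_trans (ler_norm _) _.
  rewrite -ler_sqr ?nnegrE ?mulr_ge0 ?cn_ge0 // real_normK ?num_real //.
  have := pf_CS x 1; rewrite star1 !mul1r => h; apply: le_trans h _.
  rewrite exprMn expr2 expr2 mulrA -expr2; apply: ler_wpM2r => //.
  exact: pf_bound.
have [->|z0] := eqVneq (f b) 0; first by rewrite normr0 mulr_ge0 ?cn_ge0.
have := key (((f b)^* / `|f b|) *: b).
rewrite pfZ mulrAC (mulrC _ (f b)) -normCK expr2 mulfK ?normr_eq0 //.
rewrite cnZ normrM normfV normr_id norm_conjC mulfV ?normr_eq0 //=.
by rewrite mul1r.
Qed.

End PosFunctional.
End CStarAlg.

(** * Completely positive maps *)

Section CompletelyPositive.
Context {R : realType} {B : cstarAlgType R} {H : hilbertType R}.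
Implicit Types (F : B -> H -> H) (a b c : B) (u v w : H).

(** Complete positivity tested on the matrices [b_i^* b_j], which suffice because
    every positive matrix is a sum of such matrices, one for each row of its root. *)
Definition gram_positive F : Prop := forall n (b : 'I_n -> B) (v : 'I_n -> H),
  0 <= \sum_i \sum_j ip (F (star (b i) * b j) (v j)) (v i).

Lemma cp_gram F : completely_positive F -> gram_positive F.
Proof.
move=> [_ pF] [|n] b v; first by rewrite big_ord0.
pose c : 'M[B]_n.+1 := \matrix_(k, i) (if k == ord0 then b i else 0).
have := pF n.+1 (mxstar c *m c) (ex_intro _ c erefl) v.
congr (0 <= _); apply: eq_bigr => i _; apply: eq_bigr => j _; congr (ip (F _ _) _).
rewrite mxE big_ord_recl big1 ?addr0 => [|k _]; rewrite !mxE /= ?eqxx //.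
by rewrite mulr0.
Qed.

Lemma gram_cp F : (forall k b c, F (k *: b + c) = k *: F b + F c) ->
  gram_positive F -> completely_positive F.
Proof.
move=> lF gF; split=> // n b [c ->] v.
have F0 : F 0 = 0.
  by have := lF 1 0 0; rewrite !scale1r addr0 => h; apply: (addrI (F 0)); rewrite addr0 -h.
have Fsum (s : seq 'I_n) (f : 'I_n -> B) w :
    F (\sum_(k <- s) f k) w = \sum_(k <- s) F (f k) w.
  elim: s => [|k s ih]; first by rewrite !big_nil F0.
  by rewrite !big_cons -[f k]scale1r lF scale1r -ih scale1r.
rewrite (eq_bigr (fun i => \sum_j \sum_k ip (F (star (c k i) * c k j) (v j)) (v i))); last first.
  move=> i _; apply: eq_bigr => j _; rewrite mxE Fsum ip_suml; apply: eq_bigr => k _.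
  by rewrite !mxE.
under eq_bigr do rewrite exchange_big.
rewrite exchange_big /=; apply: sumr_ge0 => k _; exact: gF.
Qed.

Section Properties.
Context (F : B -> H -> H) (lin : forall b, linear (F b)) (cpF : completely_positive F).

Lemma cp_pf v : pos_functional (fun b => ip (F b v) v).
Proof.
split=> [k b c|b]; first by rewrite cpF.1 ip_linearl.
by have := cp_gram cpF (fun _ : 'I_1 => b) (fun=> v); rewrite !big_ord1.
Qed.

(** Both sides agree on the diagonal, because [<F - v, v>] is a positive functional;
    polarisation along [u + v] and [u - i v] does the rest. *)
Lemma cp_adjoint b : adjoint (F b) (F (star b)).
Proof.
have diag v : rip (F (star b) v) v = rip (F b v) v.
  by rewrite /rip (pf_star (cp_pf v)) Re_conj.
have diagi v : rip (F (star b) v) ('i%C *: v) = - rip (F b v) ('i%C *: v).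
  rewrite /rip !ipZr (pf_star (cp_pf v)); case: (ip _ _) => x y /=.
  by rewrite !mul0r !mulN1r !sub0r opprK.
have sym u v : rip (F b u) v + rip (F b v) u = rip (F (star b) u) v + rip (F (star b) v) u.
  have := diag (u + v); rewrite !(linD (lin _)) !ripE !diag; lra.
have skew u v : rip (F b u) v - rip (F b v) u = rip (F (star b) v) u - rip (F (star b) u) v.
  have := diagi (u - 'i%C *: v); rewrite !(linB (lin _)) !(linZ (lin _)) scalerBr scalerA.
  rewrite -expr2 sqr_i scaleN1r opprK !ripE !rip_ii.
  have := diagi u; have := diagi v; rewrite -!(rip_ii _ ('i%C *: v)).
  rewrite !scalerA -expr2 sqr_i !scaleN1r !ripE; lra.
have key u v : rip (F b u) v = rip u (F (star b) v).
  rewrite (ripC u); have := sym u v; have := skew u v; lra.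
by move=> u v; rewrite !ip_rip key -{1}(linZ (lin _)) key.
Qed.

(** Kadison--Schwarz inequality, from the Gram matrix of [1] and [b]. *)
Lemma cp_schwarz (F1 : F 1 = idfun) b v : nrm (F b v) ^+ 2 <= rip (F (star b * b) v) v.
Proof.
have := ge0_Re (cp_gram cpF (fun i : 'I_2 => [:: 1; b]`_i) (fun i : 'I_2 => [:: - F b v; v]`_i)).
rewrite !big_ord_recl !big_ord0 /= !addr0 star1 !mul1r !mulr1 F1 !ReD -!/(rip _ _) /=.
rewrite (adjoint_rip (adjoint_sym (cp_adjoint b))) !ripE -!ripuu /idfun.
lra.
Qed.

Lemma cp_norm (F1 : F 1 = idfun) b v : nrm (F b v) <= cn b * nrm v.
Proof.
rewrite -ler_sqr ?nnegrE ?mulr_ge0 ?cn_ge0 ?nrm_ge0 // exprMn.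
apply: le_trans (cp_schwarz F1 b v) _.
by have := pf_bound (cp_pf v) b; rewrite F1 /= -/(rip v v) ripuu.
Qed.

(** Choi's multiplicative domain: when equality holds in the Kadison--Schwarz
    inequality for [a], the formal vector [(a, v) - (1, F a v)] is null for the
    Gram form, hence orthogonal to every [(star b, w)]. *)
Lemma cp_mul_right (F1 : F 1 = idfun) a :
  (forall v, F (star a * a) v = F (star a) (F a v)) ->
  forall b v, F (b * a) v = F b (F a v).
Proof.
move=> ha b v; apply: rip_inj => w.
suff h t : 0 <= 0 + 2 * t * (rip (F (b * a) v) w - rip (F b (F a v)) w) +
    t ^+ 2 * rip (F (b * star b) w) w.
  have := form_cauchy_schwarz h; rewrite mul0r => h2.
  have /eqP : (rip (F (b * a) v) w - rip (F b (F a v)) w) ^+ 2 = 0.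
    by apply: le_anti; rewrite h2 sqr_ge0.
  by rewrite sqrf_eq0 subr_eq0 => /eqP.
have := ge0_Re (cp_gram cpF (fun i : 'I_3 => [:: a; 1; star b]`_i)
  (fun i : 'I_3 => [:: v; - F a v; t *r w]`_i)).
rewrite !big_ord_recl !big_ord0 /= !addr0 star1 starK !mul1r !mulr1 F1 !ReD -!/(rip _ _) /=.
rewrite /idfun !(linN (lin _)) !(lin_real (lin _)) !ripE ha.
rewrite !(adjoint_rip (adjoint_sym (cp_adjoint a))).
have -> : rip (F (star a * star b) w) v = rip (F (b * a) v) w.
  by rewrite -starM (adjoint_rip (adjoint_sym (cp_adjoint _))) ripC.
have -> : rip (F (star b) w) (F a v) = rip (F b (F a v)) w.
  by rewrite (adjoint_rip (adjoint_sym (cp_adjoint _))) ripC.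
by congr (0 <= _); ring.
Qed.

Lemma cp_mul_left (F1 : F 1 = idfun) a :
  (forall v, F (a * star a) v = F a (F (star a) v)) ->
  forall b v, F (a * b) v = F a (F b v).
Proof.
move=> ha b v; apply: rip_inj => w.
rewrite (adjoint_rip (cp_adjoint _)) starM cp_mul_right //; last by move=> u; rewrite starK.
by rewrite -!(adjoint_rip (cp_adjoint _)).
Qed.

End Properties.
End CompletelyPositive.

(** * The von Neumann algebra of a tracial state *)

Section BoundedOpFacts.
Context {R : realType} {H : hilbertType R}.
Implicit Types (T S : H -> H).

Lemma bounded_opI T C : linear T -> bounded_by T C -> bounded_op T.
Proof. by move=> lT bT; split=> //; apply: bounded_by_continuous bT. Qed.

Lemma bounded_opE T : bounded_op T -> exists2 C, 0 < C & bounded_by T C.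
Proof.
by move=> [lT cT]; have [C bC] := continuous_bounded_by lT cT; exact: bounded_byW bC.
Qed.

Lemma bounded_op_adjoint T : bounded_op T -> exists2 S, bounded_op S & adjoint T S.
Proof.
move=> bT; have [C C0 hC] := bounded_opE bT.
have [S [lS bS hS]] := adjoint_exists (ltW C0) bT.1 hC.
by exists S => //; apply: bounded_opI bS.
Qed.

Lemma bounded_op_comp T S : bounded_op T -> bounded_op S -> bounded_op (T \o S).
Proof.
move=> bT bS; have [C C0 hC] := bounded_opE bT; have [D D0 hD] := bounded_opE bS.
apply: (@bounded_opI _ (C * D)) => [k u v|v] /=; first by rewrite bS.1 bT.1.
by apply: le_trans (hC _) _; rewrite -mulrA ler_pM2l.
Qed.

Lemma opE k T S v : (k *: T + S) v = k *: T v + S v. Proof. by []. Qed.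

Lemma bounded_op_lin T S k : bounded_op T -> bounded_op S -> bounded_op (k *: T + S).
Proof.
move=> bT bS; have [C C0 hC] := bounded_opE bT; have [D D0 hD] := bounded_opE bS.
apply: (@bounded_opI _ (complex.Re `|k| * C + D)) => [l u v|v].
  by rewrite !opE bT.1 bS.1 !scalerDr !scalerA (mulrC k) addrACA.
rewrite opE; apply: le_trans (nrmD _ _) _.
rewrite nrmZ mulrDl -mulrA; apply: lerD; last exact: hD.
by apply: ler_wpM2l; [apply: ge0_Re | exact: hC].
Qed.

Lemma bounded_op_id : bounded_op (@idfun H).
Proof. by apply: (@bounded_opI _ 1) => // v; rewrite mul1r. Qed.

Lemma adjoint_comp T S T' S' : adjoint T T' -> adjoint S S' -> adjoint (T \o S) (S' \o T').
Proof. by move=> h1 h2 u v; rewrite /= h1 h2. Qed.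

Lemma ip_lim_eq (a b c d : nat -> H) l m p q :
  tends a l -> tends b m -> tends c p -> tends d q ->
  (forall n, ip (a n) (b n) = ip (c n) (d n)) -> ip l m = ip p q.
Proof.
move=> ha hb hc hd h; rewrite !ip_rip; congr Complex.
  by apply: rcvg_eq (tends_rip ha hb) (tends_rip hc hd) _ => n; rewrite /rip h.
apply: rcvg_eq (tends_rip ha (tendsZ 'i%C hb)) (tends_rip hc (tendsZ 'i%C hd)) _ => n.
by rewrite /rip !ipZr h.
Qed.

Lemma dense_op_eq (S : Type) (K : hilbertType R) (e : S -> H) (T T' : H -> K) C C' :
  dense_map e -> linear T -> linear T' -> bounded_by T C -> bounded_by T' C' ->
  (forall x, T (e x) = T' (e x)) -> T = T'.
Proof.
move=> de lT lT' bT bT' h; apply/funext => v; have [a ha] := de v.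
have h1 := tends_op lT bT ha; have h2 := tends_op lT' bT' ha.
by apply: tends_uniq h1 _; under eq_fun do rewrite h.
Qed.

End BoundedOpFacts.

Lemma dense_closure {R : realType} {H : hilbertType R} (S : Type) (e : S -> H) :
  closure (range e) = setT -> dense_map e.
Proof.
move=> h v.
have /choice[a ha] : forall n : nat, exists x, nrm (e x - v) < 2^-1 ^+ n.
  move=> n; have : closure (range e) v by rewrite h.
  have e0 : 0 < ((2^-1 ^+ n : R)%:C)%C by rewrite ltcR exprn_gt0 // invr_gt0.
  move=> /(_ _ (nbhsx_ballx v _ e0)) [_ [[x _ <-]]].
  rewrite -ball_normE /= nrmC ltcR nrmB => hx; by exists x.
exists a; apply: (tends_le (f := fun n => 2^-1 ^+ n)) cvg_half => n; exact: ltW.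
Qed.

Section Tracial.
Context {R : realType} {A : cstarAlgType R} {tau : A -> R[i]} (htau : tracial_state tau).
Context {H : hilbertType R} { pi : A -> H -> H} {xi : H} (hGNS : GNS tau pi xi).

Let e a := pi a xi.
Let M := vN_gen pi.

Let rpi : star_rep pi.
Proof. by case: hGNS. Qed.

Lemma gns_bounded a : bounded_op (pi a). Proof. by case: rpi. Qed.
Lemma gns_lin k a b : pi (k *: a + b) = k *: pi a + pi b. Proof. by case: rpi. Qed.
Lemma gns1 : pi 1 = idfun. Proof. by case: rpi. Qed.
Lemma gnsM a b : pi (a * b) = pi a \o pi b. Proof. by case: rpi. Qed.
Lemma gns_star a : adjoint (pi a) (pi (star a)). Proof. by case: rpi. Qed.

Lemma gns_vec_linear : linear e.
Proof. by move=> k a b; rewrite /e gns_lin. Qed.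

Lemma gns_dense : dense_map e.
Proof. by case: hGNS => _ _ h; apply: dense_closure. Qed.

Lemma gns_ip a b : ip (e a) (e b) = tau (star b * a).
Proof.
case: hGNS => _ h _; rewrite -h gnsM /=.
by rewrite (adjoint_sym (gns_star b)).
Qed.

Lemma trace_pf : pos_functional tau.
Proof. by case: htau. Qed.

Lemma traceC a b : tau (a * b) = tau (b * a).
Proof. by case: htau. Qed.

Lemma trace1 : tau 1 = 1. Proof. by case: htau. Qed.

Lemma gns_nrm2 a : nrm (e a) ^+ 2 = complex.Re (tau (star a * a)).
Proof. by rewrite -ripuu /rip gns_ip. Qed.

Lemma gns_nrm_star a : nrm (e (star a)) = nrm (e a).
Proof.
by apply/eqP; rewrite -(@eqrXn2 _ 2) ?nrm_ge0 // !gns_nrm2 starK traceC.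
Qed.

(** Right multiplication is bounded because the trace lets it be turned into
    left multiplication on adjoints. *)
Lemma rho_exists d : exists T : H -> H,
  [/\ linear T, bounded_by T (cn d) & forall a, T (e a) = e (a * d)].
Proof.
apply: extend_dense; [exact: cn_ge0 | exact: gns_vec_linear | exact: gns_dense | |].
- by move=> k a b; rewrite mulrDl -scalerAl gns_vec_linear.
- move=> a; rewrite -gns_nrm_star -(gns_nrm_star a) starM.
  rewrite -ler_sqr ?nnegrE ?mulr_ge0 ?cn_ge0 ?nrm_ge0 // exprMn !gns_nrm2 -(cn_star d).
  exact: (pf_mul_bound trace_pf).
Qed.

Definition rho d : H -> H := sval (cid (rho_exists d)).

Lemma rho_linear d : linear (rho d).
Proof. by rewrite /rho; case: cid => T []. Qed.
Lemma rho_bounded d : bounded_by (rho d) (cn d).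
Proof. by rewrite /rho; case: cid => T []. Qed.
Lemma rhoE d a : rho d (e a) = e (a * d).
Proof. by rewrite /rho; case: cid => T []. Qed.
Lemma rho_bop d : bounded_op (rho d).
Proof. exact: bounded_opI (@rho_linear d) (@rho_bounded d). Qed.

Lemma e1 : e 1 = xi. Proof. by rewrite /e gns1. Qed.

Lemma rho_xi d : rho d xi = e d.
Proof. by rewrite -e1 rhoE mul1r. Qed.

Lemma pi_e a b : pi a (e b) = e (a * b).
Proof. by rewrite /e gnsM. Qed.

Lemma rho_adjoint d : adjoint (rho d) (rho (star d)).
Proof.
have h a b : ip (rho d (e a)) (e b) = ip (e a) (rho (star d) (e b)).
  by rewrite !rhoE !gns_ip starM starK mulrA traceC mulrA.
move=> u v; have [a ha] := gns_dense u; have [b hb] := gns_dense v.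
apply: ip_lim_eq (tends_op (@rho_linear d) (@rho_bounded d) ha) hb ha
  (tends_op (@rho_linear _) (@rho_bounded _) hb) _ => n; exact: h.
Qed.

Lemma rho_pi d a : rho d \o pi a = pi a \o rho d.
Proof.
have [C _ hC] := bounded_opE (bounded_op_comp (rho_bop d) (gns_bounded a)).
have [D _ hD] := bounded_opE (bounded_op_comp (gns_bounded a) (rho_bop d)).
apply: (dense_op_eq gns_dense _ _ hC hD).
- by case: (bounded_op_comp (rho_bop d) (gns_bounded a)).
- by case: (bounded_op_comp (gns_bounded a) (rho_bop d)).
by move=> b /=; rewrite pi_e !rhoE pi_e mulrA.
Qed.

(** The graph of the modular conjugation [J : pi a xi |-> pi (star a) xi]. *)
Definition modular_pair (x x' : H) : Prop :=
  forall a, ip x (e a) = ip (e (star a)) x'.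

Lemma modular_pair_e b : modular_pair (e b) (e (star b)).
Proof. by move=> a; rewrite !gns_ip starK traceC. Qed.

Lemma modular_pairB x x' y y' : modular_pair x x' -> modular_pair y y' ->
  modular_pair (x - y) (x' - y').
Proof. by move=> h1 h2 a; rewrite ipDl ipDr ipNl ipNr h1 h2. Qed.

Lemma modular_pair_sym x x' : modular_pair x x' -> modular_pair x' x.
Proof. by move=> h a; rewrite ip_conj -{1}(starK a) -h -ip_conj. Qed.

Lemma modular_pair_nrm x x' : modular_pair x x' -> nrm x = nrm x'.
Proof.
have le y y' : modular_pair y y' -> nrm y <= nrm y'.
  move=> h; apply: (dense_nrm_le gns_dense); first exact: nrm_ge0.
  move=> a; rewrite /rip h -/(rip _ _); apply: le_trans (rip_le _ _) _.
  by rewrite gns_nrm_star mulrC.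
by move=> h; apply: le_anti; rewrite (le _ _ h) (le _ _ (modular_pair_sym h)).
Qed.

Lemma modular_pair_tends x x' (a : nat -> A) : modular_pair x x' ->
  tends (fun n => e (a n)) x -> tends (fun n => e (star (a n))) x'.
Proof.
move=> h; rewrite /tends => ha; apply: (cvg0_squeeze _ ha) => n; rewrite nrm_ge0.
by rewrite -(modular_pair_nrm (modular_pairB (modular_pair_e (a n)) h)) lexx.
Qed.

(** [J] is antiunitary: approximate [y] by vectors [pi a xi]. *)
Lemma modular_pair_ip x x' y y' : modular_pair x x' -> modular_pair y y' ->
  ip x y = ip y' x'.
Proof.
move=> hx hy; have [a ha] := gns_dense y.
by apply: ip_lim_eq (tends_cst x) ha (modular_pair_tends hy ha) (tends_cst x') _ => n.
Qed.

Lemma modular_pair_pi c x x' : modular_pair x x' ->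
  modular_pair (pi c x) (rho (star c) x').
Proof.
move=> h a; rewrite (gns_star c) pi_e h starM starK.
by rewrite -rhoE rho_adjoint.
Qed.

Lemma modular_pair_rho c x x' : modular_pair x x' ->
  modular_pair (rho c x) (pi (star c) x').
Proof.
move=> /modular_pair_sym /(modular_pair_pi (star c)); rewrite starK.
exact: modular_pair_sym.
Qed.

Definition rho_commutant : set (H -> H) :=
  [set T | bounded_op T /\ forall d, T \o rho d = rho d \o T].

(** [pi a xi] is [rho a xi], and [T] moves past [rho a]. *)
Lemma rho_commutant_pair T T' : rho_commutant T -> adjoint T T' ->
  modular_pair (T xi) (T' xi).
Proof.
move=> [_ cT] aT a; rewrite -{1}(rho_xi a) -(starK a) -(adjoint_sym (rho_adjoint _)) starK.
rewrite -[rho _ (T xi)]/((rho (star a) \o T) xi) -cT /= rho_xi; exact: aT.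
Qed.

Lemma commutant_pair S S' : commutant (range pi) S -> adjoint S S' ->
  modular_pair (S xi) (S' xi).
Proof.
move=> [_ cS] aS a; rewrite /e -(adjoint_sym (gns_star a)).
rewrite -[pi _ (S xi)]/((pi (star a) \o S) xi) -cS; last by exists (star a).
exact: aS.
Qed.

Lemma commute_adjoint (T T' S S' : H -> H) : adjoint T T' -> adjoint S S' ->
  T \o S = S \o T -> T' \o S' = S' \o T'.
Proof.
move=> hT hS h; apply: (adjoint_uniq (T := T \o S)); last exact: adjoint_comp.
by rewrite h; exact: adjoint_comp.
Qed.

(** The commutation theorem.  If [T] commutes with the right and [S] with the left
    multiplications, then [J T xi = T^* xi] and [J S xi = S^* xi]; expanding the
    matrix coefficients of [T S] and [S T] on [pi(A) xi] with these relations gives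
    the same value.  Membership in [M] thereby becomes commutation with the explicit
    operators [rho d]. *)
Lemma vN_genE : M = rho_commutant.
Proof.
apply/seteqP; split=> [T [bT cT]|T NT]; first split=> // d.
  by apply: cT; split=> [|_ [a _ <-]]; [exact: rho_bop | exact: rho_pi].
have [bT cT] := NT; split=> // S hS; have [bS cS] := hS.
have [T' bT' aT] := bounded_op_adjoint bT; have [S' bS' aS] := bounded_op_adjoint bS.
have cT' d : T' (rho d xi) = rho d (T' xi).
  have := commute_adjoint aT (rho_adjoint (star d)) (cT _).
  by rewrite starK => /(congr1 (fun f => f xi)).
have cS' c : S' (pi c xi) = pi c (S' xi).
  have := commute_adjoint aS (gns_star (star c)) (cS _ (imageT pi _)).
  by rewrite starK => /(congr1 (fun f => f xi)).
have [C _ hC] := bounded_opE (bounded_op_comp bT bS).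
have [D _ hD] := bounded_opE (bounded_op_comp bS bT).
apply: (dense_op_eq gns_dense _ _ hC hD).
- by case: (bounded_op_comp bT bS).
- by case: (bounded_op_comp bS bT).
move=> b; apply: (dense_ip_inj gns_dense) => c /=.
rewrite aT [RHS]aS.
have -> : T' (e c) = rho c (T' xi) by rewrite -cT' rho_xi.
have -> : S' (e c) = pi c (S' xi) by exact: cS'.
have -> : S (e b) = pi b (S xi) by exact: (congr1 (fun f => f xi) (cS _ (imageT pi b))).
have -> : T (e b) = rho b (T xi).
  by rewrite -rho_xi; exact: (congr1 (fun f => f xi) (cT b)).
have -> : ip (pi b (S xi)) (rho c (T' xi)) = ip (rho (star c) (pi b (S xi))) (T' xi).
  by rewrite rho_adjoint starK.
rewrite [RHS]rho_adjoint.
have hS1 := modular_pair_sym (commutant_pair hS aS).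
rewrite (modular_pair_ip (rho_commutant_pair NT aT)
  (modular_pair_rho (star b) (modular_pair_pi c hS1))) starK.
by have /= -> := congr1 (fun f => f (S xi)) (rho_pi (star c) b).
Qed.

End Tracial.

Section CommutantClosure.
Context {R : realType} {H : hilbertType R} (D : set (H -> H)).
Implicit Types (T S P : H -> H).
Let M := commutant D.

Lemma commutant_id : M idfun.
Proof. by split=> //; exact: bounded_op_id. Qed.

Lemma commutant_comp T S : M T -> M S -> M (T \o S).
Proof.
move=> [bT cT] [bS cS]; split; first exact: bounded_op_comp.
by move=> U DU; rewrite -compA (cS _ DU) compA (cT _ DU).
Qed.

Lemma commutant_inv T P : M T -> bounded_op P ->
  (forall v, T (P v) = v) -> (forall v, P (T v) = v) -> M P.
Proof.
move=> [bT cT] bP TP PT; split=> // S DS; apply/funext => v /=.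
have := congr1 (fun f => f (P v)) (cT _ DS); rewrite /= TP => <-.
by rewrite PT.
Qed.

Lemma commutant_lim (z : nat -> H -> H) T : D `<=` bounded_op ->
  (forall n, M (z n)) -> bounded_op T ->
  (forall v, tends (fun n => z n v) (T v)) -> M T.
Proof.
move=> Db Mz bT h; split=> // S DS; apply/funext => v /=.
have [C _ hC] := bounded_opE (Db _ DS).
have h1 := tends_op (Db _ DS).1 hC (h v).
apply: tends_uniq (h (S v)) _; move: h1; congr tends; apply/funext => n.
by have := congr1 (fun f => f v) ((Mz n).2 _ DS).
Qed.

Lemma commutant_lin k T S : D `<=` bounded_op -> M T -> M S -> M (k *: T + S).
Proof.
move=> Db [bT cT] [bS cS]; split; first exact: bounded_op_lin.
move=> U DU; apply/funext => v; rewrite /= !opE.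
rewrite (linD (Db _ DU).1) (linZ (Db _ DU).1).
have /= -> := congr1 (fun f => f v) (cT _ DU).
by have /= -> := congr1 (fun f => f v) (cS _ DU).
Qed.

End CommutantClosure.

Section VNClosure.
Context {R : realType} {A : cstarAlgType R} {tau : A -> R[i]} (htau : tracial_state tau).
Context {H : hilbertType R} { pi : A -> H -> H} {xi : H} (hGNS : GNS tau pi xi).
Implicit Types (x y T S P : H -> H).
Local Notation M := (vN_gen pi).

Let comm_bop : commutant (range pi) `<=` (@bounded_op R H).
Proof. by move=> T []. Qed.

Lemma vN_bop x : M x -> bounded_op x. Proof. by case. Qed.
Lemma vN_linear x : M x -> linear x. Proof. by case=> [[]]. Qed.
Lemma vN_id : M idfun. Proof. exact: commutant_id. Qed.
Lemma vN_comp x y : M x -> M y -> M (x \o y). Proof. exact: commutant_comp. Qed.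
Lemma vN_lin k x y : M x -> M y -> M (k *: x + y). Proof. exact: commutant_lin. Qed.
Lemma vN_lim (z : nat -> H -> H) T : (forall n, M (z n)) -> bounded_op T ->
  (forall v, tends (fun n => z n v) (T v)) -> M T.
Proof. exact: commutant_lim. Qed.
Lemma vN_0 : M 0.
Proof. by have := vN_lin (-1) vN_id vN_id; rewrite scaleN1r addNr. Qed.
Lemma vN_D x y : M x -> M y -> M (x + y).
Proof. by move=> Mx My; rewrite -[x]scale1r; apply: vN_lin. Qed.
Lemma vN_Z k x : M x -> M (k *: x).
Proof. by move=> Mx; rewrite -[_ *: _]addr0; apply: vN_lin => //; exact: vN_0. Qed.
Lemma vN_B x y : M x -> M y -> M (x - y).
Proof. by move=> Mx My; apply: vN_D => //; rewrite -scaleN1r; apply: vN_Z. Qed.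
Lemma vN_pi a : M (pi a).
Proof.
split; first exact: (gns_bounded hGNS).
by move=> S [_ cS]; rewrite cS //; exists a.
Qed.

Lemma vN_adjoint x : M x -> exists2 x', M x' & adjoint x x'.
Proof.
move=> Mx; have [x' bx' ax] := bounded_op_adjoint (vN_bop Mx); exists x' => //.
move: Mx; rewrite (vN_genE htau hGNS) => -[bx cx]; split=> // d.
by have := commute_adjoint ax (rho_adjoint htau hGNS (star d)) (cx _); rewrite starK.
Qed.

(** [xi] is separating: an element of [M] killing [xi] kills every [rho d xi]. *)
Lemma vN_separating x y : M x -> M y -> x xi = y xi -> x = y.
Proof.
move=> Mx My xy; have [C _ hC] := bounded_opE (vN_bop Mx).
have [D _ hD] := bounded_opE (vN_bop My).
apply: (dense_op_eq (gns_dense hGNS) (vN_linear Mx) (vN_linear My) hC hD) => a.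
move: Mx My; rewrite !(vN_genE htau hGNS) => -[_ cx] [_ cy].
rewrite -(rho_xi htau hGNS).
have /= -> := congr1 (fun f => f xi) (cx a); have /= -> := congr1 (fun f => f xi) (cy a).
by rewrite xy.
Qed.

(** Both sides are the two members of [modular_pair_ip], taken at the pairs of [y xi]
    and of [x^* xi]. *)
Lemma vN_trace x y : M x -> M y -> ip (x (y xi)) xi = ip (y (x xi)) xi.
Proof.
move=> Mx My; have [x' Mx' ax] := vN_adjoint Mx; have [y' My' ay] := vN_adjoint My.
move: Mx My; rewrite !(vN_genE htau hGNS) => Nx Ny; rewrite [LHS]ax [RHS]ay.
apply: (modular_pair_ip htau hGNS); first exact: (rho_commutant_pair Ny ay).
exact: (modular_pair_sym (rho_commutant_pair Nx ax)).
Qed.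

Lemma vN_nrm_adjoint x x' : M x -> adjoint x x' -> nrm (x xi) = nrm (x' xi).
Proof.
rewrite (vN_genE htau hGNS) => Nx ax; apply: (modular_pair_nrm htau hGNS).
exact: (rho_commutant_pair Nx ax).
Qed.

Lemma vN_approx x : exists a : nat -> A,
  forall n, nrm ((pi (a n) - x) xi) <= 2^-1 ^+ n.
Proof.
have [a ha] := gns_dense hGNS (x xi).
have /choice[k hk] : forall n : nat, exists m, nrm ((pi (a m) - x) xi) <= 2^-1 ^+ n.
  move=> n; have [|N hN] := (cvg_epsP _ _).1 ha (2^-1 ^+ n).
    by rewrite exprn_gt0 // invr_gt0.
  exists N; have := hN N (leqnn _); rewrite subr0 ger0_norm ?nrm_ge0 // => /ltW.
  by [].
by exists (a \o k).
Qed.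

End VNClosure.

(** * A normal trace on [M] is determined by its values on [A] *)

Section Egorov.
Context {R : realType} {A : cstarAlgType R} {tau : A -> R[i]} (htau : tracial_state tau).
Context {H : hilbertType R} { pi : A -> H -> H} {xi : H} (hGNS : GNS tau pi xi).
Implicit Types (x y z w : H -> H) (u v : H).
Local Notation M := (vN_gen pi).

Record decreasing_to_zero (z : nat -> H -> H) : Prop := {
  dtz_M : forall n, M (z n);
  dtz_symm : forall n, symm (z n);
  dtz_psd : forall n, psd (z n);
  dtz_le1 : forall n v, rip (z n v) v <= rip v v;
  dtz_decr : forall m n v, (m <= n)%N -> rip (z n v) v <= rip (z m v) v;
  dtz_lim : forall v, tends (fun n => z n v) 0 }.

Section Resolvents.
Context (d d' : nat -> H -> H) (Md : forall n, M (d n)) (ad : forall n, adjoint (d n) (d' n)).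
Context (Md' : forall n, M (d' n)).

Let lM x : M x -> linear x := @vN_linear _ _ _ _ x.

(** The weights [2^k] force [d k] to be small in operator norm on the range of the
    resolvent of the sum, while the sum itself stays small at [xi] because
    [|d k xi| <= 2^-k]. *)
Fixpoint wsum n j : H -> H :=
  if j is j'.+1 then (2 ^+ (n + j') : R) *r (d' (n + j')%N \o d (n + j')%N) + wsum n j' else 0.

Lemma wsumS n j v : wsum n j.+1 v =
  (2 ^+ (n + j) : R) *r d' (n + j)%N (d (n + j)%N v) + wsum n j v.
Proof. by []. Qed.

Lemma wsum_M n j : M (wsum n j).
Proof.
elim: j => [|j ih]; first exact: vN_0.
by apply: vN_lin => //; apply: vN_comp.
Qed.

Lemma wsum_symm n j : symm (wsum n j).
Proof.
elim: j => [|j ih] u v; first by rewrite rip0l rip0r.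
rewrite !wsumS !ripE ih (adjoint_rip (adjoint_sym (ad _))).
by rewrite -(adjoint_rip (ad _)).
Qed.

Lemma wsum_form n j v :
  rip (wsum n j.+1 v) v = 2 ^+ (n + j) * nrm (d (n + j)%N v) ^+ 2 + rip (wsum n j v) v.
Proof. by rewrite wsumS !ripE (adjoint_rip (adjoint_sym (ad _))) ripuu. Qed.

Lemma wsum_psd n j : psd (wsum n j).
Proof.
move=> v; elim: j => [|j ih]; first by rewrite rip0l.
by rewrite wsum_form addr_ge0 // mulr_ge0 ?sqr_ge0 // exprn_ge0.
Qed.

Lemma wsum_shift n j v : rip (wsum n.+1 j v) v <= rip (wsum n j.+1 v) v.
Proof.
elim: j => [|j ih].
  rewrite wsum_form !rip0l addr0 mulr_ge0 ?sqr_ge0 ?exprn_ge0 //.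
by rewrite wsum_form [leRHS]wsum_form addSnnS lerD2l.
Qed.

Lemma wsum_xi n j : (forall k, nrm (d k xi) <= 2^-1 ^+ k) ->
  rip (wsum n j xi) xi <= 2 * 2^-1 ^+ n - 2 * 2^-1 ^+ (n + j).
Proof.
move=> dxi; elim: j => [|j ih]; first by rewrite rip0l addn0 subrr.
rewrite wsum_form addnS (exprS 2^-1).
have h : 2 ^+ (n + j) * nrm (d (n + j)%N xi) ^+ 2 <= 2^-1 ^+ (n + j).
  have := dxi (n + j)%N; set k := (n + j)%N => hk.
  have e2 : 2 ^+ k * (2^-1 ^+ k * 2^-1 ^+ k) = 2^-1 ^+ k :> R.
    by rewrite mulrA -exprMn mulfV // expr1n mul1r.
  rewrite -[leRHS]e2; apply: ler_wpM2l; first exact: exprn_ge0.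
  by rewrite expr2; apply: ler_pM; rewrite ?nrm_ge0.
lra.
Qed.

Lemma resolvent_exists n j : exists p, [/\ M p, symm p, psd p, bounded_by p 1 &
  forall v, p v + wsum n j (p v) = v].
Proof.
pose s := wsum n j; pose T := idfun + s.
have MT : M T by apply: vN_D; [exact: vN_id | exact: wsum_M].
have [C C0 hC] := bounded_opE (vN_bop MT).
have sT : symm T by move=> u v; rewrite /T /= !ripE [rip (s u) v]wsum_symm.
have [|p [lp bp [sp pp] Tp pT]] := @inverse_exists _ H T C 1 (lM MT) hC sT ltr01.
  by move=> v; rewrite mul1r ripDl lerDl; exact: wsum_psd.
rewrite invr1 in bp; exists p; split=> //.
exact: commutant_inv MT (bounded_opI lp bp) Tp pT.
Qed.

Definition resolvent n j := sval (cid (resolvent_exists n j)).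
Lemma resolvent_M n j : M (resolvent n j).
Proof. by rewrite /resolvent; case: cid => p []. Qed.
Lemma resolvent_symm n j : symm (resolvent n j).
Proof. by rewrite /resolvent; case: cid => p []. Qed.
Lemma resolvent_psd n j : psd (resolvent n j).
Proof. by rewrite /resolvent; case: cid => p []. Qed.
Lemma resolvent_bounded n j : bounded_by (resolvent n j) 1.
Proof. by rewrite /resolvent; case: cid => p []. Qed.
Lemma resolventE n j v : resolvent n j v + wsum n j (resolvent n j v) = v.
Proof. by rewrite /resolvent; case: cid => p []. Qed.

Lemma resolvent_antitone n j n' j' :
  (forall v, rip (wsum n j v) v <= rip (wsum n' j' v) v) ->
  forall v, rip (resolvent n' j' v) v <= rip (resolvent n j v) v.
Proof.
move=> h.
apply: (@inverse_antitone _ _ (idfun + wsum n j) (idfun + wsum n' j')).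
- by apply: lM; apply: vN_D; [exact: vN_id | exact: wsum_M].
- by move=> u v; rewrite !ripDl !ripDr [rip (wsum n j u) v]wsum_symm.
- by move=> v; rewrite ripDl addr_ge0 ?rip_ge0 //; exact: wsum_psd.
- by move=> v; exact: resolventE.
- by move=> v; exact: resolventE.
- by move=> v; rewrite !ripDl lerD2l.
Qed.

(** [2^k d_k^* d_k] is one of the terms of [wsum n j.+1], whose form at [p v] is at
    most [|v|^2]. *)
Lemma resolvent_small n j v : nrm (d (n + j)%N (resolvent n j.+1 v)) ^+ 2 <=
  2^-1 ^+ (n + j) * nrm v ^+ 2.
Proof.
set p := resolvent n j.+1; set k := (n + j)%N.
have h1 : 2 ^+ k * nrm (d k (p v)) ^+ 2 <= rip (wsum n j.+1 (p v)) (p v).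
  by rewrite wsum_form lerDl; exact: wsum_psd.
have h2 : rip (wsum n j.+1 (p v)) (p v) <= nrm v ^+ 2.
  have e : rip v (p v) = rip (p v) (p v) + rip (wsum n j.+1 (p v)) (p v).
    by rewrite -ripDl resolventE.
  have h3 : rip v (p v) <= nrm v ^+ 2.
    apply: le_trans (rip_le _ _) _; rewrite expr2; apply: ler_wpM2l; first exact: nrm_ge0.
    by have := @resolvent_bounded n j.+1 v; rewrite mul1r.
  have := rip_ge0 (p v); lra.
rewrite exprVn mulrC ler_pdivlMr ?exprn_gt0 // mulrC.
exact: le_trans h1 h2.
Qed.

(** Expand both sides in [p v] and [s (p v)], where [v = p v + s (p v)]. *)
Lemma resolvent_gap n j v : rip v v - rip (resolvent n j v) v <= rip (wsum n j v) v.
Proof.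
set p := resolvent n j; set s := wsum n j.
have ls : linear s := lM (wsum_M n j).
have ev := @resolventE n j v; rewrite -/p -/s in ev.
rewrite -{1 2 4 5 6}ev -/p (linD ls) !ripE.
have h1 := @wsum_psd n j (p v); have h2 := @wsum_psd n j (s (p v)).
rewrite -/s in h1 h2.
have e1 : rip (s (s (p v))) (p v) = rip (s (p v)) (s (p v)) by exact: wsum_symm.
have := rip_ge0 (s (p v)); rewrite (ripC (p v) (s _)) e1; lra.
Qed.

Lemma resolvent_limit n : exists Z, [/\ M Z, symm Z,
  forall v, tends (fun j => v - resolvent n j v) (Z v) &
  forall j v, rip v v - rip (resolvent n j v) v <= rip (Z v) v].
Proof.
have [|||||Z [lZ sZ tZ leZ]] := @monotone_limit _ H (fun j => idfun - resolvent n j).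
- by move=> j; apply: lM; apply: vN_B; [exact: vN_id | exact: resolvent_M].
- by move=> j u v; rewrite !ripE [rip (resolvent n j u) v]resolvent_symm.
- move=> j v; rewrite !ripE subr_ge0; apply: le_trans (rip_le _ _) _.
  rewrite ripuu expr2; apply: ler_wpM2r; first exact: nrm_ge0.
  by have := @resolvent_bounded n j v; rewrite mul1r.
- by move=> j v; rewrite !ripE lerBlDr lerDl; exact: resolvent_psd.
- move=> i j v ij; rewrite !ripE lerD2l lerN2; apply: resolvent_antitone => w.
  elim: j ij => [|j ih]; first by rewrite leqn0 => /eqP ->.
  rewrite leq_eqVlt => /orP[/eqP -> //|]; rewrite ltnS => /ih /le_trans; apply.
  by rewrite wsum_form lerDr mulr_ge0 ?sqr_ge0 ?exprn_ge0.
exists Z; split=> //.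
  apply: (vN_lim (z := fun j => idfun - resolvent n j)) => // [j|].
    by apply: vN_B; [exact: vN_id | exact: resolvent_M].
  apply: (@bounded_opI _ _ _ 2) => // v.
  have h1 := tends_nrm (tZ v).
  apply: (rcvg_le h1 (cvg_cst _)) => j.
  apply: le_trans (nrmD _ _) _; rewrite nrmN.
  by have := @resolvent_bounded n j v; rewrite /idfun mul1r; lra.
by move=> j v; have := leZ j v; rewrite !ripE.
Qed.

(** The supremum over [j] of [1 - resolvent n j].  It dominates all cut-offs that
    start at index [n], so that normality can act on infinitely many errors at
    once. *)
Definition zlim n := sval (cid (resolvent_limit n)).
Lemma zlimP n : [/\ M (zlim n), symm (zlim n),
  forall v, tends (fun j => v - resolvent n j v) (zlim n v) &
  forall j v, rip v v - rip (resolvent n j v) v <= rip (zlim n v) v].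
Proof. by rewrite /zlim; case: cid. Qed.

Lemma zlim_form n v (C : R) :
  (forall j, rip v v - rip (resolvent n j v) v <= C) -> rip (zlim n v) v <= C.
Proof.
move=> h; have [_ _ t _] := zlimP n.
apply: (rcvg_le (tends_rip (t v) (tends_cst v)) (cvg_cst _)) => j.
by rewrite !ripE.
Qed.

Lemma zlim_psd n : psd (zlim n).
Proof.
move=> v; have [_ _ _ /(_ 0%N v)] := zlimP n; apply: le_trans.
rewrite subr_ge0; apply: le_trans (rip_le _ _) _.
rewrite ripuu expr2; apply: ler_wpM2r; first exact: nrm_ge0.
by have := @resolvent_bounded n 0 v; rewrite mul1r.
Qed.

Lemma zlim_bounded n : bounded_by (zlim n) 1.
Proof.
have [Mz sz _ _] := zlimP n.
apply: psd_bounded => //; [exact: lM | exact: zlim_psd |] => v.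
by apply: zlim_form => j; rewrite mul1r lerBlDr lerDl; exact: resolvent_psd.
Qed.

(** [wsum_xi] makes [zlim n] small at [xi]; commutation with [rho a] carries this to
    the dense set of the vectors [rho a xi]. *)
Lemma zlim_decreasing : (forall k, nrm (d k xi) <= 2^-1 ^+ k) -> decreasing_to_zero zlim.
Proof.
move=> dxi; split.
- by move=> n; have [] := zlimP n.
- by move=> n; have [] := zlimP n.
- exact: zlim_psd.
- by move=> n v; apply: zlim_form => j; rewrite lerBlDr lerDl; exact: resolvent_psd.
- move=> m n v; elim: n => [|n ih]; first by rewrite leqn0 => /eqP ->.
  rewrite leq_eqVlt => /orP[/eqP -> //|]; rewrite ltnS => /ih; apply: le_trans.
  apply: zlim_form => j; have [_ _ _ h] := zlimP n.
  apply: le_trans (h j.+1 v); rewrite lerD2l lerN2; apply: resolvent_antitone.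
  exact: wsum_shift.
have zxi n : nrm (zlim n xi) ^+ 2 <= 2 * 2^-1 ^+ n.
  have [Mz sz _ _] := zlimP n.
  have := psd_nrm (lM Mz) sz (@zlim_psd n) (@zlim_bounded n) xi; rewrite mul1r => h.
  apply: le_trans h _; apply: zlim_form => j.
  apply: le_trans (resolvent_gap _ _ _) _; apply: le_trans (wsum_xi _ _ dxi) _.
  by rewrite lerBlDr lerDl mulr_ge0 // exprn_ge0.
have txi : tends (fun n => zlim n xi) 0.
  apply/cvg_epsP => e e0.
  have [|N hN] := (cvg_epsP _ _).1 (cvgM0 2 (@cvg_half R)) (e ^+ 2); first exact: exprn_gt0.
  exists N => n Nn; rewrite !subr0 ger0_norm ?nrm_ge0 //.
  rewrite -ltr_sqr ?nnegrE ?nrm_ge0 ?ltW //; apply: le_lt_trans (zxi n) _.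
  by have := hN n Nn; rewrite subr0; apply: le_lt_trans; exact: ler_norm.
move=> v; apply/cvg_epsP => e e0; have [b hb] := gns_dense hGNS v.
have [|N1 h1] := (cvg_epsP _ _).1 hb (e / 2); first by rewrite divr_gt0.
pose a := b N1.
have ta : tends (fun n => zlim n (pi a xi)) 0.
  have := tends_op (@rho_linear _ _ _ htau _ _ _ hGNS a) (@rho_bounded _ _ _ htau _ _ _ hGNS a) txi.
  rewrite (lin0 (@rho_linear _ _ _ htau _ _ _ hGNS a)); congr tends; apply/funext => n.
  rewrite -(rho_xi htau hGNS); have [Mz _ _ _] := zlimP n.
  move: Mz; rewrite (vN_genE htau hGNS) => -[_ cz].
  by have := congr1 (fun f => f xi) (cz a).
have [|N2 h2] := (cvg_epsP _ _).1 ta (e / 2); first by rewrite divr_gt0.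
exists N2 => n Nn; rewrite !subr0 ger0_norm ?nrm_ge0 //.
have [Mz _ _ _] := zlimP n.
have := nrm_le_dist (zlim n v) (zlim n (pi a xi)); rewrite -(linB (lM Mz)).
have := @zlim_bounded n (v - pi a xi); rewrite mul1r (nrmB v).
have := h1 N1 (leqnn _); rewrite subr0 ger0_norm ?nrm_ge0 // -/a => ha.
have := h2 n Nn; rewrite !subr0 ger0_norm ?nrm_ge0 //.
lra.
Qed.

End Resolvents.
End Egorov.
Arguments decreasing_to_zero {R A H} pi z.

Section Uniqueness.
Context {R : realType} {A : cstarAlgType R} {tau : A -> R[i]} (htau : tracial_state tau).
Context {H : hilbertType R} { pi : A -> H -> H} {xi : H} (hGNS : GNS tau pi xi).
Implicit Types (x y z w : H -> H) (u v : H).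
Local Notation M := (vN_gen pi).

(** Normality is taken for sequences decreasing to zero, that is, for suprema equal to
    the identity; this form is inherited by composition with automorphisms. *)
Record sequentially_normal_trace (phi : (H -> H) -> R[i]) : Prop := {
  snt_linear : forall k x y, M x -> M y -> phi (k *: x + y) = k * phi x + phi y;
  snt_unit : phi idfun = 1;
  snt_pos : forall x, M x -> positive_op x -> 0 <= phi x;
  snt_trace : forall x y, M x -> M y -> phi (x \o y) = phi (y \o x);
  snt_normal : forall z : nat -> H -> H, decreasing_to_zero pi z ->
    (fun n => complex.Re (phi (z n))) @ \oo --> (0 : R) }.

Context (phi : (H -> H) -> R[i]) (hphi : sequentially_normal_trace phi).
Context (phi_pi : forall a, phi (pi a) = tau a).

Let psi x := complex.Re (phi x).

Let lM x : M x -> linear x := @vN_linear _ _ _ _ x.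

Lemma snt_re_lin (r : R) x y : M x -> M y -> psi (r *r x + y) = r * psi x + psi y.
Proof. by move=> Mx My; rewrite /psi (snt_linear hphi) // ReD ReM_real. Qed.

Lemma snt_re_Z (r : R) x : M x -> psi (r *r x) = r * psi x.
Proof.
move=> Mx; have M0 : M 0 by exact: vN_0.
have := snt_re_lin r Mx M0; rewrite addr0 => ->.
have := snt_re_lin 1 M0 M0; rewrite scaler0 addr0; lra.
Qed.

Lemma snt_re_B x y : M x -> M y -> psi (x - y) = psi x - psi y.
Proof.
move=> Mx My; rewrite addrC -scaleN1r.
have -> : (-1 : R[i]) = ((-1)%:C)%C by rewrite rmorphN1.
by rewrite snt_re_lin // mulN1r addrC.
Qed.

Lemma snt_re_psd x : M x -> symm x -> psd x -> 0 <= psi x.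
Proof.
move=> Mx sx px; apply: ge0_Re; apply: (snt_pos hphi) => //.
by apply: symm_positive_op => //; exact: lM.
Qed.

Lemma symmB x y : symm x -> symm y -> symm (x - y).
Proof. by move=> sx sy u v; rewrite !ripE [rip (x u) v]sx [rip (y u) v]sy. Qed.

Lemma snt_re_mono x y : M x -> M y -> symm x -> symm y ->
  (forall v, rip (x v) v <= rip (y v) v) -> psi x <= psi y.
Proof.
move=> Mx My sx sy xy; rewrite -subr_ge0 -snt_re_B //; apply: snt_re_psd.
- exact: vN_B.
- exact: symmB.
- by move=> v; rewrite !ripE subr_ge0.
Qed.

Lemma symm_sq x x' : adjoint x x' -> symm (x' \o x).
Proof.
move=> ax u v /=; rewrite (adjoint_rip (adjoint_sym ax)) -(adjoint_rip ax).
by [].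
Qed.

Lemma snt_re_sq x x' : M x -> M x' -> adjoint x x' -> 0 <= psi (x' \o x).
Proof.
move=> Mx Mx' ax; apply: snt_re_psd; [exact: vN_comp | exact: symm_sq |].
by move=> v /=; rewrite (adjoint_rip (adjoint_sym ax)) rip_ge0.
Qed.

Lemma snt_re_traceC x y : M x -> M y -> psi (x \o y) = psi (y \o x).
Proof. by move=> Mx My; rewrite /psi (snt_trace hphi). Qed.

Lemma snt_CS z w : M z -> M w -> symm z -> symm w ->
  psi (z \o w) ^+ 2 <= psi (z \o z) * psi (w \o w).
Proof.
move=> Mz Mw sz sw; apply: form_cauchy_schwarz => t.
pose x := t *r w + z; have Mx : M x by apply: vN_lin.
have sx : symm x by move=> u v; rewrite !ripE [rip (w u) v]sw [rip (z u) v]sz.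
have ax : adjoint x x by apply: symm_adjoint => //; exact: lM.
have := snt_re_sq Mx Mx ax.
have -> : x \o x = (t ^+ 2) *r (w \o w) + (t *r (w \o z) + (t *r (z \o w) + (z \o z))).
  apply/funext => v; rewrite /x /= !opE (linD (lM Mw)) (linD (lM Mz)).
  rewrite (lin_real (lM Mw)) (lin_real (lM Mz)) /= scalerDr scalerA -rmorphM -expr2.
  by rewrite !addrA.
have Mzz := vN_comp Mz Mz; have Mww := vN_comp Mw Mw.
have Mzw := vN_comp Mz Mw; have Mwz := vN_comp Mw Mz.
have M1 : M (t *r (z \o w) + (z \o z)) by apply: vN_lin.
have M2 : M (t *r (w \o z) + (t *r (z \o w) + (z \o z))) by apply: vN_lin.
rewrite !snt_re_lin // (snt_re_traceC Mw Mz).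
by congr (0 <= _); ring.
Qed.

(** The central estimate.  Approximating [y] by [pi (a k)] in the norm of [xi] and
    cutting down by the resolvents [p] makes the error small in operator norm, so
    the trace property gives a bound through [tau (a k^* a k)]; letting the cut-off
    tend to the identity uses normality. *)
Lemma snt_sq_le y y' : M y -> M y' -> adjoint y y' -> psi (y' \o y) <= nrm (y xi) ^+ 2.
Proof.
move=> My My' ay; have [a ha] := vN_approx hGNS y.
pose d n := pi (a n) - y; pose d' n := pi (star (a n)) - y'.
have Mpi b : M (pi b) := vN_pi hGNS b.
have Md n : M (d n) by exact: vN_B.
have Md' n : M (d' n) by exact: vN_B.
have ad n : adjoint (d n) (d' n).
  by move=> u v; rewrite /d /d' ipDl ipDr ipNl ipNr (gns_star hGNS) ay.
pose Z := zlim Md ad Md'.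
have hZ : decreasing_to_zero pi Z by exact: (zlim_decreasing htau hGNS).
have MZ n : M (Z n) := dtz_M hZ n.
have lZ n := lM (MZ n); have sZ n := dtz_symm hZ n.
have Myy' := vN_comp My My'; have My'y := vN_comp My' My.
have syy' : symm (y \o y') by apply: symm_sq; exact: adjoint_sym.
have sy'y : symm (y' \o y) by exact: symm_sq.
set w := y' \o y in My'y sy'y *.
have main n j (ep : R) : 0 < ep -> psi w <= 2 * psi (Z n \o w) +
    ((1 + ep) * nrm (pi (a (n + j)%N) xi) ^+ 2 + (1 + ep^-1) * 2^-1 ^+ (n + j)).
  move=> ep0; pose p := resolvent Md ad Md' n j.+1; pose b := a (n + j)%N.
  have Mp : M p by exact: resolvent_M.
  have sp : symm p by exact: resolvent_symm.
  have lp := lM Mp; have bp v : nrm (p v) <= nrm v.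
    by have := resolvent_bounded Md ad Md' n j.+1 v; rewrite mul1r.
  have ap : adjoint p p by exact: symm_adjoint.
  have bp2 v : rip (p v) (p v) <= rip v v by rewrite !ripuu ler_sqr ?nnegrE ?nrm_ge0.
  have MP := vN_comp Mp Mp.
  (* [|q|^2 - |p q|^2 <= 2 <(1 - p) q, q>] for [q = y' v], and [1 - p <= Z n] *)
  have step1 : psi w <= psi ((y \o p) \o (p \o y')) + 2 * psi (Z n \o w).
    have Mpy' := vN_comp Mp My'; have Myp := vN_comp My Mp.
    rewrite [psi w]snt_re_traceC // (snt_re_traceC (MZ n)) //.
    rewrite /w -(compA y' y) (snt_re_traceC My' (vN_comp My (MZ n))) //.
    have M3 := vN_comp Myp Mpy'.
    have Myzy : M ((y \o Z n) \o y') by do 2! apply: vN_comp => //.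
    rewrite addrC -snt_re_lin //.
    apply: snt_re_mono => //.
    - exact: vN_lin.
    - move=> u v; rewrite !opE !ripE /=; congr (_ * _ + _).
        by rewrite (adjoint_rip ay) sZ -(adjoint_rip (adjoint_sym ay)).
      by rewrite (adjoint_rip ay) sp sp -(adjoint_rip (adjoint_sym ay)).
    move=> v; rewrite opE !ripE /= !(adjoint_rip ay); set q := y' v.
    rewrite [rip (p (p q)) q]sp.
    have [_ _ _ /(_ j.+1 q)] := zlimP Md ad Md' n; rewrite -/(Z n) -/p => h.
    have := rip_ge0 (q - p q); rewrite !ripE (ripC q (p q)); lra.
  (* [|g|^2 <= (1 + ep) |f|^2 + (1 + 1/ep) |f - g|^2], and [resolvent_small] bounds [f - g] *)
  have step2 : psi ((p \o y') \o (y \o p)) <=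
      (1 + ep) * psi ((p \o pi (star b)) \o (pi b \o p)) + (1 + ep^-1) * 2^-1 ^+ (n + j).
    have Mpb : M ((p \o pi (star b)) \o (pi b \o p)).
      by apply: vN_comp; apply: vN_comp => //; exact: vN_pi.
    have psi1 : psi idfun = 1 by rewrite /psi (snt_unit hphi).
    have Mid : M idfun by exact: vN_id.
    set c := (1 + ep^-1) * 2^-1 ^+ (n + j).
    have -> : c = psi (c *r idfun) by rewrite snt_re_Z // psi1 mulr1.
    rewrite -snt_re_lin //; last exact: vN_Z.
    apply: snt_re_mono.
    - by apply: vN_comp; exact: vN_comp.
    - by apply: vN_lin => //; apply: vN_Z.
    - by apply: symm_sq; exact: adjoint_comp.
    - move=> u v; rewrite !opE !ripE; congr (_ * _ + _).
      exact: (symm_sq (adjoint_comp (gns_star hGNS b) ap)).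
    move=> v; rewrite opE !ripE /= [rip (p (y' _)) _]sp [rip (p (pi _ _)) _]sp.
    rewrite (adjoint_rip (adjoint_sym ay)) (adjoint_rip (adjoint_sym (gns_star hGNS b))).
    have := resolvent_small Md ad Md' n j v; rewrite -/p -!ripuu.
    have -> : d (n + j)%N (p v) = pi b (p v) - y (p v) by [].
    set f := pi b (p v); set g := y (p v); rewrite /idfun => hfg.
    have h : 0 <= rip (ep *r f + (f - g)) (ep *r f + (f - g)) / ep.
      by rewrite divr_ge0 ?rip_ge0 // ltW.
    have e : rip (ep *r f + (f - g)) (ep *r f + (f - g)) / ep =
        (1 + ep) * rip f f - rip g g + (1 + ep^-1) * rip (f - g) (f - g).
      by rewrite !ripE (ripC g f); field; rewrite gt_eqF.
    have h2 := ler_wpM2l (_ : 0 <= 1 + ep^-1) hfg.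
    have {}h2 := h2 (addr_ge0 ler01 (ltW _)); rewrite invr_gt0 in h2.
    have := h2 ep0; rewrite e in h; rewrite /c; lra.
  have step3 : psi ((p \o pi (star b)) \o (pi b \o p)) <= nrm (pi b xi) ^+ 2.
    rewrite snt_re_traceC; [|exact: vN_comp..].
    apply: le_trans (_ : psi (pi b \o pi (star b)) <= _); last first.
      rewrite /psi -(gnsM hGNS) phi_pi traceC // -(gns_nrm2 hGNS).
      by [].
    apply: snt_re_mono.
    - by apply: vN_comp; exact: vN_comp.
    - exact: vN_comp.
    - by apply: symm_sq; apply: adjoint_comp => //; exact: adjoint_sym (gns_star hGNS b).
    - by apply: symm_sq; exact: adjoint_sym (gns_star hGNS b).
    move=> v /=; rewrite !(adjoint_rip (gns_star hGNS b)) [rip (p (p _)) _]sp.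
    exact: bp2.
  have e0 : psi ((y \o p) \o (p \o y')) = psi ((p \o y') \o (y \o p)).
    by apply: snt_re_traceC; exact: vN_comp.
  have := ler_wpM2l (_ : 0 <= 1 + ep) step3; rewrite -/b => h4.
  have {}h4 := h4 (addr_ge0 ler01 (ltW ep0)).
  rewrite e0 in step1; lra.
have lima : (fun k => nrm (pi (a k) xi)) @ \oo --> nrm (y xi).
  apply: tends_nrm; apply: tends_le (@cvg_half R) => n; exact: (ha n).
have shift (f : nat -> R) (l : R) n : f @ \oo --> l -> (fun j => f (n + j)%N) @ \oo --> l.
  move=> hf; apply/cvg_epsP => e e0; have [N hN] := (cvg_epsP _ _).1 hf e e0.
  by exists N => j Nj; apply: hN; exact: leq_trans Nj (leq_addl _ _).
have main2 n (ep : R) : 0 < ep -> psi w <= 2 * psi (Z n \o w) + (1 + ep) * nrm (y xi) ^+ 2.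
  move=> ep0.
  have hl : (fun j => 2 * psi (Z n \o w) + ((1 + ep) * nrm (pi (a (n + j)%N) xi) ^+ 2 +
      (1 + ep^-1) * 2^-1 ^+ (n + j))) @ \oo -->
      2 * psi (Z n \o w) + ((1 + ep) * nrm (y xi) ^+ 2 + 0).
    apply: cvgD; first exact: cvg_cst.
    apply: cvgD; last by apply: cvgM0; apply: (shift (fun k => 2^-1 ^+ k)); exact: cvg_half.
    apply: cvgM; first exact: cvg_cst.
    have h := shift _ _ n lima.
    by rewrite expr2; apply: cvgM.
  rewrite -[X in _ + X]addr0.
  by apply: (rcvg_le (cvg_cst _) hl) => j; exact: main.
have limZ : (fun n => psi (Z n \o w)) @ \oo --> (0 : R).
  have h0 := snt_normal hphi hZ.
  have h1 : (fun n => psi (w \o w) * psi (Z n)) @ \oo --> (0 : R) by exact: cvgM0.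
  apply/cvg_epsP => e e0; have [|N hN] := (cvg_epsP _ _).1 h1 (e ^+ 2); first exact: exprn_gt0.
  exists N => n Nn; rewrite subr0 -ltr_sqr ?nnegrE ?(ltW e0) // real_normK ?num_real //.
  apply: le_lt_trans (snt_CS (MZ n) My'y (sZ n) sy'y) _.
  have h2 : 0 <= psi (w \o w) by apply: snt_re_sq => //; apply: symm_adjoint => //; exact: lM.
  have := hN n Nn; rewrite subr0; apply: le_lt_trans; apply: le_trans (ler_norm _).
  rewrite mulrC; apply: ler_wpM2l => //; apply: snt_re_mono => //.
  - exact: vN_comp.
  - by apply: symm_sq; exact: symm_adjoint.
  move=> v /=; rewrite sZ ripuu.
  by have := psd_nrm (lZ n) (sZ n) (dtz_psd hZ n) (zlim_bounded Md ad Md' n) v; rewrite mul1r.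
apply: le_epsP => e e0.
pose c := nrm (y xi) ^+ 2; have c0 : 0 <= c by exact: sqr_ge0.
pose ep := e / (c + 1); have ep0 : 0 < ep by rewrite divr_gt0 // ltr_wpDl.
have h : psi w <= 2 * 0 + (1 + ep) * c.
  have hl : (fun n => 2 * psi (Z n \o w) + (1 + ep) * c) @ \oo --> 2 * 0 + (1 + ep) * c.
    apply: cvgD; last exact: cvg_cst.
    by apply: cvgM => //; exact: cvg_cst.
  by apply: (rcvg_le (cvg_cst _) hl) => n; exact: main2.
have : ep * c <= e.
  by rewrite /ep mulrAC ler_pdivrMr ?ltr_wpDl //; nra.
rewrite -/c; lra.
Qed.

(** A self-adjoint element becomes positive after a real shift. *)
Lemma snt_real x : M x -> symm x -> complex.Im (phi x) = 0.
Proof.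
move=> Mx sx; have [C C0 hC] := bounded_opE (vN_bop Mx).
have Mid : M idfun by exact: vN_id.
have Mc : M (C *r idfun) by exact: vN_Z.
have : 0 <= phi (C *r idfun + x).
  apply: (snt_pos hphi); first exact: vN_D.
  apply: symm_positive_op.
  - by apply: lM; exact: vN_D.
  - by move=> u v; rewrite opE !ripE [rip (x u) v]sx.
  move=> v; rewrite opE !ripE /idfun; have := rip_CS (x v) v.
  have := ler_wpM2r (nrm_ge0 v) (hC v); rewrite ripuu ler_norml; nra.
rewrite (snt_linear hphi) // (snt_unit hphi) mulr1 ge0_complexP => /andP[/eqP + _].
by case: (phi x) => p q /=; rewrite add0r.
Qed.

Lemma snt_re_adjoint x x' : M x -> M x' -> adjoint x x' -> psi x = psi x'.
Proof.
move=> Mx Mx' ax; have Md : M ('i%C *: (x - x')) by apply: vN_Z; exact: vN_B.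
have := snt_real Md; rewrite -[_ *: _]addr0 (snt_linear hphi); [|exact: vN_B|exact: vN_0].
have -> : phi 0 = 0.
  have := snt_linear hphi 1 (vN_0 : M 0) (vN_0 : M 0); rewrite scale1r addr0 mul1r => h.
  by apply: (addrI (phi 0)); rewrite addr0 -h.
rewrite [x - x']addrC -scaleN1r (snt_linear hphi) // !addr0 addrC scaleN1r mulN1r.
have h : symm ('i%C *: (x - x')).
  move=> u v; apply: (adjoint_rip (S := 'i%C *: (x - x')) _) => {}u {}v.
  have opB (y z : H -> H) (w : H) : (y - z) w = y w - z w :> H by [].
  have opZ k (y : H -> H) (w : H) : (k *: y) w = k *: y w :> H by [].
  rewrite !opZ !opB ipZl ipZr ipDl ipDr ipNl ipNr ax (adjoint_sym ax).
  have -> : ('i%C : R[i])^* = - 'i%C by apply/eqP; rewrite eq_complex /= oppr0 !eqxx.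
  by rewrite mulNr -mulrN opprB.
move=> /(_ h); rewrite /psi.
by case: (phi x) => a b; case: (phi x') => c d /=; lra.
Qed.

Lemma snt_re_bound x : M x -> `|psi x| <= nrm (x xi).
Proof.
move=> Mx; have [x' Mx' ax] := vN_adjoint htau hGNS Mx.
have Mid : M idfun by exact: vN_id.
rewrite -ler_sqr ?nnegrE ?nrm_ge0 // real_normK ?num_real //.
apply: le_trans (snt_sq_le Mx Mx' ax); rewrite -[leRHS]mulr1.
apply: form_cauchy_schwarz => t; rewrite mulr1.
have M1 : M (t *r idfun + x) by exact: vN_lin.
have M2 : M (t *r idfun + x') by exact: vN_lin.
have ad : adjoint (t *r idfun + x) (t *r idfun + x').
  move=> u v; rewrite !opE ipDl ipDr ipZl ipZr ax; congr (_ * _ + _).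
  by apply/esym/eqP; rewrite eq_complex /= oppr0 !eqxx.
have := snt_re_sq M1 M2 ad.
have -> : (t *r idfun + x') \o (t *r idfun + x) =
    (t ^+ 2) *r idfun + (t *r x + (t *r x' + (x' \o x))).
  apply/funext => v; rewrite /= !opE /= (linD (lM Mx')) (lin_real (lM Mx')).
  by rewrite scalerDr scalerA -rmorphM -expr2 -!addrA.
have M3 : M (x' \o x) by exact: vN_comp.
have M4 : M (t *r x' + (x' \o x)) by exact: vN_lin.
have M5 : M (t *r x + (t *r x' + (x' \o x))) by exact: vN_lin.
rewrite !snt_re_lin // (snt_re_adjoint Mx Mx' ax).
have -> : psi idfun = 1 by rewrite /psi (snt_unit hphi).
by congr (0 <= _); ring.
Qed.

(** By [snt_sq_le], [phi] is continuous in the norm of [xi], in which elements of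
    [pi(A)] approximate every element of [M]. *)
Lemma snt_vector x : M x -> phi x = ip (x xi) xi.
Proof.
have key y : M y -> psi y = rip (y xi) xi.
  move=> My; have [a ha] := vN_approx hGNS y.
  have nxi : nrm xi = 1.
    apply/eqP; rewrite -(@eqrXn2 _ 2) ?nrm_ge0 // expr1n.
    by rewrite -(e1 hGNS) (gns_nrm2 hGNS) star1 mulr1 (trace1 htau).
  have h n : `|psi y - rip (y xi) xi| <= 2 * 2^-1 ^+ n.
    have Mp : M (pi (a n)) by exact: (vN_pi hGNS).
    have Md : M (pi (a n) - y) by exact: vN_B.
    have h1 := snt_re_bound Md; have h2 := rip_CS ((pi (a n) - y) xi) xi.
    rewrite nxi mulr1 in h2; rewrite snt_re_B // in h1.
    have e : psi (pi (a n)) = rip (pi (a n) xi) xi.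
      by rewrite /psi phi_pi /rip -{2}(e1 hGNS) (gns_ip hGNS) star1 mul1r.
    have := ha n; move: h1 h2; rewrite e !ripE !ler_norml; lra.
  have hl := cvgM0 2 (@cvg_half R).
  by apply/eqP; rewrite -subr_eq0 -normr_le0; exact: rcvg_le (cvg_cst _) hl h.
move=> Mx; have := key _ Mx; have := key _ (vN_Z (- 'i%C) Mx).
rewrite /psi /rip -[X in phi X]addr0 (snt_linear hphi) //; last exact: vN_0.
have -> : phi 0 = 0.
  have := snt_linear hphi 1 (vN_0 : M 0) (vN_0 : M 0); rewrite scale1r addr0 mul1r => h.
  by apply: (addrI (phi 0)); rewrite addr0 -h.
have -> : (- 'i%C *: x) xi = - 'i%C *: x xi by [].
rewrite ipZl addr0; case: (phi x) => a b; case: (ip (x xi) xi) => c d /=.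
rewrite !(oppr0, mul0r, sub0r, mulN1r, opprK) => -> ->.
by [].
Qed.

End Uniqueness.

(** * Automorphisms of [M] preserve the vector state *)

Section Automorphisms.
Context {R : realType} {A : cstarAlgType R} {tau : A -> R[i]} (htau : tracial_state tau).
Context {H : hilbertType R} { pi : A -> H -> H} {xi : H} (hGNS : GNS tau pi xi).
Implicit Types (x y w : H -> H) (u v : H).
Local Notation M := (vN_gen pi).

Let lM x : M x -> linear x := @vN_linear _ _ _ _ x.

Lemma op_leI x y : M x -> M y -> symm x -> symm y ->
  (forall v, rip (x v) v <= rip (y v) v) -> op_le x y.
Proof.
move=> Mx My sx sy h v; rewrite lecE -!/(rip _ _) h andbT.
have im0 z : M z -> symm z -> complex.Im (ip (z v) v) = 0.
  move=> Mz sz; have := ip_conj (z v) v; rewrite -(symm_adjoint (lM Mz) sz).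
  by case: (ip _ _) => a b [] /eqP; rewrite -addr_eq0 -mulr2n mulrn_eq0 => /eqP.
by rewrite !im0.
Qed.

Lemma op_le_rip x y : op_le x y -> forall v, rip (x v) v <= rip (y v) v.
Proof. by move=> h v; have := h v; rewrite lecE => /andP[]. Qed.

Section OneAutomorphism.
Context (theta : (H -> H) -> (H -> H)) (htheta : vN_automorphism M theta).

Lemma aut_M x : M x -> M (theta x).
Proof. by move=> Mx; case: (vna_bij htheta) => h _ _; apply: h. Qed.

Lemma aut_id : theta idfun = idfun.
Proof.
have Mid : M idfun by exact: vN_id.
have [y My hy] : exists2 y, M y & theta y = idfun.
  by case: (vna_bij htheta) => _ _ /(_ _ Mid) [y My hy]; exists y.
have := vna_mul htheta Mid My; rewrite (_ : idfun \o y = y) // hy => h.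
exact: esym h.
Qed.

Lemma aut_D x y : M x -> M y -> theta (x + y) = theta x + theta y.
Proof. by move=> Mx My; rewrite -{1}[x]scale1r (vna_linear htheta) // scale1r. Qed.

Lemma aut_0 : theta 0 = 0.
Proof.
have M0 : M 0 by exact: vN_0.
by have := aut_D M0 M0; rewrite addr0 => h; apply: (addrI (theta 0)); rewrite addr0 -h.
Qed.

Lemma aut_Z k x : M x -> theta (k *: x) = k *: theta x.
Proof.
move=> Mx; rewrite -[k *: x]addr0 (vna_linear htheta) ?aut_0 ?addr0 //.
exact: vN_0.
Qed.

Lemma aut_B x y : M x -> M y -> theta (x - y) = theta x - theta y.
Proof.
move=> Mx My; rewrite -scaleN1r aut_D //; last exact: vN_Z.
by rewrite aut_Z // scaleN1r.
Qed.

Lemma aut_symm x : M x -> symm x -> symm (theta x).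
Proof.
move=> Mx sx; apply: adjoint_symm; apply: (vna_star htheta) => //.
exact: symm_adjoint (lM Mx) sx.
Qed.

(** A self-adjoint [x] is positive exactly when [r + x] is invertible for all
    [r > 0], a property that automorphisms preserve. *)
Lemma aut_psd x : M x -> symm x -> psd x -> psd (theta x).
Proof.
move=> Mx sx px v0; rewrite leNgt; apply/negP => neg.
pose T := theta x; have MT : M T by exact: aut_M.
have sT : symm T by exact: aut_symm.
have lT := lM MT; have [C C0 hC] := bounded_opE (vN_bop MT).
pose S := [set r : R | forall v, - r * rip v v <= rip (T v) v].
have v0n : 0 < rip v0 v0.
  rewrite lt_neqAle rip_ge0 andbT eq_sym; apply: contraTneq neg => /rip0P ->.
  by rewrite -/T (lin0 lT) rip0l ltxx.
have Spos r : S r -> 0 < r.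
  move=> /(_ v0) h; have := le_lt_trans h neg; rewrite mulNr oppr_lt0.
  by rewrite pmulr_lgt0.
have hS : has_inf S.
  split; last by exists 0 => r /Spos /ltW.
  exists C => v; have := rip_CS (T v) v; have := ler_wpM2r (nrm_ge0 v) (hC v).
  rewrite ripuu ler_norml; nra.
pose r0 := inf S.
have Sr0 : S r0.
  move=> v; apply: le_epsP => e e0.
  have vp : 0 < rip v v + 1 by rewrite ltr_wpDl ?rip_ge0.
  have [r Sr hr] := inf_adherent (divr_gt0 e0 vp) hS.
  have h1 := Sr v; rewrite -/r0 in hr.
  have h2 := ler_wpM2r (rip_ge0 v) (ltW hr).
  have h3 : e / (rip v v + 1) * rip v v <= e.
    by rewrite mulrAC ler_pdivrMr // mulrDr mulr1 lerDl ltW.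
  lra.
(* [- r0] is the bottom of the spectrum of [T], yet [r0 + T] turns out invertible *)
have r0p := Spos _ Sr0.
have Mid : M idfun by exact: vN_id.
pose X := r0 *r idfun + x; pose Y := r0 *r idfun + T.
have MX : M X by exact: vN_lin.
have MY : M Y by exact: vN_lin.
have XE v : X v = r0 *r v + x v by [].
have YE v : Y v = r0 *r v + T v by [].
have [CX _ hCX] := bounded_opE (vN_bop MX).
have [|| P [lP bP _ XP PX]] := @inverse_exists _ H X CX r0 (lM MX) hCX _ r0p.
- by move=> u v; rewrite !XE !ripE [rip (x u) v]sx.
- by move=> v; rewrite XE !ripE lerDl; exact: px.
have MP : M P := commutant_inv MX (bounded_opI lP bP) XP PX.
have PY : theta P \o Y = idfun.
  have -> : Y = theta X by rewrite /X (vna_linear htheta) // aut_id.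
  rewrite -(vna_mul htheta) // (_ : P \o X = idfun) ?aut_id //.
  by apply/funext => v /=; rewrite PX.
have [K K0 hK] := bounded_opE (vN_bop (aut_M MP)).
have [D D0 hD] := bounded_opE (vN_bop MY).
have sY : symm Y by move=> u v; rewrite !YE !ripE [rip (T u) v]sT.
have pY : psd Y by move=> v; rewrite YE !ripE; have := Sr0 v; lra.
pose dl := (K ^+ 2 * D)^-1.
have kd : 0 < K ^+ 2 * D by rewrite mulr_gt0 // exprn_gt0.
have dp : 0 < dl by rewrite invr_gt0.
have : S (r0 - dl).
  move=> v; have h1 : nrm v ^+ 2 <= K ^+ 2 * D * rip (Y v) v.
    rewrite -mulrA; apply: le_trans (_ : K ^+ 2 * nrm (Y v) ^+ 2 <= _); last first.
      by rewrite ler_pM2l ?exprn_gt0 //; exact: psd_nrm (lM MY) sY pY hD v.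
    rewrite -exprMn ler_sqr ?nnegrE ?nrm_ge0 ?mulr_ge0 ?nrm_ge0 ?(ltW K0) //.
    by have := hK (Y v); rewrite -[theta P (Y v)]/((theta P \o Y) v) PY.
  have h2 : dl * rip v v <= rip (Y v) v by rewrite ripuu /dl mulrC ler_pdivrMr // mulrC.
  move: h2; rewrite YE !ripE; lra.
move=> Sd; have := ge_inf hS.2 Sd; rewrite -/r0; lra.
Qed.

End OneAutomorphism.

(** Composing a normal trace with an automorphism keeps it normal, because an
    automorphism and its inverse preserve order, hence suprema. *)
Lemma normal_comp (phi : (H -> H) -> R[i]) theta theta' :
  faithful_normal_trace M phi -> vN_automorphism M theta -> vN_automorphism M theta' ->
  (forall x, M x -> theta (theta' x) = x) -> (forall x, M x -> theta' (theta x) = x) ->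
  sequentially_normal_trace (pi := pi) (phi \o theta).
Proof.
move=> hp ht ht' tt' t't; have Mid : M idfun by exact: vN_id.
split.
- move=> k x y Mx My /=; rewrite (vna_linear ht) // (fnt_linear hp) //; exact: aut_M.
- by rewrite /= aut_id // (fnt_unit hp).
- move=> x Mx px /=; apply: (fnt_positive hp); first exact: aut_M.
  have sx := positive_op_symm (lM Mx) px.
  apply: symm_positive_op; [by apply: lM; exact: aut_M | exact: aut_symm |].
  by apply: aut_psd => //; exact: positive_op_psd.
- move=> x y Mx My /=; rewrite (vna_mul ht Mx My) (vna_mul ht My Mx).
  by apply: (fnt_trace hp); exact: aut_M.
move=> z hz; have Mz n := dtz_M hz n; have sz n := dtz_symm hz n.
pose y n := theta (idfun - z n).
have Mi n : M (idfun - z n) by exact: vN_B.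
have si n : symm (idfun - z n) by move=> u v; rewrite !ripE [rip (z n u) v]sz.
have My n : M (y n) by exact: aut_M.
have sy n : symm (y n) by exact: aut_symm.
have sid : symm (idfun : H -> H) by [].
have ymono m n : (m <= n)%N -> op_le (y m) (y n).
  move=> mn; apply: op_leI => // v; rewrite -subr_ge0 -ripNl -ripDl.
  have -> : y n v - y m v = theta (z m - z n) v.
    rewrite /y !aut_B // aut_id // -[_ - _]/((idfun v - theta (z n) v) - (idfun v - theta (z m) v)).
    by rewrite opprB addrC addrA subrK.
  apply: aut_psd => //; first exact: vN_B.
  - exact: symmB.
  - by move=> w; rewrite !ripE subr_ge0; exact: (dtz_decr hz).
have lub : sa_lub M [set y n | n in setT] idfun.
  split.
  - by split=> // u v.
  - move=> _ [n _ <-]; apply: op_leI => // v.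
    rewrite -subr_ge0 -ripNl -ripDl.
    have -> : idfun v - y n v = theta (z n) v.
      rewrite /y aut_B // aut_id // -[_ - _]/(idfun v - (idfun v - theta (z n) v)).
      by rewrite opprB addrC subrK.
    apply: aut_psd => //; exact: (dtz_psd hz).
  - move=> w [Mw aw] hw; have sw := adjoint_symm aw.
    have Mw' : M (theta' w) by exact: aut_M.
    have sw' : symm (theta' w) by exact: aut_symm.
    have h n v : rip v v - rip (z n v) v <= rip (theta' w v) v.
      have : psd (theta' (w - y n)).
        apply: aut_psd => //; [exact: vN_B | exact: symmB |] => u.
        by rewrite !ripE subr_ge0; apply: op_le_rip; apply: hw; exists n.
      move=> /(_ v); rewrite aut_B // t't //.
      rewrite -[X in rip X _]/(theta' w v - (v - z n v)) !ripE; lra.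
    have h1 v : rip v v <= rip (theta' w v) v.
      have hl : (fun n => rip v v - rip (z n v) v) @ \oo --> rip v v - rip 0 v.
        apply: cvgB; first exact: cvg_cst.
        by apply: tends_rip (tends_cst v); exact: (dtz_lim hz).
      apply: le_trans (rcvg_le hl (cvg_cst _) (h^~ v)).
      by rewrite rip0l subr0.
    apply: op_leI => // v.
    have : psd (theta (theta' w - idfun)).
      apply: aut_psd => //; [exact: vN_B | exact: symmB |] => u.
      by rewrite !ripE subr_ge0.
    move=> /(_ v); rewrite aut_B // tt' // aut_id //.
    by rewrite -[X in rip X _]/(w v - v) !ripE subr_ge0.
have dir : directed_family [set y n | n in setT].
  split; first by exists (y 0%N); exists 0%N.
  move=> _ _ [m _ <-] [n _ <-]; exists (y (maxn m n)); split; first by exists (maxn m n).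
  - by apply: ymono; exact: leq_maxl.
  - by apply: ymono; exact: leq_maxr.
have sub : [set y n | n in setT] `<=` selfadjoint_part M.
  by move=> _ [n _ <-]; split=> //; exact: symm_adjoint (lM (My n)) (sy n).
have nrml := fnt_normal hp sub dir lub.
pose q n := complex.Re (phi (theta (z n))).
have Mtz n : M (theta (z n)) by exact: aut_M.
have phiE n : phi (theta (z n)) = ((q n)%:C)%C.
  apply: ge0_ReK; apply: (fnt_positive hp) => //; apply: symm_positive_op.
  - exact: lM.
  - exact: aut_symm.
  - by apply: aut_psd => //; exact: (dtz_psd hz).
have phiy n : phi (y n) = ((1 - q n)%:C)%C.
  rewrite /y aut_B // aut_id // addrC -scaleN1r (fnt_linear hp) // (fnt_unit hp) phiE.
  by rewrite mulN1r addrC rmorphB rmorph1.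
have qdec : nonincreasing_seq q.
  move=> m n mn; have := fnt_positive hp (vN_B (Mtz m) (Mtz n)).
  have -> : theta (z m) - theta (z n) = theta (z m - z n) by rewrite aut_B.
  have pos : positive_op (theta (z m - z n)).
    apply: symm_positive_op.
    - by apply: lM; apply: aut_M => //; exact: vN_B.
    - by apply: aut_symm => //; [exact: vN_B | exact: symmB].
    - apply: aut_psd => //; [exact: vN_B | exact: symmB |].
      by move=> w; rewrite !ripE subr_ge0; exact: (dtz_decr hz).
  move=> /(_ pos); rewrite aut_B // addrC -scaleN1r (fnt_linear hp) // !phiE.
  by rewrite mulN1r addrC -rmorphB lecR subr_ge0.
have q0 n : 0 <= q n.
  by rewrite -lecR -phiE; apply: (fnt_positive hp) => //; apply: symm_positive_op;
    [exact: lM | exact: aut_symm | by apply: aut_psd => //; exact: (dtz_psd hz)].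
have qc : cvgn q by apply: nonincreasing_is_cvgn => //; exists 0 => _ [n _ <-].
have Lq n : limn q <= q n by exact: nonincreasing_cvgn_ge.
have L0 : 0 <= limn q by apply: rcvg_le (cvg_cst 0) qc q0.
have : phi idfun <= ((1 - limn q)%:C)%C.
  by apply: nrml => _ [n _ <-]; rewrite phiy lecR lerD2l lerN2.
rewrite (fnt_unit hp) -[X in X <= _](rmorph1 (real_complex R)) lecR => h.
have -> : (0 : R) = limn q by apply: le_anti; rewrite L0 /=; lra.
exact: qc.
Qed.

End Automorphisms.

(** * Hilbert completion of a semi-inner product space *)

Section HilbertBuild.
Context {R : realType} (V : lmodType R[i]) (f : V -> V -> R[i]).
Context (fl : forall k u v w, f (k *: u + v) w = k * f u w + f v w).
Context (fc : forall u v, f v u = (f u v)^*).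
Context (fpos : forall u, 0 <= f u u) (fdef : forall u, f u u = 0 -> u = 0).

Definition hnorm (u : V) : R := Num.sqrt (complex.Re (f u u)).

Context (fcomplete : forall a : nat -> V,
  (forall e : R, 0 < e -> exists N, forall i j, (N <= i)%N -> (N <= j)%N ->
     hnorm (a i - a j) < e) ->
  exists l, forall e : R, 0 < e -> exists N, forall n, (N <= n)%N -> hnorm (a n - l) < e).

Lemma hnorm_sq u : f u u = ((hnorm u ^+ 2)%:C)%C.
Proof. by rewrite sqr_sqrtr -?(ge0_ReK (fpos u)) //; apply: ge0_Re. Qed.

Lemma fZl k u w : f (k *: u) w = k * f u w.
Proof.
have f0 : f 0 w = 0.
  by have := fl 1 0 0 w; rewrite scale1r addr0 mul1r => h; apply: (addrI (f 0 w)); rewrite addr0 -h.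
by rewrite -[k *: u]addr0 fl f0 addr0.
Qed.

Lemma fDl u v w : f (u + v) w = f u w + f v w.
Proof. by rewrite -{1}[u]scale1r fl mul1r. Qed.

Lemma fDr u v w : f w (u + v) = f w u + f w v.
Proof. by rewrite fc fDl rmorphD /= -!fc. Qed.

Lemma fZr k u w : f w (k *: u) = k^* * f w u.
Proof. by rewrite fc fZl rmorphM /= -!fc. Qed.

Definition hnormC (u : V) : R[i] := ((hnorm u)%:C)%C.

Lemma hnormZ k u : hnormC (k *: u) = `|k| * hnormC u.
Proof.
apply/eqP; rewrite -(@eqrXn2 _ 2) ?mulr_ge0 ?normr_ge0 ?lecR ?sqrtr_ge0 //.
by rewrite exprMn normCK /hnormC -!(rmorphXn (real_complex R) 2) /= -!hnorm_sq fZl fZr mulrA.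
Qed.

Lemma hnormD u v : hnormC (u + v) <= hnormC u + hnormC v.
Proof.
rewrite -(rmorphD (real_complex R)) lecR -ler_sqr ?nnegrE ?addr_ge0 ?sqrtr_ge0 //.
have re w : complex.Re (f w w) = hnorm w ^+ 2 by rewrite hnorm_sq.
have sy : complex.Re (f v u) = complex.Re (f u v) by rewrite fc Re_conj.
have cs : complex.Re (f u v) ^+ 2 <= hnorm u ^+ 2 * hnorm v ^+ 2.
  rewrite -!re; apply: form_cauchy_schwarz => t.
  have := ge0_Re (fpos (u + t *r v)).
  rewrite !fDl !fDr !fZl !fZr (_ : (t%:C)%C^* = (t%:C)%C); last exact: conjc_real.
  by rewrite !ReD !ReM_real sy; congr (0 <= _); ring.
have cs2 : complex.Re (f u v) <= hnorm u * hnorm v.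
  apply: le_trans (ler_norm _) _; rewrite -ler_sqr ?nnegrE ?mulr_ge0 ?sqrtr_ge0 //.
  by rewrite real_normK ?num_real // exprMn.
rewrite -re !fDl !fDr !ReD sy !re; nra.
Qed.

Lemma hnorm_eq0 u : hnormC u = 0 -> u = 0.
Proof. by move=> h; apply: fdef; rewrite hnorm_sq rmorphXn /= -/(hnormC u) h expr0n. Qed.

(** An alias of [V], to carry the norm of the form [f]. *)
Definition hV : Type := V.
HB.instance Definition _ := GRing.Lmodule.on hV.
HB.instance Definition _ := Lmodule_isNormed.Build R[i] hV hnormD hnormZ hnorm_eq0.

Lemma hnormE (u : hV) : `|u| = ((hnorm u)%:C)%C. Proof. by []. Qed.

Lemma hV_complete (F : set_system hV) : ProperFilter F -> cauchy F -> cvg F.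
Proof.
move=> FF cF.
have /choice[x hx] : forall n : nat, exists x : hV, F (ball x (((2^-1 : R) ^+ n)%:C)%C).
  move=> n; apply: (cauchyP F).1 => //; rewrite ltcR exprn_gt0 // invr_gt0 //.
have h2 n : 0 < (2^-1 : R) ^+ n by rewrite exprn_gt0 // invr_gt0.
have bE (u v : hV) (e : R) : ball u (e%:C)%C v <-> hnorm (u - v) < e.
  by rewrite -ball_normE /= hnormE ltcR.
have tri (u v w : V) : hnorm (u - w) <= hnorm (u - v) + hnorm (v - w).
  rewrite -lecR rmorphD; have := hnormD (u - v) (v - w).
  by rewrite addrA subrK.
have sym (u v : V) : hnorm (u - v) = hnorm (v - u).
  have := hnormZ (-1) (u - v); rewrite scaleN1r opprB normrN normr1 mul1r.
  by move=> /complexI.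
have hd i j : hnorm (x i - x j) < 2^-1 ^+ i + 2^-1 ^+ j.
  have [z [/bE hi /bE hj]] := filter_ex (filterI (hx i) (hx j)).
  by apply: le_lt_trans (tri _ z _) _; rewrite ltrD // sym.
have [l hl] : exists l, forall e : R, 0 < e -> exists N, forall n, (N <= n)%N -> hnorm (x n - l) < e.
  apply: fcomplete => e e0.
  have [|N hN] := (cvg_epsP _ _).1 (@cvg_half R) (e / 2); first by rewrite divr_gt0.
  exists N => i j Ni Nj; have := hd i j; have := hN i Ni; have := hN j Nj.
  by rewrite !subr0 !ger0_norm ?exprn_ge0 ?invr_ge0 //; lra.
apply/cvg_ex; exists l; apply/cvg_ballP => e e0.
have er := ge0_ReK (ltW e0); move: e0; rewrite er ltcR => e0.
have [|N1 h1] := hl (complex.Re e / 2); first by rewrite divr_gt0.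
have [|N2 hN2] := (cvg_epsP _ _).1 (@cvg_half R) (complex.Re e / 2); first by rewrite divr_gt0.
pose n := maxn N1 N2; apply: filterS (hx n) => z /bE hz; apply/bE.
apply: le_lt_trans (tri _ (x n) _) _; rewrite (sym l).
have := h1 n (leq_maxl _ _); have := hN2 n (leq_maxr _ _).
by rewrite subr0 ger0_norm ?exprn_ge0 ?invr_ge0 //; lra.
Qed.

HB.instance Definition _ := Uniform_isComplete.Build hV hV_complete.
HB.instance Definition _ := isHilbert.Build R hV fl fc
  (fun u => etrans (hnorm_sq u) (rmorphXn (real_complex R) 2 (hnorm u))).

Lemma hilbert_build : exists (K : hilbertType R) (j : V -> K) (j' : K -> V),
  [/\ linear j, cancel j j', cancel j' j & forall u v, ip (j u) (j v) = f u v].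
Proof. by exists hV, id, id. Qed.

End HilbertBuild.

Section Completion.
Context {R : realType} (E : lmodType R[i]) (form : E -> E -> R[i]).
Context (fl : forall k u v w, form (k *: u + v) w = k * form u w + form v w).
Context (fc : forall u v, form v u = (form u v)^*).
Context (fpos : forall u, 0 <= form u u).
Implicit Types (x y : E) (l m : nat -> E).

Let rf x y : R := complex.Re (form x y).

Let f0l y : form 0 y = 0.
Proof.
have := fl 1 0 0 y; rewrite scale1r addr0 mul1r => h.
by apply: (addrI (form 0 y)); rewrite addr0 -h.
Qed.
Let fDl u v w : form (u + v) w = form u w + form v w.
Proof. by rewrite -{1}[u]scale1r fl mul1r. Qed.
Let fZl k u w : form (k *: u) w = k * form u w.
Proof. by rewrite -[k *: u]addr0 fl f0l addr0. Qed.
Let fDr u v w : form w (u + v) = form w u + form w v.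
Proof. by rewrite fc fDl rmorphD /= -!fc. Qed.
Let fZr k u w : form w (k *: u) = k^* * form w u.
Proof. by rewrite fc fZl rmorphM /= -!fc. Qed.
Let fNl u w : form (- u) w = - form u w.
Proof. by rewrite -scaleN1r fZl mulN1r. Qed.
Let fNr u w : form w (- u) = - form w u.
Proof. by rewrite fc fNl rmorphN /= -fc. Qed.

Let rfC x y : rf x y = rf y x. Proof. by rewrite /rf fc Re_conj. Qed.
Let rfDl x y z : rf (x + y) z = rf x z + rf y z. Proof. by rewrite /rf fDl ReD. Qed.
Let rfDr x y z : rf z (x + y) = rf z x + rf z y. Proof. by rewrite /rf fDr ReD. Qed.
Let rfNl x z : rf (- x) z = - rf x z. Proof. by rewrite /rf fNl ReN. Qed.
Let rfNr x z : rf z (- x) = - rf z x. Proof. by rewrite /rf fNr ReN. Qed.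
Let rfi x y : complex.Im (form x y) = rf x ('i%C *: y).
Proof. by rewrite /rf fZr; case: (form x y) => a b /=; rewrite mul0r mulN1r opprK add0r. Qed.
Let rf_skew x y : rf x ('i%C *: y) = - rf y ('i%C *: x).
Proof. by rewrite -!rfi fc; case: (form y x). Qed.
Let rfZl k x y : rf (k *: x) y = complex.Re k * rf x y - complex.Im k * rf x ('i%C *: y).
Proof. by rewrite -rfi /rf fZl; case: k => a b; case: (form x y). Qed.
Let rf_ge0 x : 0 <= rf x x. Proof. exact/ge0_Re/fpos. Qed.

Let sn x : R := Num.sqrt (rf x x).
Let sn2 x : rf x x = sn x ^+ 2. Proof. by rewrite sqr_sqrtr. Qed.
Let sn_ge0 x : 0 <= sn x. Proof. exact: sqrtr_ge0. Qed.

Let rf_CS x y : `|rf x y| <= sn x * sn y.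
Proof.
rewrite -ler_sqr ?nnegrE ?mulr_ge0 // real_normK ?num_real // exprMn -!sn2.
apply: form_cauchy_schwarz => t; have := rf_ge0 (x + t *r y).
have tZl z : rf (t *r y) z = t * rf y z by rewrite /rf fZl ReM_real.
have tZr z : rf z (t *r y) = t * rf z y by rewrite rfC tZl rfC.
by rewrite !rfDl !rfDr !tZl !tZr (rfC y x); congr (0 <= _); ring.
Qed.

Let snD x y : sn (x + y) <= sn x + sn y.
Proof.
rewrite -ler_sqr ?nnegrE ?addr_ge0 // -sn2 !rfDl !rfDr (rfC y x) !sn2.
have := rf_CS x y; rewrite ler_norml; nra.
Qed.

Let snZ k x : sn (k *: x) = complex.Re `|k| * sn x.
Proof.
apply/eqP; rewrite -(@eqrXn2 _ 2) ?mulr_ge0 ?ge0_Re //.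
rewrite exprMn -!sn2 /rf fZl fZr mulrA -normCK.
rewrite {1}(ge0_ReK (normr_ge0 k)) -(rmorphXn (real_complex R)) ReM_real.
by [].
Qed.

Let cauchyE l : Prop := forall e, 0 < e -> exists N, forall i j,
  (N <= i)%N -> (N <= j)%N -> sn (l i - l j) < e.

Let cauchyE_D l m k : cauchyE l -> cauchyE m -> cauchyE (fun n => k *: l n + m n).
Proof.
move=> cl cm e e0; pose c := complex.Re `|k| + 1.
have c0 : 0 < c by rewrite ltr_wpDl // ge0_Re.
have [|N1 h1] := cl (e / 2 / c); first by rewrite !divr_gt0.
have [|N2 h2] := cm (e / 2); first by rewrite divr_gt0.
exists (maxn N1 N2) => i j; rewrite !geq_max => /andP[i1 i2] /andP[j1 j2].
rewrite opprD addrACA -scalerBr; apply: le_lt_trans (snD _ _) _; rewrite snZ.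
have := h2 i j i2 j2; have := h1 i j i1 j1; rewrite ltr_pdivlMr // => h3 h4.
have : complex.Re `|k| * sn (l i - l j) <= sn (l i - l j) * c.
  by rewrite mulrC ler_wpM2l // lerDl.
lra.
Qed.

Let cauchyE_cst x : cauchyE (fun=> x).
Proof. by move=> e e0; exists 0%N => i j _ _; rewrite subrr /sn /rf f0l sqrtr0. Qed.

Let cauchyE_bounded l : cauchyE l -> exists2 B, 0 < B & exists N, forall n, (N <= n)%N -> sn (l n) <= B.
Proof.
move=> /(_ 1 ltr01)[N hN]; exists (sn (l N) + 1); first by rewrite ltr_wpDl.
exists N => n Nn; have := snD (l N) (l n - l N); rewrite addrC subrK.
have := hN n N Nn (leqnn _); lra.
Qed.

Let rcauchy (u : nat -> R) :
  (forall e, 0 < e -> exists N, forall i j, (N <= i)%N -> (N <= j)%N -> `|u i - u j| < e) ->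
  exists z : R, u @ \oo --> z.
Proof.
move=> h; suff /cvg_ex : cvg (u @ \oo) by [].
apply: cauchy_cvg; apply/cauchy_ballP => e e0; have [N hN] := h e e0.
exists (u @` [set n | (N <= n)%N], u @` [set n | (N <= n)%N]) => /=.
  by split; exists N => // n /= Nn; exists n.
move=> [x y] [/= [i Ni <-] [n Nn <-]]; rewrite -ball_normE /=; exact: hN.
Qed.

Let rf_cauchy l m : cauchyE l -> cauchyE m -> exists z : R, (fun n => rf (l n) (m n)) @ \oo --> z.
Proof.
move=> cl cm; apply: rcauchy => e e0.
have [B B0 [N hB]] := cauchyE_bounded cl; have [D D0 [N' hD]] := cauchyE_bounded cm.
have [|N1 h1] := cl (e / 2 / D); first by rewrite !divr_gt0.
have [|N2 h2] := cm (e / 2 / B); first by rewrite !divr_gt0.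
exists (maxn (maxn N N') (maxn N1 N2)) => i j.
rewrite !geq_max => /andP[/andP[iN iN'] /andP[i1 i2]] /andP[/andP[jN jN'] /andP[j1 j2]].
have -> : rf (l i) (m i) - rf (l j) (m j) = rf (l i - l j) (m i) + rf (l j) (m i - m j).
  by rewrite rfDl rfDr rfNl rfNr; ring.
apply: le_lt_trans (ler_normD _ _) _.
have := h1 i j i1 j1; have := h2 i j i2 j2; rewrite !ltr_pdivlMr // => a1 a2.
have := rf_CS (l i - l j) (m i); have := rf_CS (l j) (m i - m j).
have := ler_wpM2l (sn_ge0 (l i - l j)) (hD i iN').
have := ler_wpM2r (sn_ge0 (m i - m j)) (hB j jN).
rewrite (mulrC B); lra.
Qed.

(** Elements of the completion are the functionals [y |-> lim form (l n) y] given by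
    Cauchy sequences [l]; equality of functionals performs the quotient. *)
Definition represents (phi : E -> R[i]) l : Prop :=
  [/\ cauchyE l, forall y, (fun n => rf (l n) y) @ \oo --> complex.Re (phi y) &
      forall y, complex.Im (phi y) = complex.Re (phi ('i%C *: y))].

Definition completion_pred : pred (E -> R[i]^o) := fun phi => `[< exists l, represents phi l >].

Let rep_lin phi psi l m k : represents phi l -> represents psi m ->
  represents (fun y => k * phi y + psi y) (fun n => k *: l n + m n).
Proof.
move=> [cl hl il] [cm hm im]; split; first exact: cauchyE_D.
  move=> y; under eq_fun do rewrite rfDl rfZl.
  have -> : complex.Re (k * phi y + psi y) = complex.Re k * complex.Re (phi y) -
      complex.Im k * complex.Re (phi ('i%C *: y)) + complex.Re (psi y).
    by rewrite -il; case: k => a b; case: (phi y) => c d; case: (psi y).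
  apply: cvgD => //; apply: cvgB; apply: cvgM => //; exact: cvg_cst.
have eD (a b : R[i]) : complex.Im (k * a + b) =
    complex.Re k * complex.Im a + complex.Im k * complex.Re a + complex.Im b.
  by case: k => c d; case: a => x y; case: b.
move=> y; rewrite eD.
have -> : complex.Re (k * phi ('i%C *: y) + psi ('i%C *: y)) =
    complex.Re k * complex.Re (phi ('i%C *: y)) - complex.Im k * complex.Im (phi ('i%C *: y)) +
    complex.Re (psi ('i%C *: y)).
  by case: k {eD} => c d; case: (phi _) => a b; case: (psi _).
have ii : complex.Im (phi ('i%C *: y)) = - complex.Re (phi y).
  rewrite il scalerA -expr2 sqr_i scaleN1r.
  have h2 : (fun n => rf (l n) (- y)) @ \oo --> - complex.Re (phi y).
    by under eq_fun do rewrite rfNr; apply: cvgN.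
  exact: rcvg_eq (hl (- y)) h2 (fun=> erefl).
by rewrite ii il im; ring.
Qed.

Let rep_zero : represents (fun=> 0) (fun=> 0).
Proof.
split; [exact: cauchyE_cst | move=> y | by []].
by under eq_fun do rewrite /rf f0l; exact: cvg_cst.
Qed.

(** Along a Cauchy sequence [m], the values [phi (m n)] and [form (l n) (m n)] are
    asymptotic; this makes the limit inner product independent of the representing
    sequences. *)
Let rep_pair phi l m : represents phi l -> cauchyE m ->
  (fun n => complex.Re (phi (m n)) - rf (l n) (m n)) @ \oo --> (0 : R).
Proof.
move=> [cl hl _] cm; apply/cvg_epsP => e e0.
have [B B0 [N hB]] := cauchyE_bounded cm.
have [|N1 h1] := cl (e / 2 / B); first by rewrite !divr_gt0.
exists (maxn N N1) => n; rewrite geq_max => /andP[nN n1]; rewrite subr0.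
apply: (@le_lt_trans _ _ (e / 2)); last by lra.
have hlim : (fun i => `|rf (l (i + N1)%N) (m n) - rf (l n) (m n)|) @ \oo -->
    `|complex.Re (phi (m n)) - rf (l n) (m n)|.
  apply: cvg_norm; apply: cvgB; last exact: cvg_cst.
  apply/cvg_epsP => d d0; have [M hM] := (cvg_epsP _ _).1 (hl (m n)) d d0.
  by exists M => i Mi; apply: hM; exact: leq_trans Mi (leq_addr _ _).
apply: (rcvg_le hlim (cvg_cst _)) => i; rewrite -rfNl -rfDl.
apply: le_trans (rf_CS _ _) _.
have := h1 (i + N1)%N n (leq_addl _ _) n1; rewrite ltr_pdivlMr // => h3.
have := ler_wpM2l (sn_ge0 (l (i + N1)%N - l n)) (hB n nN); lra.
Qed.

Let rep_of phi : completion_pred phi -> exists l, represents phi l.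
Proof. by move/asboolP. Qed.

Lemma completion_submod : GRing.submod_closed completion_pred.
Proof.
split; first by apply/asboolP; exists (fun=> 0); exact: rep_zero.
move=> k phi psi /rep_of[l hl] /rep_of[m hm]; apply/asboolP.
by exists (fun n => k *: l n + m n); exact: rep_lin.
Qed.

HB.instance Definition _ := GRing.isSubmodClosed.Build R[i] (E -> R[i]^o) completion_pred completion_submod.

Record completion := Completion {
  cfun :> E -> R[i]^o;
  cfunP : cfun \in completion_pred }.

HB.instance Definition _ := [isSub for cfun].
HB.instance Definition _ := [Choice of completion by <:].
HB.instance Definition _ := [SubChoice_isSubLmodule of completion by <:].

Let K := completion.
Implicit Types (phi psi chi : K).

Let rep_ex phi : exists l, represents phi l.
Proof. exact: rep_of (cfunP phi). Qed.
Let kseq phi := sval (cid (rep_ex phi)).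
Let kseqP phi : represents phi (kseq phi). Proof. exact: svalP (cid (rep_ex phi)). Qed.
Let rep_cauchy phi l : represents phi l -> cauchyE l. Proof. by case. Qed.

Let rlim phi psi : exists z : R, (fun n => rf (kseq phi n) (kseq psi n)) @ \oo --> z.
Proof. by apply: rf_cauchy; [case: (kseqP phi) | case: (kseqP psi)]. Qed.
Let ripK phi psi : R := sval (cid (rlim phi psi)).
Let ipK phi psi : R[i] := Complex (ripK phi psi) (ripK phi ('i%C *: psi)).

Let ripKP phi psi l m : represents phi l -> represents psi m ->
  (fun n => rf (l n) (m n)) @ \oo --> ripK phi psi.
Proof.
move=> hl hm; have h0 : (fun n => rf (kseq phi n) (kseq psi n)) @ \oo --> ripK phi psi.
  exact: svalP (cid (rlim phi psi)).
have a1 := rep_pair hl (rep_cauchy hm).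
have a2 := rep_pair (kseqP phi) (rep_cauchy hm).
have a3 := rep_pair hm (rep_cauchy (kseqP phi)).
have a4 := rep_pair (kseqP psi) (rep_cauchy (kseqP phi)).
pose u n := rf (kseq phi n) (kseq psi n) +
  ((complex.Re (phi (m n)) - rf (kseq phi n) (m n)) - (complex.Re (phi (m n)) - rf (l n) (m n)) +
   ((complex.Re (psi (kseq phi n)) - rf (kseq psi n) (kseq phi n)) -
    (complex.Re (psi (kseq phi n)) - rf (m n) (kseq phi n)))).
have h : u @ \oo --> ripK phi psi + ((0 - 0) + (0 - 0)).
  by apply: cvgD => //; apply: cvgD; apply: cvgB.
have e : u = fun n => rf (l n) (m n).
  by apply/funext => n; rewrite /u (rfC (m n)) (rfC (kseq psi n)); ring.
by move: h; rewrite e subrr !addr0.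
Qed.

Let rep_linK k phi psi l m : represents phi l -> represents psi m ->
  represents (k *: phi + psi : K) (fun n => k *: l n + m n).
Proof. exact: rep_lin. Qed.

Let rep_Z k phi l : represents phi l -> represents (k *: phi : K) (fun n => k *: l n).
Proof.
move=> hl; have h0 : represents (0 : K) (fun=> 0) by exact: rep_zero.
have := rep_linK k hl h0; rewrite addr0.
by under eq_fun do rewrite addr0.
Qed.

Let rep_B phi psi l m : represents phi l -> represents psi m ->
  represents (phi - psi : K) (fun n => l n - m n).
Proof.
move=> hl hm; have := rep_linK (-1) hm hl; rewrite scaleN1r addrC.
by under eq_fun do rewrite scaleN1r addrC.
Qed.

Let ripK_uniq phi psi l m (z : R) : represents phi l -> represents psi m ->
  (fun n => rf (l n) (m n)) @ \oo --> z -> ripK phi psi = z.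
Proof. by move=> hl hm hz; exact: rcvg_eq (ripKP hl hm) hz (fun=> erefl). Qed.

Let ripK_sym phi psi : ripK phi psi = ripK psi phi.
Proof.
apply: ripK_uniq (kseqP phi) (kseqP psi) _; under eq_fun do rewrite rfC.
exact: ripKP (kseqP _) (kseqP _).
Qed.

Let ripK_skew phi psi : ripK phi ('i%C *: psi) = - ripK psi ('i%C *: phi).
Proof.
apply: ripK_uniq (kseqP phi) (rep_Z 'i%C (kseqP psi)) _; under eq_fun do rewrite rf_skew.
by apply: cvgN; exact: ripKP (kseqP _) (rep_Z _ (kseqP _)).
Qed.

Let ripK_lin k phi psi chi : ripK (k *: phi + psi) chi =
  complex.Re k * ripK phi chi - complex.Im k * ripK phi ('i%C *: chi) + ripK psi chi.
Proof.
apply: ripK_uniq (rep_linK k (kseqP phi) (kseqP psi)) (kseqP chi) _.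
under eq_fun do rewrite rfDl rfZl.
apply: cvgD; last exact: ripKP (kseqP _) (kseqP _).
apply: cvgB; apply: cvgM; try exact: cvg_cst.
  exact: ripKP (kseqP _) (kseqP _).
exact: ripKP (kseqP _) (rep_Z _ (kseqP _)).
Qed.

Let ipK_lin k phi psi chi : ipK (k *: phi + psi) chi = k * ipK phi chi + ipK psi chi.
Proof.
rewrite /ipK !ripK_lin.
have -> : ripK phi ('i%C *: ('i%C *: chi)) = - ripK phi chi.
  apply: ripK_uniq (kseqP phi) (rep_Z 'i%C (rep_Z 'i%C (kseqP chi))) _.
  under eq_fun do rewrite scalerA -expr2 sqr_i scaleN1r rfNr.
  by apply: cvgN; exact: ripKP (kseqP _) (kseqP _).
by case: k => a b; apply/eqP; rewrite eq_complex /= !mulrN !opprK eqxx /= [X in X + _]addrC.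
Qed.

Let ipK_conj phi psi : ipK psi phi = (ipK phi psi)^*.
Proof. by rewrite /ipK ripK_skew ripK_sym. Qed.

Let ripK_ge0 phi : 0 <= ripK phi phi.
Proof.
apply: (rcvg_le (cvg_cst 0) (ripKP (kseqP phi) (kseqP phi))) => n; exact: rf_ge0.
Qed.

Let ripK_i phi : ripK phi ('i%C *: phi) = 0.
Proof. by have := ripK_skew phi phi; lra. Qed.

Let ipK_pos phi : 0 <= ipK phi phi.
Proof. by rewrite ge0_complexP /ipK /= ripK_i eqxx ripK_ge0. Qed.

Let ipK_def phi : ipK phi phi = 0 -> phi = 0.
Proof.
move=> [h _]; have := ripKP (kseqP phi) (kseqP phi); rewrite h => h0.
have re0 y : complex.Re (phi y) = 0.
  have [_ hl _] := kseqP phi.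
  apply: rcvg_eq (hl y) _ (fun=> erefl).
  apply/cvg_epsP => e e0.
  have [|N hN] := (cvg_epsP _ _).1 (cvgM0 (sn y ^+ 2) h0) (e ^+ 2); first exact: exprn_gt0.
  exists N => n Nn; rewrite subr0 -ltr_sqr ?nnegrE ?(ltW e0) //.
  apply: le_lt_trans (_ : sn y ^+ 2 * rf (kseq phi n) (kseq phi n) < _); last first.
    by have := hN n Nn; rewrite subr0; apply: le_lt_trans; exact: ler_norm.
  by rewrite sn2 -exprMn mulrC ler_sqr ?nnegrE ?mulr_ge0 //; exact: rf_CS.
apply/val_inj/funext => y /=; have [_ _ hi] := kseqP phi.
by rewrite (complexE (phi y)) hi !re0 mulr0 addr0.
Qed.

Let embed_pred x : ((fun y => form x y) : E -> R[i]^o) \in completion_pred.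
Proof.
apply/asboolP; exists (fun=> x); split; first exact: cauchyE_cst.
- by move=> y; exact: cvg_cst.
- by move=> y; rewrite rfi.
Qed.
Let embed x : K := Completion (embed_pred x).

Let rep_embed x : represents (embed x) (fun=> x).
Proof.
split; first exact: cauchyE_cst.
- by move=> y; exact: cvg_cst.
- by move=> y /=; rewrite rfi.
Qed.

Let embed_lin : linear embed.
Proof. by move=> k x y; apply/val_inj/funext => z; rewrite /= fl. Qed.

Let ipK_embed x y : ipK (embed x) (embed y) = form x y.
Proof.
have h1 : ripK (embed x) (embed y) = rf x y.
  apply: ripK_uniq (rep_embed x) (rep_embed y) _; exact: cvg_cst.
have h2 : ripK (embed x) ('i%C *: embed y) = rf x ('i%C *: y).
  apply: ripK_uniq (rep_embed x) (rep_Z 'i%C (rep_embed y)) _; exact: cvg_cst.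
by rewrite /ipK h1 h2 -rfi /rf; case: (form x y).
Qed.

Let hn := hnorm ipK.

Let hn_approx phi l : represents phi l -> forall e, 0 < e -> exists N, forall n, (N <= n)%N ->
  hn (phi - embed (l n)) < e.
Proof.
move=> hl e e0; have cl := rep_cauchy hl.
have [|N hN] := cl (e / 2); first by rewrite divr_gt0.
exists N => n Nn; have hr := rep_B hl (rep_embed (l n)).
apply: (@le_lt_trans _ _ (e / 2)); last by lra.
rewrite /hn /hnorm /ipK /= -(@ger0_norm _ (e / 2)) -?sqrtr_sqr; last by rewrite ltW // divr_gt0.
apply: ler_wsqrtr.
have hlim := ripKP hr hr.
have hlim2 : (fun i => rf (l (i + N)%N - l n) (l (i + N)%N - l n)) @ \oo -->
    ripK (phi - embed (l n)) (phi - embed (l n)).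
  apply/cvg_epsP => d d0; have [M hM] := (cvg_epsP _ _).1 hlim d d0.
  by exists M => i Mi; apply: hM; exact: leq_trans Mi (leq_addr _ _).
apply: (rcvg_le hlim2 (cvg_cst _)) => i; rewrite sn2.
rewrite ler_sqr ?nnegrE //; last by rewrite ltW // divr_gt0.
by apply/ltW/hN => //; exact: leq_addl.
Qed.

Let hn_embed x : hn (embed x) = sn x.
Proof. by rewrite /hn /hnorm ipK_embed. Qed.

Let hnD phi psi : hn (phi + psi) <= hn phi + hn psi.
Proof.
have := hnormD ipK_lin ipK_conj ipK_pos phi psi.
by rewrite /hnormC -(rmorphD (real_complex R)) lecR.
Qed.

Let hnN phi : hn (- phi) = hn phi.
Proof.
have := hnormZ ipK_lin ipK_conj ipK_pos (-1) phi.
by rewrite scaleN1r normrN normr1 mul1r => /complexI.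
Qed.

Let ipK_complete (a : nat -> K) :
  (forall e : R, 0 < e -> exists N, forall i j, (N <= i)%N -> (N <= j)%N -> hn (a i - a j) < e) ->
  exists b : K, forall e : R, 0 < e -> exists N, forall n, (N <= n)%N -> hn (a n - b) < e.
Proof.
move=> ca.
have /choice[x hx] : forall n : nat, exists x, hn (a n - embed x) < 2^-1 ^+ n.
  move=> n; have [|N hN] := hn_approx (kseqP (a n)) (_ : 0 < 2^-1 ^+ n).
    by rewrite exprn_gt0 // invr_gt0.
  by exists (kseq (a n) N); exact: hN.
have cx : cauchyE x.
  move=> e e0; have [|N1 h1] := ca (e / 3); first by rewrite divr_gt0.
  have [|N2 h2] := (cvg_epsP _ _).1 (@cvg_half R) (e / 3); first by rewrite divr_gt0.
  exists (maxn N1 N2) => i j; rewrite !geq_max => /andP[i1 i2] /andP[j1 j2].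
  rewrite -hn_embed (linB embed_lin).
  have -> : embed (x i) - embed (x j) = - (a i - embed (x i)) + ((a i - a j) + (a j - embed (x j))).
    by rewrite subrKA opprB addrA subrK.
  have := hnD (- (a i - embed (x i))) ((a i - a j) + (a j - embed (x j))).
  have := hnD (a i - a j) (a j - embed (x j)); rewrite hnN.
  have := h1 i j i1 j1; have := hx i; have := hx j; have := h2 i i2; have := h2 j j2.
  rewrite !subr0 !ger0_norm ?exprn_ge0 ?invr_ge0 //; lra.
have /choice[g hg] : forall y, exists z : R, (fun n => rf (x n) y) @ \oo --> z.
  by move=> y; apply: (@rf_cauchy x (fun=> y)) => //; exact: cauchyE_cst.
have hrep : represents (fun y => Complex (g y) (g ('i%C *: y))) x by split.
have hpred : ((fun y => Complex (g y) (g ('i%C *: y))) : E -> R[i]^o) \in completion_pred.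
  by apply/asboolP; exists x.
have [b hb] : exists b : K, represents b x by exists (Completion hpred).
exists b => e e0.
have [|N1 h1] := hn_approx hb (_ : 0 < e / 2); first by rewrite divr_gt0.
have [|N2 h2] := (cvg_epsP _ _).1 (@cvg_half R) (e / 2); first by rewrite divr_gt0.
exists (maxn N1 N2) => n; rewrite geq_max => /andP[n1 n2].
have := hnD (a n - embed (x n)) (- (b - embed (x n))); rewrite hnN.
rewrite opprB subrKA => tri; apply: le_lt_trans tri _; rewrite (splitr e).
apply: ltrD (h1 n n1); apply: lt_trans (hx n) _.
by have := h2 n n2; rewrite subr0 ger0_norm // exprn_ge0 // invr_ge0.
Qed.

Theorem hilbert_completion : exists (V : hilbertType R) (j : E -> V),
  [/\ linear j, dense_map j & forall x y, ip (j x) (j y) = form x y].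
Proof.
have [V [j [j' [lj j'K jK hj]]]] := hilbert_build ipK_lin ipK_conj ipK_pos ipK_def ipK_complete.
exists V, (j \o embed); split.
- by move=> k x y /=; rewrite embed_lin lj.
- move=> v; exists (kseq (j' v)); apply/cvg_epsP => e e0.
  have [N hN] := hn_approx (kseqP (j' v)) e0; exists N => n Nn.
  rewrite subr0 ger0_norm ?nrm_ge0 //; apply: le_lt_trans (hN n Nn).
  have -> : (j \o embed) (kseq (j' v) n) - v = - j (j' v - embed (kseq (j' v) n)).
    by rewrite (linB lj) jK opprB.
  rewrite nrmN.
  rewrite -(ger0_norm (nrm_ge0 _)) -sqrtr_sqr -ripuu /rip hj.
  by rewrite /hn /hnorm.
- by move=> x y /=; rewrite hj ipK_embed.
Qed.

End Completion.

(** * Free modules *)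

Section FreeModule.
Context {R : realType} {S : choiceType}.
Local Notation E := {freeg S / R[i]}.

Definition gen (s : S) : E := [freeg [:: (1, s)]].

Lemma fglift_linear (M : lmodType R[i]) (f : S -> M) : linear (fglift f).
Proof.
have ladd : additive (fglift f) := lift_is_additive f.
pose A := GRing.isZmodMorphism.Build E M (fglift f) ladd.
pose L : {additive E -> M} := HB.pack (fglift f) A.
have lD x y : fglift f (x + y) = fglift f x + fglift f y by exact: (raddfD L).
have lsum I (s : seq I) (g : I -> E) : fglift f (\sum_(i <- s) g i) = \sum_(i <- s) fglift f (g i).
  exact: (raddf_sum L).
have dE D : fglift f D = \sum_(z <- dom D) coeff z D *: f z.
  by rewrite -{1}(freeg_sumE D) lsum; apply: eq_bigr => z _; rewrite liftU.
move=> k x y; rewrite lD; congr (_ + _).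
have -> : k *: x = \sum_(z <- dom x) [freeg [:: (k * coeff z x, z)]].
  apply/eqP/freeg_eqP => t.
  have cs : coeff t x = \sum_(z <- dom x) coeff t [freeg [:: (coeff z x, z)]].
    by rewrite -[in LHS](freeg_sumE x) (raddf_sum (coeff t)).
  rewrite [LHS]coeffZ cs [RHS](raddf_sum (coeff t)) mulr_sumr.
  by apply: eq_bigr => z _; rewrite coeffU mulrA; exact: esym (coeffU _ _ _).
rewrite lsum.
rewrite [in RHS]dE scaler_sumr; apply: eq_bigr => z _.
by rewrite liftU scalerA.
Qed.

Lemma fglift_gen (M : lmodType R[i]) (f : S -> M) s : fglift f (gen s) = f s.
Proof. by rewrite liftU scale1r. Qed.

Lemma free_span (D : E) : exists l : seq (R[i] * S), D = \sum_(p <- l) p.1 *: gen p.2.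
Proof.
exists [seq (coeff z D, z) | z <- dom D]; rewrite big_map -{1}(freeg_sumE D).
apply: eq_bigr => z _ /=; apply/eqP/freeg_eqP => y.
by rewrite coeffZ !coeffU mul1r.
Qed.

End FreeModule.

(** * Kolmogorov decomposition of a positive definite kernel *)

Section Kernel.
Context {R : realType} {S : choiceType} (k : S -> S -> R[i]).
Local Notation E := {freeg S / R[i]}.

Definition kernel_positive : Prop := forall l : seq (R[i] * S),
  0 <= \sum_(p <- l) \sum_(q <- l) p.1 * q.1^* * k p.2 q.2.

Context (kpos : kernel_positive).

(** Polarisation: positivity at [s + t] and [s + i t]. *)
Lemma kernel_conj s t : k t s = (k s t)^*.
Proof.
have h1 := kpos [:: (1, s); (1, t)]; have h2 := kpos [:: (1, s); ('i%C, t)].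
have h3 := kpos [:: (1, s)]; have h4 := kpos [:: (1, t)].
move: h1 h2 h3 h4; rewrite !big_cons !big_nil /= !addr0 rmorph1 !mulr1 !mul1r.
rewrite !ge0_complexP => /andP[/eqP h1 _] /andP[/eqP h2 _] /andP[/eqP h3 _] /andP[/eqP h4 _].
move: h1 h2 h3 h4; case: (k s s) => a b; case: (k s t) => c d; case: (k t s) => e f.
case: (k t t) => g h /=; rewrite !(mul0r, mul1r, mulr0, mulr1, add0r, addr0, sub0r, oppr0, mulrN, mulNr, opprK).
move=> h1 h2 h3 h4.
have -> : e = c by lra.
by have -> : f = - d by lra.
Qed.

Definition kform (x y : E) : R[i] :=
  (fglift (fun p => ((fglift (fun q => (k p q)^* : R[i]^o) y)^* : R[i]^o)) x).

Lemma kform_linear a x y z : kform (a *: x + y) z = a * kform x z + kform y z.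
Proof. exact: fglift_linear. Qed.

Lemma kform_gen s t : kform (gen s) (gen t) = k s t.
Proof. by rewrite /kform !fglift_gen conjCK. Qed.

Lemma kform_sum (l m : seq (R[i] * S)) :
  kform (\sum_(p <- l) p.1 *: gen p.2) (\sum_(q <- m) q.1 *: gen q.2) =
  \sum_(p <- l) \sum_(q <- m) p.1 * q.1^* * k p.2 q.2.
Proof.
have inner p : (fglift (fun q => (k p q)^* : R[i]^o) (\sum_(q <- m) q.1 *: gen q.2))^* =
    \sum_(q <- m) q.1^* * k p q.2.
  rewrite (lin_sum (fglift_linear _)) rmorph_sum; apply: eq_bigr => q _.
  rewrite (linZ (fglift_linear _)) fglift_gen.
  by rewrite -[_ *: _]/(q.1 * (k p q.2)^*) rmorphM /= conjCK.
rewrite /kform (lin_sum (fglift_linear _)); apply: eq_bigr => p _.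
rewrite (linZ (fglift_linear _)) fglift_gen inner.
rewrite -[_ *: _]/(p.1 * _) mulr_sumr; apply: eq_bigr => q _.
by rewrite mulrA.
Qed.

Lemma kform_conj x y : kform y x = (kform x y)^*.
Proof.
have [l ->] := free_span x; have [m ->] := free_span y.
rewrite !kform_sum rmorph_sum exchange_big /=; apply: eq_bigr => p _.
rewrite rmorph_sum; apply: eq_bigr => q _.
by rewrite !rmorphM /= conjCK -kernel_conj [_^* * _]mulrC.
Qed.

Lemma kform_pos x : 0 <= kform x x.
Proof. by have [l ->] := free_span x; rewrite kform_sum; exact: kpos. Qed.

Theorem kolmogorov : exists (K : hilbertType R) (j : E -> K),
  [/\ linear j, dense_map j & forall s t, ip (j (gen s)) (j (gen t)) = k s t].
Proof.
have [K [j [lj dj hj]]] := hilbert_completion kform_linear kform_conj kform_pos.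
by exists K, j; split=> // s t; rewrite hj kform_gen.
Qed.

End Kernel.

Section FreeDense.
Context {R : realType} {S : choiceType} {K : hilbertType R}.
Context (j : {freeg S / R[i]} -> K) (lj : linear j) (dj : dense_map j).
Let e s := j (gen s).

Lemma gen_op_eq (L : hilbertType R) (T T' : K -> L) C C' : linear T -> linear T' ->
  bounded_by T C -> bounded_by T' C' -> (forall s, T (e s) = T' (e s)) -> T = T'.
Proof.
move=> lT lT' bT bT' h; apply: (dense_op_eq dj lT lT' bT bT') => x.
have [l ->] := free_span x; rewrite (lin_sum lj) (lin_sum lT) (lin_sum lT').
by apply: eq_bigr => p _; rewrite (linZ lj) (linZ lT) (linZ lT') [X in _ *: X]h.
Qed.

Lemma gen_ip_inj (u v : K) : (forall s, ip u (e s) = ip v (e s)) -> u = v.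
Proof.
move=> h; apply: (dense_ip_inj dj) => x; have [l ->] := free_span x.
rewrite (lin_sum lj) !ip_sumr; apply: eq_bigr => p _.
by rewrite (linZ lj) !ipZr [X in _ * X]h.
Qed.

Lemma gen_adjoint (T T' : K -> K) : bounded_op T -> bounded_op T' ->
  (forall s t, ip (T (e s)) (e t) = ip (e s) (T' (e t))) -> adjoint T T'.
Proof.
move=> bT bT' h.
have [T2 bT2 aT] := bounded_op_adjoint bT.
suff -> : T' = T2 by [].
have [C _ hC] := bounded_opE bT'; have [D _ hD] := bounded_opE bT2.
apply: (gen_op_eq bT'.1 bT2.1 hC hD) => t; apply: gen_ip_inj => s.
by rewrite ip_conj -h aT -ip_conj.
Qed.

(** The norm bound makes [g] respect every linear relation among the generators. *)
Lemma gen_extend (L : hilbertType R) (g : S -> L) C : 0 <= C ->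
  (forall l : seq (R[i] * S), nrm (\sum_(p <- l) p.1 *: g p.2) <= C * nrm (\sum_(p <- l) p.1 *: e p.2)) ->
  exists T : K -> L, [/\ linear T, bounded_by T C & forall s, T (e s) = g s].
Proof.
move=> C0 h; have [||T [lT bT hT]] := extend_dense (g := fglift g) C0 lj dj.
- exact: fglift_linear.
- move=> x; have [l ->] := free_span x.
  have -> : fglift g (\sum_(p <- l) p.1 *: gen p.2) = \sum_(p <- l) p.1 *: g p.2.
    rewrite (lin_sum (fglift_linear _)); apply: eq_bigr => p _.
    by rewrite (linZ (fglift_linear _)) fglift_gen.
  have -> : j (\sum_(p <- l) p.1 *: gen p.2) = \sum_(p <- l) p.1 *: e p.2.
    by rewrite (lin_sum lj); apply: eq_bigr => p _; rewrite (linZ lj).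
  exact: h.
exists T; split=> // s; rewrite /e hT fglift_gen.
by [].
Qed.

End FreeDense.

(** * Dilation of a positive family *)

Lemma sum_fibers (V : nmodType) (I J : eqType) (s : seq I) (l : seq J) (key : J -> I)
    (F : I -> J -> V) : uniq s -> (forall p, p \in l -> key p \in s) ->
  \sum_(h <- s) \sum_(p <- l | key p == h) F h p = \sum_(p <- l) F (key p) p.
Proof.
move=> us; elim: l => [|p l ih] hl.
  by rewrite big_nil big1 // => h _; rewrite big_nil.
under eq_bigr do rewrite big_mkcond big_cons -big_mkcond.
rewrite big_split /= big_cons ih => [|q ql]; last by rewrite hl // inE ql orbT.
congr (_ + _); have ps : key p \in s by rewrite hl // mem_head.
rewrite (bigD1_seq _ ps us) /= eqxx big1 ?addr0 // => h; rewrite eq_sym => /negbTE ->.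
by [].
Qed.

Section Stinespring.
Context {R : realType} {G : groupType} {A : cstarAlgType R} (alpha : G -> A -> A).
Context (halpha : cstar_action alpha) {H : hilbertType R} (rep : A -> H -> H).
Context (hrep : star_rep rep) (x : G -> H -> H).
Context (xb : forall t, bounded_op (x t)) (x1 : x 1%g = idfun).
Context (xcov : forall t a, x t \o rep a = rep (alpha t a) \o x t).
Context (xpos : forall n (f : n.-tuple G), uniq f ->
  op_mx_positive (fun i j => x (tnth f i * (tnth f j)^-1)%g)).

Let S : choiceType := (G * H)%type.

(** The inner product of [Theta (u t) V v] and [Theta (u s) V w] for [p = (t, v)] and
    [q = (s, w)], in a dilation [F = V^* Theta V] with [F (u t) = x t]. *)
Definition family_kernel (p q : S) : R[i] := ip (x (q.1^-1 * p.1)%g p.2) q.2.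

(** Positivity of [x] concerns distinct group elements: collect the terms of a finite
    combination by their component in [G]. *)
Lemma family_kernel_positive : kernel_positive family_kernel.
Proof.
move=> l; pose key (p : R[i] * S) : G := (p.2.1)^-1%g.
pose s := undup [seq key p | p <- l].
pose V (g : G) : H := \sum_(p <- l | key p == g) p.1 *: p.2.2.
have us : uniq s by exact: undup_uniq.
have ks p : p \in l -> key p \in s by move=> pl; rewrite mem_undup map_f.
have := @xpos _ (in_tuple s) us (fun i => V (tnth (in_tuple s) i)).
congr (0 <= _).
rewrite -(big_tnth _ _ s xpredT (fun g => \sum_i
  ip (x (g * (tnth (in_tuple s) i)^-1)%g (V (tnth (in_tuple s) i))) (V g))).
under eq_bigr do rewrite -(big_tnth _ _ s xpredT (fun h => ip (x (_ * h^-1)%g (V h)) (V _))).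
transitivity (\sum_(g <- s) \sum_(p <- l) ip (x (g * (key p)^-1)%g (p.1 *: p.2.2)) (V g)).
  apply: eq_bigr => g _; rewrite -(sum_fibers (fun h p => ip (x (g * h^-1)%g (p.1 *: p.2.2)) (V g)) us ks).
  apply: eq_bigr => h _; rewrite /V (lin_sum (xb _).1) ip_suml.
  by [].
rewrite exchange_big /=; apply: eq_bigr => p _.
rewrite -(sum_fibers (fun g q => p.1 * q.1^* * family_kernel p.2 q.2) us ks).
apply: eq_bigr => g _; rewrite /V ip_sumr; apply: eq_bigr => q /eqP <-.
by rewrite (linZ (xb _).1) ipZl ipZr mulrA /key invgK /family_kernel.
Qed.

Lemma alphaM s t a : alpha (s * t)%g a = alpha s (alpha t a).
Proof. by case: halpha. Qed.
Lemma alpha1 a : alpha 1%g a = a. Proof. by case: halpha. Qed.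
Lemma alpha_hom s : star_hom (alpha s). Proof. by case: halpha. Qed.
Lemma alphaK s a : alpha s (alpha s^-1%g a) = a.
Proof. by rewrite -alphaM mulgV alpha1. Qed.
Let repM a b v : rep (a * b) v = rep a (rep b v).
Proof. by case: hrep => _ _ _ -> _. Qed.
Let rep_star a : adjoint (rep a) (rep (star a)).
Proof. by case: hrep. Qed.
Let rep1 v : rep 1 v = v.
Proof. by case: hrep => _ _ -> _ _. Qed.
Let rep_lin k a b v : rep (k *: a + b) v = k *: rep a v + rep b v.
Proof. by case: hrep => _ -> _ _ _. Qed.
Section Dilation.
Context (K : hilbertType R) (j : {freeg S / R[i]} -> K) (lj : linear j) (dj : dense_map j).
Context (hj : forall p q, ip (j (gen p)) (j (gen q)) = family_kernel p q).

Let e t v : K := j (gen ((t, v) : S)).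

Let ipe s t v w : ip (e s v) (e t w) = ip (x (t^-1 * s)%g v) w.
Proof. exact: hj. Qed.

Let e_linear t : linear (e t).
Proof.
move=> k u v; apply: (gen_ip_inj lj dj) => -[s w].
by rewrite -/(e s w) ip_linearl !ipe (xb _).1 ip_linearl.
Qed.

Let ip_sums (l : seq (R[i] * S)) (g g' : S -> K) :
  ip (\sum_(p <- l) p.1 *: g p.2) (\sum_(q <- l) q.1 *: g' q.2) =
  \sum_(p <- l) \sum_(q <- l) p.1 * q.1^* * ip (g p.2) (g' q.2).
Proof.
rewrite ip_suml; apply: eq_bigr => p _; rewrite ipZl ip_sumr mulr_sumr.
by apply: eq_bigr => q _; rewrite ipZr mulrA.
Qed.

Lemma dilation_unitary_exists s : exists T : K -> K,
  [/\ linear T, bounded_by T 1 & forall t v, T (e t v) = e (s * t)%g v].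
Proof.
have [//||T [lT bT hT]] := @gen_extend _ _ _ j lj dj K (fun p => e (s * p.1)%g p.2) 1.
  move=> l; rewrite mul1r -ler_sqr ?nnegrE ?nrm_ge0 // -!ripuu /rip.
  rewrite (ip_sums l (fun p => e (s * p.1)%g p.2) (fun p => e (s * p.1)%g p.2)).
  rewrite (ip_sums l (fun p => j (gen p)) (fun p => j (gen p))).
  rewrite le_eqVlt; apply/orP; left; apply/eqP; congr complex.Re.
  apply: eq_bigr => p _; apply: eq_bigr => q _; congr (_ * _).
  by rewrite ipe hj /family_kernel invgM -mulgA mulKg.
by exists T; split=> // t v; exact: (hT (t, v)).
Qed.

Definition dilU s := sval (cid (dilation_unitary_exists s)).
Lemma dilU_linear s : linear (dilU s). Proof. by rewrite /dilU; case: cid => T []. Qed.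
Lemma dilU_bounded s : bounded_by (dilU s) 1. Proof. by rewrite /dilU; case: cid => T []. Qed.
Lemma dilUE s t v : dilU s (e t v) = e (s * t)%g v. Proof. by rewrite /dilU; case: cid => T []. Qed.
Lemma dilU_bop s : bounded_op (dilU s).
Proof. exact: bounded_opI (@dilU_linear s) (@dilU_bounded s). Qed.

Let move_coef t s b c v w :
  ip (e t (rep (alpha t^-1%g (b * c)) v)) (e s w) =
  ip (e t (rep (alpha t^-1%g c) v)) (e s (rep (alpha s^-1%g (star b)) w)).
Proof.
have [_ _ aM aS] := alpha_hom t^-1%g; have [_ _ _ aS'] := alpha_hom s^-1%g.
rewrite aM repM !ipe aS' -(rep_star _) -[x _ (rep _ _)]/((x (s^-1 * t)%g \o rep (alpha t^-1%g b)) _).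
by rewrite xcov -alphaM -mulgA mulgV mulg1.
Qed.

(** Boundedness of the dilated representation: for a fixed finite combination,
    [b |-> <rho b f, f>] is a positive functional on [A]. *)
Lemma dilation_rep_exists a : exists T : K -> K,
  [/\ linear T, bounded_by T (cn a) & forall t v, T (e t v) = e t (rep (alpha t^-1%g a) v)].
Proof.
have [||T [lT bT hT]] := @gen_extend _ _ _ j lj dj K (fun p => e p.1 (rep (alpha p.1^-1%g a) p.2)) (cn a).
- exact: cn_ge0.
- move=> l; pose g b (p : S) := e p.1 (rep (alpha p.1^-1%g b) p.2).
  pose Gam b := \sum_(p <- l) p.1 *: g b p.2.
  have lG : linear Gam.
    move=> k b c; rewrite /Gam scaler_sumr -big_split /=; apply: eq_bigr => p _.
    have [la _ _ _] := alpha_hom p.2.1^-1%g.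
    by rewrite /g la rep_lin e_linear scalerDr !scalerA (mulrC k).
  have move_gam b : ip (Gam (star b * b)) (Gam 1) = ip (Gam b) (Gam b).
    rewrite /Gam !ip_sums; apply: eq_bigr => p _; apply: eq_bigr => q _; congr (_ * _).
    rewrite move_coef starK; have [_ a1 _ _] := alpha_hom q.2.1^-1%g.
    by rewrite a1 rep1.
  have pf : pos_functional (fun b => ip (Gam b) (Gam 1)).
    split=> [k b c|b]; first by rewrite lG ip_linearl.
    by rewrite move_gam ipuu lecR sqr_ge0.
  have -> : \sum_(p <- l) p.1 *: j (gen p.2) = Gam 1.
    apply: eq_bigr => -[c [t v]] _; have [_ a1 _ _] := alpha_hom t^-1%g.
    by rewrite /g /= a1 rep1.
  rewrite -[X in nrm X <= _]/(Gam a) -ler_sqr ?nnegrE ?mulr_ge0 ?cn_ge0 ?nrm_ge0 //.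
  rewrite exprMn -!ripuu /rip -move_gam; exact: (pf_bound pf).
by exists T; split=> // t v; exact: (hT (t, v)).
Qed.

Definition dilR a := sval (cid (dilation_rep_exists a)).
Lemma dilR_linear a : linear (dilR a). Proof. by rewrite /dilR; case: cid => T []. Qed.
Lemma dilR_bounded a : bounded_by (dilR a) (cn a). Proof. by rewrite /dilR; case: cid => T []. Qed.
Lemma dilRE a t v : dilR a (e t v) = e t (rep (alpha t^-1%g a) v).
Proof. by rewrite /dilR; case: cid => T []. Qed.
Lemma dilR_bop a : bounded_op (dilR a).
Proof. exact: bounded_opI (@dilR_linear a) (@dilR_bounded a). Qed.

Let op_eq (T T' : K -> K) : bounded_op T -> bounded_op T' ->
  (forall t v, T (e t v) = T' (e t v)) -> T = T'.
Proof.
move=> bT bT' h; have [C _ hC] := bounded_opE bT; have [D _ hD] := bounded_opE bT'.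
by apply: (gen_op_eq lj dj bT.1 bT'.1 hC hD) => -[t v]; exact: h.
Qed.

Let op_adj (T T' : K -> K) : bounded_op T -> bounded_op T' ->
  (forall s v t w, ip (T (e s v)) (e t w) = ip (e s v) (T' (e t w))) -> adjoint T T'.
Proof. by move=> bT bT' h; apply: (gen_adjoint lj dj bT bT') => -[s v] [t w]; exact: h. Qed.

Lemma dilation_covariant : covariant_rep alpha dilR dilU.
Proof.
split.
- split.
  + exact: dilR_bop.
  + move=> k a b; apply: op_eq; [exact: dilR_bop | exact: bounded_op_lin (dilR_bop a) (dilR_bop b) |].
    move=> t v; have [la _ _ _] := alpha_hom t^-1%g.
    by rewrite opE !dilRE la rep_lin e_linear.
  + apply: op_eq; [exact: dilR_bop | exact: bounded_op_id |] => t v.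
    by have [_ a1 _ _] := alpha_hom t^-1%g; rewrite dilRE a1 rep1.
  + move=> a b; apply: op_eq; [exact: dilR_bop | exact: bounded_op_comp (dilR_bop a) (dilR_bop b) |].
    by move=> t v /=; have [_ _ aM _] := alpha_hom t^-1%g; rewrite !dilRE aM repM.
  + move=> a; apply: op_adj; [exact: dilR_bop..|] => s v t w.
    rewrite !dilRE -{1}[a]mulr1 move_coef.
    by have [_ a1 _ _] := alpha_hom s^-1%g; rewrite a1 rep1.
- split.
  + exact: dilU_bop.
  + apply: op_eq; [exact: dilU_bop | exact: bounded_op_id |] => t v.
    by rewrite dilUE mul1g.
  + move=> s t; apply: op_eq; [exact: dilU_bop | exact: bounded_op_comp (dilU_bop s) (dilU_bop t) |].
    by move=> r v /=; rewrite !dilUE mulgA.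
  + move=> t; apply: op_adj; [exact: dilU_bop..|] => s v r w.
    by rewrite !dilUE !ipe invgM invgK mulgA.
- move=> t a; apply: op_eq.
  + exact: bounded_op_comp (bounded_op_comp (dilU_bop _) (dilR_bop _)) (dilU_bop _).
  + exact: dilR_bop.
  move=> s v /=; rewrite dilUE dilRE dilUE dilRE mulgA mulgV mul1g invgM invgK.
  by rewrite alphaM.
Qed.

(** [F] compresses the representation given by the universal property along the
    isometry [v |-> e 1 v]. *)
Lemma dilation_map (B : cstarAlgType R) (iota : A -> B) (u : G -> B) :
  universal_crossed_product alpha iota u ->
  exists F : B -> H -> H, [/\ forall b, bounded_op (F b), F 1 = idfun, completely_positive F &
    forall a t, F (iota a * u t) = rep a \o x t].
Proof.
move=> hB; have [Th [sTh ThA ThU]] := ucp_universal hB dilation_covariant.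
have [Thb Thlin Th1 ThM Thst] := sTh.
pose V v := e 1%g v; have lV : linear V := e_linear 1%g.
have bV : bounded_by V 1.
  move=> v; rewrite mul1r -ler_sqr ?nnegrE ?nrm_ge0 // -!ripuu /rip ipe.
  by rewrite invg1 mul1g x1.
have [W [lW bW hW]] := adjoint_exists ler01 lV bV.
pose F b := W \o Th b \o V.
have ipF b v w : ip (F b v) w = ip (Th b (V v)) (V w).
  by rewrite ip_conj -hW -ip_conj.
have bF b : bounded_op (F b).
  have [C C0 hC] := bounded_opE (Thb b).
  apply: (@bounded_opI _ _ _ C) => [k v w|v].
    by rewrite /F /= lV (Thb b).1 lW.
  rewrite /F /=; apply: le_trans (bW _) _; rewrite mul1r; apply: le_trans (hC _) _.
  by rewrite ler_pM2l //; have := bV v; rewrite mul1r.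
have ip_inj (v w : H) : (forall z, ip v z = ip w z) -> v = w.
  by move=> h; apply: rip_inj => z; rewrite /rip h.
exists F; split=> //.
- by apply/funext => v; apply: ip_inj => w; rewrite ipF Th1 ipe invg1 mul1g x1.
- apply: gram_cp.
    move=> k b c; apply/funext => v; rewrite opE; apply: ip_inj => w.
    by rewrite ip_linearl !ipF Thlin opE ip_linearl.
  move=> n b v.
  have -> : \sum_i \sum_j0 ip (F (star (b i) * b j0) (v j0)) (v i) =
      ip (\sum_j0 Th (b j0) (V (v j0))) (\sum_i Th (b i) (V (v i))).
    rewrite ip_sumr; apply: eq_bigr => i _; rewrite ip_suml; apply: eq_bigr => i' _.
    by rewrite ipF ThM /= (adjoint_sym (Thst (b i))).
  by rewrite ipuu lecR sqr_ge0.
- move=> a t; apply/funext => v; apply: ip_inj => w /=.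
  rewrite ipF ThM ThA ThU /= dilUE mulg1 dilRE ipe invg1 mul1g.
  rewrite -[x t _]/((x t \o rep (alpha t^-1%g a)) v) xcov alphaK.
  by [].
Qed.

End Dilation.

Theorem family_dilation (B : cstarAlgType R) (iota : A -> B) (u : G -> B) :
  universal_crossed_product alpha iota u ->
  exists F : B -> H -> H, [/\ forall b, bounded_op (F b), F 1 = idfun, completely_positive F &
    forall a t, F (iota a * u t) = rep a \o x t].
Proof.
have [K [j [lj dj hj]]] := kolmogorov family_kernel_positive.
exact: dilation_map lj dj hj B iota u.
Qed.

End Stinespring.

(** * The crossed product *)

Section PosCS.
Context {R : realType} {B : cstarAlgType R} (f : B -> R[i]) (pf : pos_functional f).

Lemma pf_CS_norm x y : complex.Re `|f (star y * x)| ^+ 2 <=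
  complex.Re (f (star x * x)) * complex.Re (f (star y * y)).
Proof.
have [->|z0] := eqVneq (f (star y * x)) 0.
  by rewrite normr0 expr0n mulr_ge0 ?pf_re.
set c := (f (star y * x))^* / `|f (star y * x)|.
have cc : c^* * c = 1.
  rewrite mulrC -normCK /c normrM normfV normr_id norm_conjC mulfV ?expr1n //.
  by rewrite normr_eq0.
have := pf_CS pf (c *: x) y.
rewrite -!scalerAr starZ -!scalerAl scalerA (mulrC c) cc scale1r pfZ //.
by rewrite /c mulrAC (mulrC _ (f _)) -normCK expr2 mulfK // normr_eq0.
Qed.

End PosCS.

Section CrossedProduct.
Context {R : realType} {G : groupType} {A : cstarAlgType R} {alpha : G -> A -> A}.
Context {B : cstarAlgType R} {iota : A -> B} {u : G -> B}.
Context (hB : universal_crossed_product alpha iota u).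

Lemma crossed_vanish (f : B -> R[i]) (C : R) : scalar f ->
  (forall b, complex.Re `|f b| <= C * cn b) ->
  (forall a t, f (iota a * u t) = 0) -> forall b, f b = 0.
Proof.
move=> lf bf f0 b.
have fD x y : f (x + y) = f x + f y by rewrite -{1}[x]scale1r lf mul1r.
have f00 : f 0 = 0 by apply: (addrI (f 0)); rewrite -fD !addr0.
have fN x : f (- x) = - f x by apply/eqP; rewrite -addr_eq0 -fD addNr f00.
apply/normr0_eq0; rewrite (ge0_ReK (normr_ge0 _)); suff -> : complex.Re `|f b| = 0 by [].
apply: le_anti; rewrite ge0_Re // andbT; apply: le_epsP => e e0; rewrite add0r.
have C1 : 0 < `|C| + 1 by rewrite ltr_wpDl.
have [|n [a [t h]]] := ucp_dense hB b (_ : 0 < ((e / (`|C| + 1))%:C)%C).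
  by rewrite ltcR divr_gt0.
set c := \sum_i _ in h; have fc : f c = 0.
  by rewrite /c (big_morph f fD f00) big1.
have -> : f b = f (b - c) by rewrite fD fN fc subr0.
move: h; rewrite cnC ltcR ltr_pdivlMr // => h; apply: le_trans (bf _) (ltW (le_lt_trans _ h)).
rewrite mulrC; apply: ler_wpM2l; first exact: cn_ge0.
by apply: le_trans (ler_norm C) _; rewrite lerDl.
Qed.

Lemma pf_eq (f g : B -> R[i]) : pos_functional f -> pos_functional g ->
  (forall a t, f (iota a * u t) = g (iota a * u t)) -> f = g.
Proof.
move=> pf pg h; apply/funext => b; apply/eqP; rewrite -subr_eq0; apply/eqP.
apply: (@crossed_vanish (fun b => f b - g b) (complex.Re (f 1) + complex.Re (g 1))).
- by move=> k x y; rewrite pf.1 pg.1 mulrBr opprD addrACA.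
- move=> x; rewrite mulrC mulrDr.
  have := ler_normB (f x) (g x); rewrite lecE => /andP[_ h1].
  apply: le_trans h1 _; rewrite ReD; apply: lerD; exact: pf_norm.
- by move=> a t; rewrite h subrr.
Qed.

Lemma cp_eq {H : hilbertType R} (F F' : B -> H -> H) :
  (forall b, linear (F b)) -> (forall b, linear (F' b)) ->
  completely_positive F -> completely_positive F' -> F 1 = idfun -> F' 1 = idfun ->
  (forall a t, F (iota a * u t) = F' (iota a * u t)) -> F = F'.
Proof.
move=> lF lF' cF cF' F1 F1' h; apply/funext => b; apply/funext => v; apply: rip_inj => w.
rewrite /rip; congr complex.Re; apply/eqP; rewrite -subr_eq0; apply/eqP.
apply: (@crossed_vanish (fun b => ip (F b v) w - ip (F' b v) w) (2 * nrm v * nrm w)).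
- by move=> k x y; rewrite cF.1 cF'.1 !ip_linearl mulrBr opprD addrACA.
- move=> x; have := ler_normB (ip (F x v) w) (ip (F' x v) w); rewrite lecE => /andP[_ h1].
  apply: le_trans h1 _; rewrite ReD.
  have := ip_CS (F x v) w; have := ip_CS (F' x v) w.
  have := ler_wpM2r (nrm_ge0 w) (cp_norm lF cF F1 x v).
  have := ler_wpM2r (nrm_ge0 w) (cp_norm lF' cF' F1' x v); nra.
- by move=> a t; rewrite h subrr.
Qed.

Lemma crossed_uV t : star (u t) * u t = 1.
Proof. by rewrite -(ucp_uV hB) -(ucp_uM hB) mulVg (ucp_u1 hB). Qed.

Lemma crossed_swap t a : u t * iota a = iota (alpha t a) * u t.
Proof. by rewrite -(ucp_cov hB) -mulrA crossed_uV mulr1. Qed.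

End CrossedProduct.

(** * Weak expectations, positive families and traces *)

Section Main.
Context {R : realType} {G : groupType} {A : cstarAlgType R} {alpha : G -> A -> A}.
Context (halpha : cstar_action alpha) {tau : A -> R[i]} (htau : tracial_state tau).
Context (hinv : invariant_state alpha tau) {H : hilbertType R} { pi : A -> H -> H} {xi : H}.
Context (hGNS : GNS tau pi xi) {tauM : (H -> H) -> R[i]}.
Context (htauM : faithful_normal_trace (vN_gen pi) tauM).
Context (htauM_pi : forall a, tauM (pi a) = tau a).
Context {beta : G -> (H -> H) -> (H -> H)} (hbeta : vN_action (vN_gen pi) beta).
Context (hbeta_pi : forall s a, beta s (pi a) = pi (alpha s a)).

Local Notation M := (vN_gen pi).
Implicit Types (y z : H -> H).

Lemma beta_aut s : vN_automorphism M (beta s). Proof. by case: hbeta. Qed.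
Lemma beta_M s y : M y -> M (beta s y). Proof. exact: aut_M (beta_aut s) y. Qed.
Lemma betaK s y : M y -> beta s (beta s^-1%g y) = y.
Proof. by case: hbeta => _ b1 bM My; rewrite -bM // mulgV b1. Qed.
Lemma betaVK s y : M y -> beta s^-1%g (beta s y) = y.
Proof. by case: hbeta => _ b1 bM My; rewrite -bM // mulVg b1. Qed.
Lemma beta_mul s y z : M y -> M z -> beta s (y \o z) = beta s y \o beta s z.
Proof. exact: (vna_mul (beta_aut s)). Qed.

Lemma tauM_vector y : M y -> tauM y = ip (y xi) xi.
Proof.
have id_aut : vN_automorphism M id.
  by split=> //; split=> // y' My'; exists y'.
move=> My; have hn := normal_comp htauM id_aut id_aut (fun _ _ => erefl) (fun _ _ => erefl).
exact: (snt_vector htau hGNS hn htauM_pi My).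
Qed.

(** [tauM \o beta s] is another normal trace on [M] extending [tau]. *)
Lemma beta_vector s y : M y -> ip (beta s y xi) xi = ip (y xi) xi.
Proof.
move=> My; rewrite -tauM_vector; last exact: beta_M.
have hn := normal_comp htauM (beta_aut s) (beta_aut s^-1%g) (@betaK s) (@betaVK s).
apply: (snt_vector htau hGNS hn _ My) => a /=.
by rewrite hbeta_pi htauM_pi hinv.
Qed.

Lemma beta_nrm s y : M y -> nrm (beta s y xi) = nrm (y xi).
Proof.
move=> My; have [y' My' ay] := vN_adjoint htau hGNS My.
apply/eqP; rewrite -(@eqrXn2 _ 2) ?nrm_ge0 // -!ripuu /rip.
rewrite (vna_star (beta_aut s) My My' ay) ay; apply/eqP; congr complex.Re.
rewrite ip_conj [RHS]ip_conj; congr (_^*).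
by rewrite -[LHS]/(ip ((beta s y' \o beta s y) xi) xi) -beta_mul // beta_vector //; exact: vN_comp.
Qed.

(** By [beta_nrm], [beta t] is continuous in the norm of [xi]; right multiplication by
    [z] is bounded in that norm because [xi] is a trace vector.  Hence covariance
    passes from [pi(A)] to [M]. *)
Lemma covariance_extends t y z : M z -> (forall a, z \o pi a = pi (alpha t a) \o z) ->
  M y -> z \o y = beta t y \o z.
Proof.
move=> Mz cov My; have Mby := beta_M t My.
apply: (vN_separating htau hGNS); [exact: vN_comp | exact: vN_comp |] => /=.
have [z' Mz' az] := vN_adjoint htau hGNS Mz.
have [C C0 hC] := bounded_opE (vN_bop Mz'); have [D _ hD] := bounded_opE (vN_bop Mz).
have right_bound w : M w -> nrm (w (z xi)) <= C * nrm (w xi).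
  move=> Mw; have [w' Mw' aw] := vN_adjoint htau hGNS Mw.
  rewrite (vN_nrm_adjoint htau hGNS Mw aw).
  rewrite -[w (z xi)]/((w \o z) xi) (vN_nrm_adjoint htau hGNS (vN_comp Mw Mz) (adjoint_comp aw az)).
  exact: hC.
have [a ha] := vN_approx hGNS y.
have ta : tends (fun n => pi (a n) xi) (y xi) := tends_le ha cvg_half.
have t1 := tends_op (vN_linear Mz) hD ta.
apply: tends_uniq t1 _.
apply: (tends_le (f := fun n => C * 2^-1 ^+ n)); last exact/cvgM0/cvg_half.
move=> n; rewrite -[z (pi _ xi)]/((z \o pi (a n)) xi) cov /= -hbeta_pi.
have Mp : M (pi (a n)) by exact: (vN_pi hGNS).
have Md : M (pi (a n) - y) by exact: vN_B.
have -> : beta t (pi (a n)) (z xi) - beta t y (z xi) = beta t (pi (a n) - y) (z xi).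
  by rewrite (aut_B (beta_aut t)).
apply: le_trans (right_bound _ (beta_M t Md)) _; rewrite beta_nrm // ler_pM2l //.
Qed.

Context {B : cstarAlgType R} {iota : A -> B} {u : G -> B}.
Context (hB : universal_crossed_product alpha iota u).
Context {gamma : G -> B -> B} (hgamma : cstar_action gamma).
Context (hgamma_gen : forall s t a,
  gamma s (iota a * u t) = iota (alpha s a) * u (s * t * s^-1)%g).

Local Notation WE := (weak_expectations iota gamma pi M beta).
Local Notation PF := (positive_families M beta).
Local Notation TE := (trace_extensions iota tau).

Let iotaM a b : iota (a * b) = iota a * iota b.
Proof. by case: (ucp_hom hB). Qed.
Let iota1 : iota 1 = 1. Proof. by case: (ucp_hom hB). Qed.
Let iota_star a : iota (star a) = star (iota a). Proof. by case: (ucp_hom hB). Qed.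
Let iota_lin : linear iota. Proof. by case: (ucp_hom hB). Qed.
Let piM a b v : pi (a * b) v = pi a (pi b v). Proof. by rewrite (gnsM hGNS). Qed.
Let pi1 v : pi 1 v = v. Proof. by rewrite (gns1 hGNS). Qed.
Let Mpi a : M (pi a) := vN_pi hGNS a.

Lemma we_linear F b : WE F -> linear (F b).
Proof. by case=> MF _ _ _ _; exact: vN_linear. Qed.

(** [F] is multiplicative on [iota(A)], which puts [iota a] in its multiplicative
    domain. *)
Lemma we_left F a b v : WE F -> F (iota a * b) v = pi a (F b v).
Proof.
move=> hF; have lF b' := we_linear b' hF; case: hF => MF F1 cF _ Fi.
rewrite -Fi; apply: (cp_mul_left lF cF F1) => w.
by rewrite -iota_star -iotaM !Fi piM.
Qed.

Lemma we_right F a b v : WE F -> F (b * iota a) v = F b (pi a v).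
Proof.
move=> hF; have lF b' := we_linear b' hF; case: hF => MF F1 cF _ Fi.
rewrite -Fi; apply: (cp_mul_right lF cF F1) => w.
by rewrite -iota_star -iotaM !Fi piM.
Qed.

(** The positivity of the family is that of the image under [F] of the Gram matrix of
    the unitaries [star (u t)]. *)
Lemma we_family F : WE F -> PF (fun t => F (u t)).
Proof.
move=> hF; have [MF F1 cF eF Fi] := hF; split=> //; split.
- by rewrite (ucp_u1 hB).
- move=> t y My; apply: covariance_extends => // a; apply/funext => v /=.
  by rewrite -we_right // (crossed_swap hB) we_left.
- move=> s t; rewrite -eF; congr F.
  have := hgamma_gen s t 1; rewrite iota1 mul1r => ->.
  by case: (alpha_hom halpha s) => _ -> _ _; rewrite iota1 mul1r.
- move=> n f _ v; have := cp_gram cF (fun i => star (u (tnth f i))) v.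
  congr (0 <= _); apply: eq_bigr => i _; apply: eq_bigr => k _.
  by rewrite starK -(ucp_uV hB) -(ucp_uM hB).
Qed.

Lemma we_inj F F' : WE F -> WE F' -> (forall t, F (u t) = F' (u t)) -> F = F'.
Proof.
move=> hF hF' h; have lF b := we_linear b hF; have lF' b := we_linear b hF'.
have [_ F1 cF _ _] := hF; have [_ F1' cF' _ _] := hF'.
apply: (cp_eq hB) => // a t; apply/funext => v.
by rewrite !we_left // h.
Qed.

Lemma gamma_hom s : star_hom (gamma s). Proof. by case: hgamma. Qed.

(** [family_dilation] provides [F].  Commutation with the commutant and equivariance
    hold on the generators [iota a * u t] and pass to their closed span; for
    equivariance, both sides evaluated at [xi] are bounded by the norm of [b]. *)
Lemma family_we x : PF x -> exists2 F, WE F & (fun t => F (u t)) = x.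
Proof.
move=> [Mx [x1 xc xe xp]].
have [F [bF F1 cF Fgen]] : exists F : B -> H -> H, [/\ forall b, bounded_op (F b),
    F 1 = idfun, completely_positive F & forall a t, F (iota a * u t) = pi a \o x t].
  apply: (@family_dilation R G A alpha halpha H pi _ x _ x1 _ xp B iota u hB).
  - by case: hGNS.
  - by move=> t; exact: vN_bop (Mx t).
  - by move=> t a; rewrite xc // hbeta_pi.
have lF b : linear (F b) := (bF b).1.
have MF b : M (F b).
  split=> // S [bS cS]; apply/funext => v /=.
  have [S' _ aS] := bounded_op_adjoint bS; have [C C0 hC] := bounded_opE bS.
  apply: rip_inj => w; rewrite /rip [in RHS]aS; congr complex.Re.
  apply/eqP; rewrite -subr_eq0; apply/eqP.
  apply: (crossed_vanish hB (f := fun b => ip (F b (S v)) w - ip (F b v) (S' w))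
    (C := nrm (S v) * nrm w + nrm v * nrm (S' w))).
  - by move=> k b1 b2; rewrite cF.1 !ip_linearl mulrBr opprD addrACA.
  - move=> b'; have := ler_normB (ip (F b' (S v)) w) (ip (F b' v) (S' w)).
    rewrite lecE => /andP[_ h1]; apply: le_trans h1 _; rewrite ReD mulrDl.
    apply: lerD; apply: le_trans (ip_CS _ _) _; rewrite mulrAC;
      (apply: ler_wpM2r; [exact: nrm_ge0 | by rewrite mulrC; exact: cp_norm]).
  - move=> a t; rewrite Fgen -aS /=.
    have -> : pi a (x t (S v)) = S (pi a (x t v)).
      have [_ /(_ _ (conj bS cS)) cx] := vN_comp (Mpi a) (Mx t).
      by have /= -> := congr1 (fun f => f v) cx.
    by rewrite subrr.
exists F; last first.
  apply/funext => t; rewrite -[u t]mul1r -iota1 Fgen; apply/funext => v /=.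
  by rewrite pi1.
split=> //; last first.
  move=> a; rewrite -[iota a]mulr1 -(ucp_u1 hB) Fgen x1.
  by [].
move=> s b; apply: (vN_separating htau hGNS) => //; first exact: beta_M.
pose Fg c := F (gamma s c).
have [gl g1 gM gst] := gamma_hom s.
have cFg : completely_positive Fg.
  apply: gram_cp => [k c c'|n c v]; first by rewrite /Fg gl cF.1.
  have := cp_gram cF (fun i => gamma s (c i)) v; congr (0 <= _).
  by apply: eq_bigr => i _; apply: eq_bigr => k _; rewrite /Fg gM gst.
have Fg1 : Fg 1 = idfun by rewrite /Fg g1.
apply: rip_inj => w; rewrite /rip; congr complex.Re; apply/eqP; rewrite -subr_eq0; apply/eqP.
apply: (crossed_vanish hB (f := fun b => ip (Fg b xi) w - ip (beta s (F b) xi) w)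
    (C := 2 * nrm xi * nrm w)).
- move=> k b1 b2; rewrite cFg.1 cF.1 (vna_linear (beta_aut s)) // !opE !ip_linearl.
  by rewrite mulrBr opprD addrACA.
- move=> b'; have := ler_normB (ip (Fg b' xi) w) (ip (beta s (F b') xi) w).
  rewrite lecE => /andP[_ h1]; apply: le_trans h1 _; rewrite ReD.
  have := ip_CS (Fg b' xi) w; have := ip_CS (beta s (F b') xi) w; rewrite beta_nrm //.
  have := ler_wpM2r (nrm_ge0 w) (cp_norm lF cF F1 b' xi).
  have := ler_wpM2r (nrm_ge0 w) (cp_norm (fun c => lF (gamma s c)) cFg Fg1 b' xi).
  nra.
- move=> a t; rewrite /Fg hgamma_gen !Fgen beta_mul // hbeta_pi xe.
  by rewrite subrr.
Qed.

Lemma we_gen_value F a t : WE F -> tauM (F (iota a * u t)) = tauM (pi a \o F (u t)).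
Proof. by move=> hF; congr tauM; apply/funext => v; rewrite we_left. Qed.

Lemma we_state F b : WE F -> tauM (F b) = ip (F b xi) xi.
Proof. by case=> MF _ _ _ _; rewrite tauM_vector. Qed.

Lemma we_pos_functional F : WE F -> pos_functional (fun b => tauM (F b)).
Proof.
move=> hF; have [_ _ cF _ _] := hF; have [p1 p2] := cp_pf cF xi; split=> [k b c|b].
  by rewrite !we_state // p1.
by rewrite we_state.
Qed.

(** On generators, with [Y = pi a \o x (s t)], equivariance writes [x (t s)] as
    [beta t (x (s t))], so that both sides become the value of [w] at the product of
    [Y] and [pi (alpha t^-1 a')], in either order. *)
Lemma we_trace F : WE F -> TE (fun b => tauM (F b)).
Proof.
move=> hF; have [MF F1 cF eF Fi] := hF; have pf := we_pos_functional hF.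
have [Mx [x1 xc xe _]] := we_family hF.
split; last by move=> a; rewrite Fi htauM_pi.
split; [exact: pf.1 | by rewrite F1 (fnt_unit htauM) | exact: pf.2 |].
set sg := fun b => tauM (F b) in pf *.
(* the commutator functional vanishes as soon as it does on generators *)
have bound b c : complex.Re `|sg (b * c) - sg (c * b)| <= 2 * cn c * complex.Re (sg 1) * cn b.
  have := ler_normB (sg (b * c)) (sg (c * b)); rewrite lecE => /andP[_ h1].
  apply: le_trans h1 _; rewrite ReD.
  have p1 : 0 <= complex.Re (sg 1) by have := pf_re pf 1; rewrite star1 mulr1.
  have := pf_norm pf (b * c); have := pf_norm pf (c * b).
  have := ler_wpM2r p1 (cnM b c); have := ler_wpM2r p1 (cnM c b); nra.
have lcomm c : scalar (fun b => sg (b * c) - sg (c * b)).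
  move=> k b b'; rewrite mulrDl mulrDr -scalerAl -scalerAr !pf.1.
  by rewrite mulrBr opprD addrACA.
have gen a s a' t : sg (iota a * u s * (iota a' * u t)) = sg (iota a' * u t * (iota a * u s)).
  have prod b r b' q : iota b * u r * (iota b' * u q) = iota (b * alpha r b') * u (r * q)%g.
    by rewrite iotaM (ucp_uM hB) -!mulrA; congr (_ * _); rewrite !mulrA (crossed_swap hB).
  rewrite !prod /sg !we_gen_value // !tauM_vector; [|exact: vN_comp..] => /=.
  pose Y := pi a \o F (u (s * t)%g); have MY : M Y by exact: vN_comp.
  pose a1 := alpha t^-1%g a'.
  have e1 : pi (a' * alpha t a) \o F (u (t * s)%g) = beta t (pi a1 \o Y).
    rewrite (beta_mul t (Mpi a1) MY) (beta_mul t (Mpi a) (MF _)).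
    rewrite !hbeta_pi (alphaK halpha) xe; apply/funext => v /=; rewrite piM.
    by rewrite !mulgA mulgK.
  rewrite -[ip (pi (a' * _) _) _]/(ip ((pi (a' * alpha t a) \o F (u (t * s)%g)) xi) xi) e1.
  rewrite beta_vector; last exact: vN_comp.
  rewrite /= (vN_trace htau hGNS (Mpi a1) MY) /Y /= piM.
  have /= -> := congr1 (fun f => f xi) (xc (s * t)%g _ (Mpi a1)).
  by rewrite hbeta_pi /a1 -(alphaM halpha) mulgK.
move=> b c; apply/eqP; rewrite -subr_eq0; apply/eqP.
apply: (crossed_vanish hB (lcomm c)) => [b'|a s]; first exact: bound.
rewrite -opprB; apply/eqP; rewrite oppr_eq0; apply/eqP.
apply: (crossed_vanish hB (lcomm (iota a * u s))) => [b'|a' t]; first exact: bound.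
by rewrite gen subrr.
Qed.

Lemma trace_ext_eq sg sg' : tracial_state sg -> tracial_state sg' ->
  (forall a t, sg (iota a * u t) = sg' (iota a * u t)) -> sg = sg'.
Proof.
by move=> [l1 _ p1 _] [l2 _ p2 _] h; apply: (pf_eq hB) => //; split.
Qed.

(** [gamma s] is conjugation by [u s] on generators. *)
Lemma trace_gamma sg s b : TE sg -> sg (gamma s b) = sg b.
Proof.
move=> [[l1 _ p1 tr] _]; have [gl _ gM gst] := gamma_hom s.
have -> : sg (gamma s b) = (sg \o gamma s) b by [].
congr (_ b); apply: (pf_eq hB) => [||a t].
- split=> [k x y|x] /=; first by rewrite gl l1.
  by rewrite gM gst; exact: p1.
- by split.
- rewrite /= hgamma_gen -(ucp_cov hB) !(ucp_uM hB) (ucp_uV hB).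
  rewrite -!mulrA (mulrA (star (u s))) (crossed_uV hB) mul1r tr -!mulrA.
  by rewrite (crossed_uV hB) mulr1.
Qed.

Section TraceToExpectation.
Context (sg : B -> R[i]) (hsg : TE sg).

Let pf : pos_functional sg. Proof. by case: hsg => -[]. Qed.
Let sgC b c : sg (b * c) = sg (c * b). Proof. by case: hsg => -[]. Qed.
Let sg_iota a : sg (iota a) = tau a. Proof. by case: hsg. Qed.

Let Q b a c := sg (star (iota c) * (b * iota a)).

Let Q_bound b a c : complex.Re `|Q b a c| <= cn b * nrm (pi a xi) * nrm (pi c xi).
Proof.
rewrite -ler_sqr ?nnegrE ?mulr_ge0 ?cn_ge0 ?nrm_ge0 //; last exact: ge0_Re.
apply: le_trans (pf_CS_norm pf _ _) _; rewrite !exprMn !(gns_nrm2 hGNS) -!sg_iota.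
rewrite !iotaM !iota_star; apply: ler_wpM2r; first exact: pf_re.
exact: pf_mul_bound.
Qed.

(** [F b] is the operator of the form [(a, c) |-> sigma (c^* b a)] on the dense
    subspace [pi(A) xi]. *)
Lemma trace_operator_exists b : exists T : H -> H, [/\ linear T, bounded_by T (cn b) &
  forall a c, ip (T (pi a xi)) (pi c xi) = sg (star (iota c) * b * iota a)].
Proof.
have le := gns_vec_linear hGNS; have de := gns_dense hGNS.
have /choice[g hg] : forall a, exists v, nrm v <= cn b * nrm (pi a xi) /\
    forall c, (Q b a c)^* = ip (pi c xi) v.
  move=> a; apply: (riesz_dense le de); first by rewrite mulr_ge0 ?cn_ge0 ?nrm_ge0.
    move=> k c c'; rewrite /Q iota_lin starD starZ mulrDl -scalerAl pf.1 rmorphD rmorphM /=.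
    by rewrite conjCK.
  by move=> c; rewrite norm_conjC; exact: Q_bound.
have hQ a c : ip (g a) (pi c xi) = Q b a c.
  by have [_ h] := hg a; rewrite ip_conj -h conjCK.
have lg : linear g.
  move=> k a a'; apply: (dense_ip_inj de) => c; rewrite ip_linearl !hQ.
  by rewrite /Q iota_lin !mulrDr -!scalerAr pf.1.
have [|T [lT bT hT]] := extend_dense (cn_ge0 b) le de lg; first by move=> a; have [] := hg a.
by exists T; split=> // a c; rewrite hT hQ /Q mulrA.
Qed.

Definition trace_operator b := sval (cid (trace_operator_exists b)).
Local Notation F := trace_operator.

Let F_linear b : linear (F b). Proof. by rewrite /F; case: cid => T []. Qed.
Let F_bounded b : bounded_by (F b) (cn b). Proof. by rewrite /F; case: cid => T []. Qed.
Let FE b a c : ip (F b (pi a xi)) (pi c xi) = sg (star (iota c) * b * iota a).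
Proof. by rewrite /F; case: cid => T []. Qed.
Let F_bop b : bounded_op (F b). Proof. exact: bounded_opI (@F_linear b) (@F_bounded b). Qed.

Let op_eq (T T' : H -> H) : bounded_op T -> bounded_op T' ->
  (forall a c, ip (T (pi a xi)) (pi c xi) = ip (T' (pi a xi)) (pi c xi)) -> T = T'.
Proof.
move=> bT bT' h; have [C _ hC] := bounded_opE bT; have [D _ hD] := bounded_opE bT'.
apply: (dense_op_eq (gns_dense hGNS) bT.1 bT'.1 hC hD) => a.
by apply: (dense_ip_inj (gns_dense hGNS)) => c; exact: h.
Qed.

Let pi_ip a b : ip (pi a xi) (pi b xi) = tau (star b * a) := gns_ip hGNS a b.

(** Commutation with [rho d] is the trace property of [sg]. *)
Lemma trace_operator_M b : M (F b).
Proof.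
rewrite (vN_genE htau hGNS); split=> // d.
have br := rho_bop htau hGNS d.
apply: op_eq; [exact: bounded_op_comp | exact: bounded_op_comp |] => a c /=.
rewrite (rhoE htau hGNS) FE (rho_adjoint htau hGNS) (rhoE htau hGNS) FE.
rewrite !iotaM iota_star starM starK -!mulrA [RHS]sgC -!mulrA.
by [].
Qed.

Let F_lin k b c : F (k *: b + c) = k *: F b + F c.
Proof.
apply: op_eq; [by [] | exact: bounded_op_lin |] => a d.
by rewrite opE ip_linearl !FE mulrDr mulrDl -scalerAr -scalerAl pf.1.
Qed.

(** On vectors of [pi(A) xi] the Gram sum is the value of [sg] at a square. *)
Lemma trace_operator_cp : completely_positive F.
Proof.
apply: gram_cp; first exact: F_lin.
move=> n b v; have /choice[a ha] : forall i, exists a : nat -> A, tends (fun m => pi (a m) xi) (v i).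
  by move=> i; exact: (gns_dense hGNS).
pose Z (w : 'I_n -> H) := \sum_i \sum_j ip (F (star (b i) * b j) (w j)) (w i).
have Zpos m : 0 <= Z (fun i => pi (a i m) xi).
  rewrite (_ : Z _ = sg (star (\sum_i b i * iota (a i m)) * (\sum_j b j * iota (a j m)))).
    exact: pf.2.
  rewrite star_sum mulr_suml (pf_sum pf); apply: eq_bigr => i _.
  rewrite mulr_sumr (pf_sum pf); apply: eq_bigr => k _.
  by rewrite FE starM !mulrA.
have limsum (h : 'I_n -> 'I_n -> nat -> R) (l : 'I_n -> 'I_n -> R) :
    (forall i k, h i k @ \oo --> l i k) ->
    (fun m => \sum_i \sum_k h i k m) @ \oo --> \sum_i \sum_k l i k.
  have ls (g : 'I_n -> nat -> R) (l' : 'I_n -> R) : (forall i, g i @ \oo --> l' i) ->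
      (fun m => \sum_i g i m) @ \oo --> \sum_i l' i.
    move=> hg; elim: (index_enum _) => [|i s ih].
      by rewrite big_nil; under eq_fun do rewrite big_nil; exact: cvg_cst.
    by rewrite big_cons; under eq_fun do rewrite big_cons; exact: cvgD.
  by move=> hl; exact: (ls _ _ (fun i => ls _ _ (hl i))).
have tF i k : tends (fun m => F (star (b i) * b k) (pi (a k m) xi)) (F (star (b i) * b k) (v k)).
  exact: tends_op (@F_linear _) (@F_bounded _) (ha k).
have reZ w : complex.Re (Z w) = \sum_i \sum_k rip (F (star (b i) * b k) (w k)) (w i).
  by rewrite /Z Re_sum; apply: eq_bigr => i _; rewrite Re_sum.
have imD : {morph (@complex.Im R) : p q / p + q} by case=> ? ? [].
have imZ w : complex.Im (Z w) = \sum_i \sum_k rip (F (star (b i) * b k) (w k)) ('i%C *: w i).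
  rewrite /Z (big_morph _ imD (erefl : complex.Im (0 : R[i]) = 0)); apply: eq_bigr => i _.
  rewrite (big_morph _ imD (erefl : complex.Im (0 : R[i]) = 0)); apply: eq_bigr => k _.
  by rewrite ip_rip.
rewrite -/(Z v) ge0_complexP; apply/andP; split.
  apply/eqP; rewrite imZ.
  have h := limsum _ _ (fun i k => tends_rip (tF i k) (tendsZ 'i%C (ha i))).
  apply: rcvg_eq h (cvg_cst 0) _ => m.
  by rewrite -(imZ (fun i => pi (a i m) xi)); have := Zpos m; rewrite ge0_complexP => /andP[/eqP].
rewrite reZ; have h := limsum _ _ (fun i k => tends_rip (tF i k) (ha i)).
apply: (rcvg_le (cvg_cst 0) h) => m; rewrite -(reZ (fun i => pi (a i m) xi)).
by apply: ge0_Re; exact: Zpos.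
Qed.

Lemma trace_operator_we : WE F.
Proof.
have MF := trace_operator_M.
split=> //.
- apply: op_eq; [by [] | exact: bounded_op_id |] => a c.
  by rewrite FE mulr1 -iota_star -iotaM sg_iota pi_ip.
- exact: trace_operator_cp.
- move=> s b; apply: (vN_separating htau hGNS) => //; first exact: beta_M.
  apply: (dense_ip_inj (gns_dense hGNS)) => c.
  have [_ a1 _ aS] := alpha_hom halpha s^-1%g; have [_ _ _ aS'] := alpha_hom halpha s.
  have {1}<- : pi 1 xi = xi by rewrite pi1.
  rewrite FE iota1 mulr1.
  have -> : ip (beta s (F b) xi) (pi c xi) = ip (F b xi) (pi (alpha s^-1%g c) xi).
    rewrite -!(adjoint_sym (gns_star hGNS _)) -aS.
    rewrite -[RHS]/(ip ((pi (alpha s^-1%g (star c)) \o F b) xi) xi).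
    rewrite -(beta_vector s (vN_comp (Mpi _) (MF b))) (beta_mul s (Mpi _) (MF b)).
    by rewrite hbeta_pi (alphaK halpha).
  have <- : F b (pi 1 xi) = F b xi by rewrite pi1.
  rewrite FE iota1 mulr1 -[RHS](trace_gamma s _ hsg).
  have [_ _ gM gst] := gamma_hom s; rewrite gM gst; congr (sg (star _ * _)).
  rewrite -[iota (alpha _ _)]mulr1 -(ucp_u1 hB) hgamma_gen (alphaK halpha) mulg1 mulgV.
  by rewrite (ucp_u1 hB) mulr1.
- move=> a; apply: op_eq; [by [] | exact: vN_bop (Mpi a) |] => b c.
  rewrite FE -iota_star -!iotaM sg_iota -piM pi_ip.
  by rewrite mulrA.
Qed.

Lemma trace_operator_value a t : tauM (pi a \o F (u t)) = sg (iota a * u t).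
Proof.
rewrite tauM_vector; last exact: vN_comp (Mpi a) (trace_operator_M _).
rewrite /= (gns_star hGNS) -[X in F _ X]pi1 FE iota1 mulr1 iota_star starK.
by [].
Qed.

End TraceToExpectation.

(** The trace [tauM \o F] for the weak expectation [F] of [x]; off the positive
    families the value is a dummy. *)
Definition family_trace (x : G -> H -> H) : B -> R[i] :=
  match pselect (PF x) with
  | left hx => fun b => tauM (s2val (cid2 (family_we hx)) b)
  | right _ => fun=> 0
  end.

Lemma family_traceP x : PF x -> TE (family_trace x) /\
  forall a t, family_trace x (iota a * u t) = tauM (pi a \o x t).
Proof.
move=> hx; rewrite /family_trace; case: pselect => // hx'; case: cid2 => F hF Fx /=.
by split=> [|a t]; [exact: we_trace | rewrite we_gen_value // -Fx].
Qed.

Lemma family_trace_bij : set_bij PF TE family_trace.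
Proof.
split.
- by move=> x /family_traceP[].
- move=> x y /set_mem hx /set_mem hy e; apply/funext => t.
  have [Mx _] := hx; have [My _] := hy.
  apply: (vN_separating htau hGNS) => //; apply: (dense_ip_inj (gns_dense hGNS)) => a.
  rewrite -(adjoint_sym (gns_star hGNS _)) -[RHS](adjoint_sym (gns_star hGNS _)).
  have := (family_traceP hx).2 (star a) t; rewrite e (family_traceP hy).2.
  rewrite !tauM_vector; [|exact: vN_comp..].
  by [].
- move=> sg hsg; exists (fun t => trace_operator hsg (u t)).
    by apply: we_family; exact: trace_operator_we.
  have hPF : PF (fun t => trace_operator hsg (u t)) by apply: we_family; exact: trace_operator_we.
  have [[ht _] hv] := family_traceP hPF.
  apply: (trace_ext_eq ht hsg.1) => a t.
  by rewrite hv trace_operator_value.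
Qed.

End Main.

Theorem theorem1p2 (R : realType) (G : groupType)
  (A : cstarAlgType R) (alpha : G -> A -> A) (halpha : cstar_action alpha)
  (tau : A -> R[i]) (htau : tracial_state tau) (hinv : invariant_state alpha tau)
  (H : hilbertType R) (pi : A -> H -> H) (xi : H) (hGNS : GNS tau pi xi)
  (tauM : (H -> H) -> R[i])
  (htauM : faithful_normal_trace (vN_gen pi) tauM)
  (htauM_pi : forall a, tauM (pi a) = tau a)
  (beta : G -> (H -> H) -> (H -> H))
  (hbeta : vN_action (vN_gen pi) beta)
  (hbeta_pi : forall s a, beta s (pi a) = pi (alpha s a))
  (B : cstarAlgType R) (iota : A -> B) (u : G -> B)
  (hB : universal_crossed_product alpha iota u)
  (gamma : G -> B -> B) (hgamma : cstar_action gamma)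
  (hgamma_gen : forall s t a,
     gamma s (iota a * u t) = iota (alpha s a) * u (s * t * s^-1)%g) :
  set_bij (weak_expectations iota gamma pi (vN_gen pi) beta)
          (positive_families (vN_gen pi) beta)
          (fun F t => F (u t)) /\
  exists Phi : (G -> H -> H) -> (B -> R[i]),
    [/\ forall x, positive_families (vN_gen pi) beta x ->
          forall a t, Phi x (iota a * u t) = tauM (pi a \o x t),
        forall x, positive_families (vN_gen pi) beta x ->
          forall sigma : B -> R[i], tracial_state sigma ->
          (forall a t, sigma (iota a * u t) = tauM (pi a \o x t)) ->
          sigma = Phi x &
        set_bij (positive_families (vN_gen pi) beta)
                (trace_extensions iota tau) Phi].
Proof.
have famP := @family_traceP R G A alpha halpha tau htau hinv H pi xi hGNS tauM htauM
  htauM_pi beta hbeta hbeta_pi B iota u hB gamma hgamma hgamma_gen.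
split.
  split.
  - move=> F hF; exact: (we_family halpha htau hinv hGNS htauM htauM_pi hbeta hbeta_pi hB hgamma_gen hF).
  - move=> F F' /set_mem hF /set_mem hF' e.
    by apply: (we_inj hGNS hB hF hF') => t; exact: (congr1 (fun f => f t) e).
  - move=> x hx; have [F hF Fx] := family_we halpha htau hinv hGNS htauM htauM_pi hbeta
      hbeta_pi hB hgamma hgamma_gen hx.
    by exists F.
eexists; split; last exact: (family_trace_bij halpha htau hinv hGNS htauM htauM_pi hbeta
  hbeta_pi hB hgamma hgamma_gen).
- by move=> x hx; have [_] := famP x hx.
- move=> x hx sigma hs h; have [[ht _] hv] := famP x hx.
  by apply: (trace_ext_eq hB hs ht) => a t; rewrite h hv.
Qed.
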